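(* Let $s,t$ be complex numbers with $\mathrm{Re}\,s>-1$ and $\mathrm{Re}\,t>-1$, and put $Z(s,t;x-1,x+1)=\int_0^1|2\sin\pi\theta|^s|2\cos\pi\theta|^t\,d\theta$. Then: (i) \[Z(s,t;x-1,x+1)=\frac{\Gamma(s+1)\Gamma(t+1)}{\Gamma(\frac s2+1)\Gamma(\frac t2+1)\Gamma(\frac{s+t}{2}+1)}=\prod_{n=1}^\infty\frac{(1+\frac{s}{2n})(1+\frac{t}{2n})(1+\frac{s+t}{2n})}{(1+\frac sn)(1+\frac tn)}.\] (ii) Around $s=t=0$, \[Z(s,t;x-1,x+1)=\exp\left(\sum_{k=2}^\infty\frac{(-1)^k}{k}\zeta(k)\left\{(1-2^{-k})(s^k+t^k)-2^{-k}(s+t)^k\right\}\right),\] and this power series lies in $\mathbb{Q}[\pi^2,\zeta(3),\zeta(5),\dots][[s,t]]$. (iii) For all integers $k,l\ge0$, the number \[m(\underbrace{x-1,\dots,x-1}_k,\underbrace{x+1,\dots,x+1}_l)=\int_0^1(\log|2\sin\pi\theta|)^k(\log|2\cos\pi\theta|)^l\,d\theta\] belongs to $\mathbb{Q}[\pi^2,\zeta(3),\zeta(5),\zeta(7),\dots]$.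
   Context: $\zeta$ is the Riemann zeta function and $\Gamma$ the Gamma function. Note $|e^{2\pi i\theta}-1|=|2\sin\pi\theta|$ and $|e^{2\pi i\theta}+1|=|2\cos\pi\theta|$, so $Z(s,t;x-1,x+1)=\int_0^1|e^{2\pi i\theta}-1|^s|e^{2\pi i\theta}+1|^t\,d\theta$, and $m(P_1,\dots,P_l)=\int_0^1\prod_j\log|P_j(e^{2\pi i\theta})|\,d\theta$. *)

(* Defs.v *)
From HB Require Import structures.
From mathcomp Require Import all_boot all_order all_algebra.
From mathcomp Require Import all_classical all_reals all_analysis.
From mathcomp Require Import complex.
Set Implicit Arguments. Unset Strict Implicit. Unset Printing Implicit Defensive.
Import Order.TTheory GRing.Theory Num.Theory.
Import numFieldTopology.Exports numFieldNormedType.Exports.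
Local Open Scope classical_set_scope.
Local Open Scope ring_scope.
Local Open Scope complex_scope.

(* The complex numbers over R, as a numClosedFieldType: this alias lets
   MathComp-Analysis equip it with its norm (modulus) topology. *)
Definition Cx (R : realType) : numClosedFieldType := R[i].

Section Defs.
Variable R : realType.
Local Notation C := (Cx R).

Definition cexp (w : C) : C :=
  (expR (complex.Re w) * cos (complex.Im w)) +i* (expR (complex.Re w) * sin (complex.Im w)).

(* a ^ s for a real a > 0 and complex s, i.e. exp (s * ln a); (value 0 for a <= 0,
   which only occurs on Lebesgue-null sets below) *)
Definition cpowR (a : R) (s : C) : C :=
  if 0 < a then cexp (s * (ln a)%:C) else 0.

Definition cintegral (D : set R) (f : R -> C) : C :=
  (Rintegral lebesgue_measure D (fun x => complex.Re (f x)))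
  +i* (Rintegral lebesgue_measure D (fun x => complex.Im (f x))).

(* Euler's Gamma function (Euler integral, valid for Re z > 0) *)
Definition Gamma (z : C) : C :=
  cintegral `[0, +oo[ (fun x => cpowR x (z - 1) * (expR (- x))%:C).

Definition zeta (k : nat) : R := limn (series (fun n : nat => ((n.+1)%:R ^+ k)^-1 : R)).

Definition Zxx (s t : C) : C :=
  cintegral `[0, 1] (fun th => cpowR `|2 * sin (pi * th)| s * cpowR `|2 * cos (pi * th)| t).

Definition mxx (k l : nat) : R :=
  Rintegral lebesgue_measure `[0, 1]
    (fun th => (ln `|2 * sin (pi * th)|) ^+ k * (ln `|2 * cos (pi * th)|) ^+ l).

Inductive zeta_ring : R -> Prop :=
  | zr_rat (q : rat) : zeta_ring (ratr q)
  | zr_pi2 : zeta_ring (pi ^+ 2)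
  | zr_zeta (j : nat) : (1 <= j)%N -> zeta_ring (zeta j.*2.+1)
  | zr_add x y : zeta_ring x -> zeta_ring y -> zeta_ring (x + y)
  | zr_mul x y : zeta_ring x -> zeta_ring y -> zeta_ring (x * y).

Definition logZ_term (s t : C) (k : nat) : C :=
  ((-1) ^+ k / k%:R) * (zeta k)%:C *
  ((1 - (2 ^+ k)^-1) * (s ^+ k + t ^+ k) - (2 ^+ k)^-1 * (s + t) ^+ k).

End Defs.

(* Main.v *)
(* Put f = |2 sin (pi x)|, g = |2 cos (pi x)| and let Z(s, t) be the integral of f^s g^t.
   From f^2 + g^2 = 4 and integration by parts, Z(s + 2, t + 2) is an explicit rational
   multiple of Z(s, t), and the mass of (f g)^(2n) concentrates where f = g = sqrt 2, so
   Z(s + 2n, t + 2n) / Z(2n, 2n) tends to 2^((s + t) / 2): this is the product formula.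
   The same concentration argument for x^n e^(-x) gives Gauss's product for Gamma, hence
   the expression of Z by Gamma values.

   Truncating the logarithms of the factors of the product at degree m gives
   |Z(s, t) exp (- sum_(k <= m) logZ_term s t k) - 1| = O(r^(m+1)) for |s|, |t| <= r, and
   m -> oo is the exponential formula.  On the other hand, expanding
   f^s g^t = exp (s log f + t log g) under the integral shows that the coefficient of
   s^i t^j in Z is mxx i j / (i! j!).  Comparing both expansions along (s, t) = (a x, x) with
   a a natural number, the homogeneous part of degree n of Z has values in the ring of zeta
   values at (a, 1), and interpolation in a recovers its coefficients.

   For even zeta values, let b_k(n) be 4^k / (2k)! times the mean of x^(2k) on [0, pi / 2]
   for the weight cos^(2n) x.  Integration by parts gives
   b_k(n - 1) - b_k(n) = b_(k-1)(n) / n^2, hence the elementary symmetric functions of the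
   1 / m^2 are pi^(2k) / (2k + 1)!, and Newton's identities express zeta (2k) through them. *)
Require Import Defs.
From HB Require Import structures.
From mathcomp Require Import all_boot all_order all_algebra.
From mathcomp Require Import all_classical all_reals all_analysis.
From mathcomp Require Import measurable_realfun complex.
From mathcomp Require Import ring lra.
Import Order.TTheory GRing.Theory Num.Theory.
Import numFieldTopology.Exports numFieldNormedType.Exports.
Local Open Scope classical_set_scope.
Local Open Scope ring_scope.
Local Open Scope complex_scope.
Set Implicit Arguments.
Unset Strict Implicit.

(** * Complex numbers *)

Section ComplexBasics.
Variable R : realType.
Local Notation C := (Cx R).
Implicit Types z w : C.

(** The recurrence only relates Z(s, t) to Z(s + 2n, t + 2n), so asymptotic information is needed to
    determine Z. Division by Z(2n, 2n), whose own recurrence is explicit, turns this into a limit of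
    normalised means, for which a second-moment bound suffices. No complex logarithm and no
    uniqueness theorem for power series in two variables is used. Logarithms occur only as Taylor
    polynomials inside [cexp], with errors estimated by differentiation along the segment from 0 to
    w. In each factor the degree-one parts of the five logarithms add up to a multiple of s/2 + t/2
    + (s + t)/2 - s - t = 0; hence the sum over k starts at 2 and the errors are summable like
    1/n^2. Along a line, both expansions of Z become polynomials in x up to O(x^n), and their
    coefficients are compared. Interpolation divides only by differences of natural numbers, so it
    stays in a ring containing the rationals. The integrals are improper, with exponents down to -1,
    and |cos| has a corner at 1/2; integration by parts is therefore carried out on each arc, over
    compact intervals that exhaust it. *)

Definition Rez (z : C) : R := complex.Re z.
Definition Imz (z : C) : R := complex.Im z.

(** The norm of [C] takes values in [C]; estimates are done with this real-valued modulus
    instead. *)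
Definition cabs (z : C) : R := Num.sqrt (Rez z ^+ 2 + Imz z ^+ 2).

Lemma cabsE z : `|z| = (cabs z)%:C.
Proof. exact: normc_def. Qed.

Lemma ReD z w : Rez (z + w) = Rez z + Rez w.
Proof. by case: z w => a b [c d]. Qed.

Lemma ImD z w : Imz (z + w) = Imz z + Imz w.
Proof. by case: z w => a b [c d]. Qed.

Lemma ReN z : Rez (- z) = - Rez z.
Proof. by case: z. Qed.

Lemma ImN z : Imz (- z) = - Imz z.
Proof. by case: z. Qed.

Lemma ReM z w : Rez (z * w) =
  Rez z * Rez w - Imz z * Imz w.
Proof. by case: z w => a b [c d]. Qed.

Lemma ImM z w : Imz (z * w) =
  Rez z * Imz w + Imz z * Rez w.
Proof. by case: z w => a b [c d]. Qed.

Definition reimE := (ReD, ImD, ReN, ImN, ReM, ImM).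

Lemma eqC z w : Rez z = Rez w -> Imz z = Imz w -> z = w.
Proof. by case: z w => a b [c d] /= -> ->. Qed.

Lemma realC_nat n : (n%:R%:C : C) = n%:R.
Proof. exact: (rmorph_nat (real_complex R)). Qed.

Lemma realCX (x : R) n : ((x ^+ n)%:C : C) = (x%:C : C) ^+ n.
Proof. exact: (rmorphXn (real_complex R)). Qed.

Lemma realCM (x y : R) : ((x * y)%:C : C) = (x%:C : C) * y%:C.
Proof. exact: (rmorphM (real_complex R)). Qed.

Lemma realCD (x y : R) : ((x + y)%:C : C) = (x%:C : C) + y%:C.
Proof. exact: (rmorphD (real_complex R)). Qed.

Lemma realCN (x : R) : ((- x)%:C : C) = - (x%:C : C).
Proof. exact: (rmorphN (real_complex R)). Qed.

Lemma realCV (x : R) : ((x^-1)%:C : C) = (x%:C : C)^-1.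
Proof. exact: (fmorphV (real_complex R)). Qed.

Lemma realC_inj (x y : R) : (x%:C : C) = y%:C -> x = y.
Proof. by case. Qed.

Lemma cabs_ge0 z : 0 <= cabs z.
Proof. exact: sqrtr_ge0. Qed.

Lemma cabsD z w : cabs (z + w) <= cabs z + cabs w.
Proof. by rewrite -lecR realCD -!cabsE ler_normD. Qed.

Lemma cabsM z w : cabs (z * w) = cabs z * cabs w.
Proof. by apply: realC_inj; rewrite realCM -!cabsE normrM. Qed.

Lemma cabsN z : cabs (- z) = cabs z.
Proof. by apply: realC_inj; rewrite -!cabsE normrN. Qed.

Lemma cabsB z w : cabs (z - w) = cabs (w - z).
Proof. by rewrite -opprB cabsN. Qed.

Lemma cabsV z : cabs z^-1 = (cabs z)^-1.
Proof. by apply: realC_inj; rewrite realCV -!cabsE normfV. Qed.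

Lemma cabsX z n : cabs (z ^+ n) = cabs z ^+ n.
Proof. by apply: realC_inj; rewrite realCX -!cabsE normrX. Qed.

Lemma cabs_real (x : R) : cabs x%:C = `|x|.
Proof. by rewrite /cabs /= expr0n addr0 sqrtr_sqr. Qed.

Lemma cabs0 : cabs 0 = 0.
Proof. by rewrite -[0 in LHS]/(0%:C) cabs_real normr0. Qed.

Lemma cabs1 : cabs 1 = 1.
Proof. by rewrite -[1 in LHS]/(1%:C) cabs_real normr1. Qed.

Lemma cabs_nat n : cabs n%:R = n%:R.
Proof. by rewrite -realC_nat cabs_real normr_nat. Qed.

Lemma cabs_eq0 z : (cabs z == 0) = (z == 0).
Proof. by rewrite -[RHS]normr_eq0 cabsE eq_complex /= eqxx andbT. Qed.

Lemma cabs_gt0 z : (0 < cabs z) = (z != 0).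
Proof. by rewrite lt_def cabs_ge0 andbT cabs_eq0. Qed.

Lemma Re_le_cabs z : `|Rez z| <= cabs z.
Proof. by rewrite -sqrtr_sqr /cabs ler_wsqrtr// lerDl sqr_ge0. Qed.

Lemma Im_le_cabs z : `|Imz z| <= cabs z.
Proof. by rewrite -sqrtr_sqr /cabs ler_wsqrtr// lerDr sqr_ge0. Qed.

Lemma cabs_le z : cabs z <= `|Rez z| + `|Imz z|.
Proof.
rewrite -[leRHS]ger0_norm ?addr_ge0 // -sqrtr_sqr /cabs ler_wsqrtr//.
rewrite sqrrD !real_normK ?num_real // -addrA lerD2l lerDr mulrn_wge0 // mulr_ge0.
Qed.

Lemma cabs_sum I (s : seq I) (P : pred I) (F : I -> C) :
  cabs (\sum_(i <- s | P i) F i) <= \sum_(i <- s | P i) cabs (F i).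
Proof.
elim: s => [|i s IH]; first by rewrite !big_nil cabs0.
by rewrite !big_cons; case: ifP => // _; rewrite (le_trans (cabsD _ _))// lerD2l.
Qed.

Lemma cabs_lt z (e : R) : (`|z| < e%:C) = (cabs z < e).
Proof. by rewrite cabsE ltcR. Qed.

Lemma cvgCP (u : nat -> C) (l : C) :
  u @ \oo --> l <-> (fun n => cabs (u n - l)) @ \oo --> (0 : R).
Proof.
split.
  move=> /cvgrPdist_lt ul; apply/cvgrPdist_lt => e e0.
  have := ul e%:C; rewrite ltcR => /(_ e0); apply: filterS => n.
  by rewrite cabs_lt sub0r normrN ger0_norm ?cabs_ge0// cabsB.
move=> /cvgrPdist_lt ul; apply/cvgrPdist_lt => /= e e0.
(* In the partial order of [C], a positive number is real. *)
have /complex_realP[r re] : e \is Num.real by exact: gtr0_real.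
rewrite {}re in e0 *.
have := ul r; rewrite -ltcR => /(_ e0); apply: filterS => n.
by rewrite cabs_lt sub0r normrN ger0_norm ?cabs_ge0// cabsB.
Qed.

Lemma cvgC_ReIm (u : nat -> C) (l : C) :
  (fun n => Rez (u n)) @ \oo --> Rez l ->
  (fun n => Imz (u n)) @ \oo --> Imz l -> u @ \oo --> l.
Proof.
move=> /cvgr_dist_lt hr /cvgr_dist_lt hi; apply/cvgCP/cvgrPdist_lt => e e0.
have e20 : 0 < e / 2 by rewrite divr_gt0.
near=> n.
rewrite sub0r normrN ger0_norm ?cabs_ge0// (le_lt_trans (cabs_le _))//.
rewrite [ltRHS]splitr !reimE ltrD//.
  by rewrite distrC; near: n; exact: hr.
by rewrite distrC; near: n; exact: hi.
Unshelve. all: by end_near. Qed.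

Lemma cvg_Re (u : nat -> C) (l : C) : u @ \oo --> l ->
  (fun n => Rez (u n)) @ \oo --> Rez l.
Proof.
move=> /cvgCP ul; apply/cvgrPdist_lt => e e0.
move/cvgrPdist_lt : ul => /(_ _ e0); apply: filterS => n.
rewrite sub0r normrN ger0_norm ?cabs_ge0//; apply: le_lt_trans.
by rewrite distrC (le_trans _ (Re_le_cabs _))// !reimE.
Qed.

Lemma cvg_Im (u : nat -> C) (l : C) : u @ \oo --> l ->
  (fun n => Imz (u n)) @ \oo --> Imz l.
Proof.
move=> /cvgCP ul; apply/cvgrPdist_lt => e e0.
move/cvgrPdist_lt : ul => /(_ _ e0); apply: filterS => n.
rewrite sub0r normrN ger0_norm ?cabs_ge0//; apply: le_lt_trans.
by rewrite distrC (le_trans _ (Im_le_cabs _))// !reimE.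
Qed.

Lemma cvg_realC (u : nat -> R) (l : R) : u @ \oo --> l ->
  (fun n => (u n)%:C : C) @ \oo --> (l%:C : C).
Proof. by move=> ul; apply: cvgC_ReIm => //=; exact: cvg_cst. Qed.

Lemma cvg_cabs (u : nat -> C) (l : C) : u @ \oo --> l ->
  (fun n => cabs (u n)) @ \oo --> cabs l.
Proof.
move=> ul.
have h := @cvg_Re (fun n => `|u n| : C) (`|l| : C) (cvg_norm ul).
have E : (fun n => Rez `|u n|) = (fun n => cabs (u n)).
  by apply/funext => n; rewrite cabsE.
by rewrite E cabsE in h; exact: h.
Qed.

Lemma Re_cexp z : Rez (cexp z) = expR (Rez z) * cos (Imz z).
Proof. by []. Qed.

Lemma Im_cexp z : Imz (cexp z) = expR (Rez z) * sin (Imz z).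
Proof. by []. Qed.

Lemma cexp0 : cexp (0 : C) = 1.
Proof. by rewrite /cexp /= expR0 cos0 sin0 mulr1 mulr0. Qed.

Lemma cexpD z w : cexp (z + w) = cexp z * cexp w.
Proof.
by apply: eqC; rewrite !(Re_cexp, Im_cexp, reimE) expRD ?cosD ?sinD; ring.
Qed.

Lemma cexpN_mul z : cexp (- z) * cexp z = 1.
Proof. by rewrite -cexpD addNr cexp0. Qed.

Lemma cexp_neq0 z : cexp z != 0.
Proof.
by apply/eqP => h; have /eqP := cexpN_mul z; rewrite h mulr0 eq_sym oner_eq0.
Qed.

Lemma cexpN z : cexp (- z) = (cexp z)^-1.
Proof. by apply: (mulIf (cexp_neq0 z)); rewrite cexpN_mul mulVf ?cexp_neq0. Qed.

Lemma cexp_sum I (s : seq I) (P : pred I) (F : I -> C) :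
  cexp (\sum_(i <- s | P i) F i) = \prod_(i <- s | P i) cexp (F i).
Proof. by apply: (big_morph (@cexp R) cexpD cexp0). Qed.

Lemma cexp_real (x : R) : cexp (x%:C : C) = (expR x)%:C.
Proof. by apply: eqC; rewrite /cexp/= ?cos0 ?sin0 ?mulr1 ?mulr0. Qed.

Lemma cabs_cexp z : cabs (cexp z) = expR (Rez z).
Proof.
rewrite /cabs Re_cexp Im_cexp !exprMn -mulrDr cos2Dsin2 mulr1 sqrtr_sqr.
by rewrite ger0_norm // expR_ge0.
Qed.

Lemma cabs_cexp_le z : cabs (cexp z) <= expR (cabs z).
Proof. by rewrite cabs_cexp ler_expR (le_trans (ler_norm _)) ?Re_le_cabs. Qed.

Lemma cvg_cexp (u : nat -> C) (l : C) : u @ \oo --> l ->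
  (fun n => cexp (u n)) @ \oo --> cexp l.
Proof.
move=> ul; have hr := cvg_Re ul; have hi := cvg_Im ul.
have he := continuous_cvg _ (@continuous_expR R _) hr.
apply: cvgC_ReIm.
  under eq_cvg do rewrite Re_cexp.
  rewrite Re_cexp; apply: cvgM; [exact: he|].
  exact: (continuous_cvg _ (@continuous_cos R _) hi).
under eq_cvg do rewrite Im_cexp.
rewrite Im_cexp; apply: cvgM; [exact: he|].
exact: (continuous_cvg _ (@continuous_sin R _) hi).
Qed.

(** Componentwise derivative in a real variable, so that real calculus applies to each part. *)
Definition cderive (f : R -> C) (x : R) (d : C) :=
  is_derive x 1 (fun y => Rez (f y)) (Rez d) /\
  is_derive x 1 (fun y => Imz (f y)) (Imz d).

Lemma cderive_eq f x d d' : cderive f x d -> d = d' -> cderive f x d'.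
Proof. by move=> h <-. Qed.

Lemma cderive_cst (c : C) x : cderive (fun=> c) x 0.
Proof. by split; exact: is_derive_cst. Qed.

Lemma cderive_real (f : R -> R) (x d : R) : is_derive x 1 f d ->
  cderive (fun y => (f y)%:C) x d%:C.
Proof. by move=> h; split => //=; exact: is_derive_cst. Qed.

Lemma cderiveD f g x df dg : cderive f x df -> cderive g x dg ->
  cderive (fun y => f y + g y) x (df + dg).
Proof.
move=> [fr fi] [gr gi]; split; rewrite reimE.
  rewrite (_ : (fun y => _) = (fun y => Rez (f y)) + (fun y => Rez (g y))).
    exact: is_deriveD.
  by apply/funext => y; rewrite reimE.
rewrite (_ : (fun y => _) = (fun y => Imz (f y)) + (fun y => Imz (g y))).
  exact: is_deriveD.
by apply/funext => y; rewrite reimE.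
Qed.

Lemma cderiveM f g x df dg : cderive f x df -> cderive g x dg ->
  cderive (fun y => f y * g y) x (df * g x + f x * dg).
Proof.
move=> [fr fi] [gr gi]; split.
  rewrite (_ : (fun y => _) =
   (fun y => Rez (f y)) * (fun y => Rez (g y)) -
   (fun y => Imz (f y)) * (fun y => Imz (g y))); last first.
    by apply/funext => y; rewrite reimE.
  by apply: is_derive_eq; rewrite !(Re_cexp, Im_cexp, reimE) /GRing.scale/=; ring.
rewrite (_ : (fun y => _) =
 (fun y => Rez (f y)) * (fun y => Imz (g y)) +
 (fun y => Imz (f y)) * (fun y => Rez (g y))); last first.
  by apply/funext => y; rewrite reimE.
by apply: is_derive_eq; rewrite !(Re_cexp, Im_cexp, reimE) /GRing.scale/=; ring.
Qed.

Lemma cderive_cexp f x df : cderive f x df ->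
  cderive (fun y => cexp (f y)) x (df * cexp (f x)).
Proof.
move=> [fr fi]; split.
  rewrite (_ : (fun y => _) =
    (expR \o (fun y => Rez (f y))) * (cos \o (fun y => Imz (f y)))) //.
  by apply: is_derive_eq; rewrite !(Re_cexp, Im_cexp, reimE) /GRing.scale/=; ring.
rewrite (_ : (fun y => _) =
  (expR \o (fun y => Rez (f y))) * (sin \o (fun y => Imz (f y)))) //.
by apply: is_derive_eq; rewrite !(Re_cexp, Im_cexp, reimE) /GRing.scale/=; ring.
Qed.

End ComplexBasics.

(** * Taylor bounds *)

Section TaylorBounds.
Variable R : realType.
Local Notation C := (Cx R).
Implicit Types z w : C.

Lemma mvt01 (f df : R -> R) :
  (forall x : R, 0 <= x <= 1 -> is_derive x 1 f (df x)) ->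
  exists2 c, 0 <= c <= 1 & f 1 - f 0 = df c.
Proof.
move=> H.
have [||c cI ec] := @MVT_segment R f df 0 1 ler01.
- by move=> x; rewrite in_itv /= => /andP[/ltW x0 /ltW x1]; apply: H; rewrite x0.
- apply: derivable_within_continuous => x; rewrite in_itv /= => /H hx.
  exact: ex_derive.
by exists c; [move: cI; rewrite in_itv | rewrite ec subr0 mulr1].
Qed.

Lemma cderiveN (f : R -> C) (x : R) df : cderive f x df ->
  cderive (fun y => - f y) x (- df).
Proof.
move=> h; rewrite (_ : (fun y => _) = (fun y => -1 * f y)).
  by apply: cderive_eq (cderiveM (cderive_cst _ x) h) _; rewrite mul0r add0r mulN1r.
by apply/funext => y; rewrite mulN1r.
Qed.

(** The mean value theorem fails for complex values, so [f] is paired with the conjugate of its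
    increment d: Re (conj d * f) grows by |d|^2 and, by Cauchy-Schwarz, no faster than |d| h. *)
Lemma cderive_bound (f df : R -> C) (h dh : R -> R) :
  (forall x : R, 0 <= x <= 1 -> [/\ cderive f x (df x), is_derive x 1 h (dh x) &
     cabs (df x) <= dh x]) ->
  cabs (f 1 - f 0) <= h 1 - h 0.
Proof.
move=> H; set d := f 1 - f 0; set a := cabs d.
(* a h - Re (conj d * f) is nondecreasing *)
pose dc : C := Rez d +i* (- Imz d).
pose k (x : R) := Rez (a%:C * (h x)%:C - dc * f x).
pose dk (x : R) := Rez (a%:C * (dh x)%:C - dc * df x).
have kd (x : R) : 0 <= x <= 1 -> is_derive x 1 k (dk x).
  move=> /H[fd hd _].
  suff [] : cderive (fun x => a%:C * (h x)%:C - dc * f x) x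
    (a%:C * (dh x)%:C - dc * df x) by [].
  apply: cderiveD.
    by apply: cderive_eq (cderiveM (cderive_cst _ x) (cderive_real hd)) _; rewrite mul0r add0r.
  apply: cderiveN.
  by apply: cderive_eq (cderiveM (cderive_cst _ x) fd) _; rewrite mul0r add0r.
have cauchy (x : R) : 0 <= x <= 1 -> Rez (dc * df x) <= a * dh x.
  move=> /H[_ _ le]; apply: le_trans (ler_wpM2l (cabs_ge0 d) le).
  rewrite /a -cabsM.
  have -> : cabs (d * df x) = cabs (dc * df x).
    by rewrite !cabsM; congr (_ * _); rewrite /cabs /dc /= sqrrN.
  apply: le_trans (le_trans (ler_norm _) (Re_le_cabs _)).
  exact: lexx.
have [c cI ec] := mvt01 kd.
have [c' cI' ec'] : exists2 c, 0 <= c <= 1 & h 1 - h 0 = dh c.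
  by apply: mvt01 => x /H[].
have h01 : 0 <= h 1 - h 0.
  by rewrite ec'; have [_ _] := H _ cI'; apply: le_trans; exact: cabs_ge0.
have : 0 <= k 1 - k 0.
  by rewrite ec /dk ReD ReN [Rez (a%:C * _)]ReM /= mul0r subr0 subr_ge0 cauchy.
have -> : k 1 - k 0 = a * (h 1 - h 0) - a ^+ 2.
  rewrite /a /cabs sqr_sqrtr ?addr_ge0 ?sqr_ge0 // -/(cabs d) -/a /k !reimE /dc /=.
  have -> : Rez d = Rez (f 1) - Rez (f 0) by rewrite !reimE.
  have -> : Imz d = Imz (f 1) - Imz (f 0) by rewrite !reimE.
  by ring.
have [->//|a0] := eqVneq a 0.
have ap : 0 < a by rewrite lt_def a0 cabs_ge0.
by rewrite subr_ge0 expr2 ler_pM2l.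
Qed.

Lemma cderiveX (f : R -> C) (x : R) (df : C) n : cderive f x df ->
  cderive (fun y => f y ^+ n) x (n%:R * df * f x ^+ n.-1).
Proof.
move=> fd; elim: n => [|n IH].
  by apply: cderive_eq (cderive_cst _ _) _; rewrite !mul0r.
rewrite (_ : (fun y => _) = (fun y => f y * f y ^+ n)); last first.
  by apply/funext => y; rewrite exprS.
apply: cderive_eq (cderiveM fd IH) _ => /=.
case: n {IH} => [|n] /=; first by rewrite !mul0r !mulr0 addr0 mul1r mulr1.
by rewrite -[n.+2%:R]natr1 exprS; ring.
Qed.

Lemma cderive_id (x : R) : cderive (fun y => y%:C) x 1.
Proof. exact: cderive_eq (cderive_real (is_derive_id _ _)) _. Qed.

Lemma cderive_scal (x : R) w : cderive (fun y => y%:C * w) x w.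
Proof.
by apply: cderive_eq (cderiveM (cderive_id x) (cderive_cst w x)) _; rewrite mulr0 addr0 mul1r.
Qed.

Lemma realC0 : ((0 : R)%:C : C) = 0.
Proof. by []. Qed.

Lemma realC1 : ((1 : R)%:C : C) = 1.
Proof. by []. Qed.

Lemma cderive_sum n (F : nat -> R -> C) (dF : nat -> C) (x : R) :
  (forall k, cderive (F k) x (dF k)) ->
  cderive (fun y => \sum_(k < n) F k y) x (\sum_(k < n) dF k).
Proof.
move=> h; elim: n => [|n IH].
  rewrite big_ord0; under eq_fun do rewrite big_ord0; exact: cderive_cst.
rewrite big_ord_recr /=; under eq_fun do rewrite big_ord_recr.
exact: cderiveD.
Qed.

Definition expT n w : C := \sum_(k < n) w ^+ k / k`!%:R.

Lemma cderive_expT n w (x : R) :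
  cderive (fun y => expT n.+1 (y%:C * w)) x (w * expT n (x%:C * w)).
Proof.
pose dF k : C := (k%:R * w * (x%:C * w) ^+ k.-1) / k`!%:R.
apply: cderive_eq (@cderive_sum _ (fun k y => (y%:C * w) ^+ k / k`!%:R) dF _ _) _.
  move=> k; apply: cderive_eq (cderiveM (cderiveX k (cderive_scal x w)) (cderive_cst _ x)) _.
  by rewrite mulr0 addr0.
rewrite big_ord_recl /dF /= !mul0r add0r /expT big_distrr /=; apply: eq_bigr => k _.
rewrite /bump /= add1n add0n factS natrM invfM.
have : (k.+1%:R : C) != 0 by rewrite pnatr_eq0.
move: (k.+1%:R : C) (k`!%:R^-1 : C) => u v u0.
by field.
Qed.

(** Induction on [n] along the segment y w: the derivative in y of the remainder of order n + 1 is w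
    times the remainder of order n. Differentiating the factor exp (y a) of [h] adds a nonnegative
    term, which keeps the domination. *)
Lemma cabs_cexp_sub_expT n w :
  cabs (cexp w - expT n w) <= cabs w ^+ n / n`!%:R * expR (cabs w).
Proof.
elim: n w => [|n IH] w.
  by rewrite /expT big_ord0 subr0 expr0 fact0 divr1 mul1r cabs_cexp_le.
pose a := cabs w.
pose f (y : R) : C := cexp (y%:C * w) - expT n.+1 (y%:C * w).
pose df (y : R) : C := w * cexp (y%:C * w) - w * expT n (y%:C * w).
pose h (y : R) : R := (y * a) ^+ n.+1 / n.+1`!%:R * expR (y * a).
pose dh (y : R) : R := a * (y * a) ^+ n / n`!%:R * expR (y * a) + a * h y.
have F (x : R) : 0 <= x <= 1 ->
    [/\ cderive f x (df x), is_derive x 1 h (dh x) & cabs (df x) <= dh x].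
  move=> /andP[x0 x1]; split.
  - apply: cderiveD; first exact: cderive_cexp (cderive_scal _ _).
    exact/cderiveN/cderive_expT.
  - rewrite (_ : h = (cst (n.+1`!%:R^-1) * ((fun y => y * a) ^+ n.+1)) *
                     (expR \o (fun y => y * a))); last first.
      by apply/funext => y; rewrite /h !fctE /= /cst [X in X * _]mulrC.
    rewrite (_ : (fun y => y * a) = id * cst a) //.
    apply: is_derive_eq; rewrite /GRing.scale /= /dh /h factS natrM invfM.
    rewrite !fctE /= /cst.
    have : (n.+1%:R : R) != 0 by rewrite pnatr_eq0.
    move: (n.+1%:R : R) (n`!%:R^-1 : R) (expR _) ((x * a) ^+ n.+1) => u v e X u0.
    by field.
  - rewrite /df -mulrBr cabsM -/a.
    have -> : dh x = a * ((x * a) ^+ n / n`!%:R * expR (x * a)) + a * h x.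
      by rewrite /dh; ring.
    rewrite -[leLHS]addr0 lerD //; last first.
      by rewrite !mulr_ge0 ?exprn_ge0 ?mulr_ge0 ?cabs_ge0 ?expR_ge0 ?invr_ge0.
    rewrite ler_wpM2l ?cabs_ge0// (le_trans (IH _))//.
    by rewrite cabsM cabs_real ger0_norm.
have := cderive_bound F; rewrite /f /h !mul1r !mul0r expr0n /= !mul0r subr0.
rewrite cexp0 [X in _ - (_ - X)]/expT big_ord_recl expr0 fact0 divr1.
rewrite [X in 1 + X]big1 ?addr0 ?subrr ?subr0 //.
by move=> i _; rewrite expr0n mul0r.
Qed.

(** The Taylor polynomial of log (1 + w), of degree K because of the index shift; [expT n] stops at
    degree n - 1. *)
Definition logT K w : C := \sum_(k < K) (-1) ^+ k * w ^+ k.+1 / k.+1%:R.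

Lemma cderive_logT K w (x : R) :
  cderive (fun y => logT K (y%:C * w)) x (w * \sum_(k < K) (- (x%:C * w)) ^+ k).
Proof.
pose dF k : C := (-1) ^+ k * (k.+1%:R * w * (x%:C * w) ^+ k) / k.+1%:R.
apply: cderive_eq (@cderive_sum _ (fun k y => (-1) ^+ k * (y%:C * w) ^+ k.+1 / k.+1%:R) dF _ _) _.
  move=> k; apply: cderive_eq (cderiveM (cderiveM (cderive_cst _ x)
    (cderiveX k.+1 (cderive_scal x w))) (cderive_cst _ x)) _.
  by rewrite mulr0 addr0 mul0r add0r.
rewrite big_distrr /=; apply: eq_bigr => k _.
rewrite /dF [in RHS]exprNn; field.
by rewrite nat1r pnatr_eq0.
Qed.

Lemma sum_geometric_N K w : (1 + w) * \sum_(k < K) (- w) ^+ k = 1 - (- w) ^+ K.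
Proof.
elim: K => [|K IH]; first by rewrite big_ord0 mulr0 expr0 subrr.
by rewrite big_ord_recr /= mulrDr IH exprS; ring.
Qed.

Lemma cabs_logT_le K w : cabs w <= 2^-1 -> cabs (logT K w) <= 2 * cabs w.
Proof.
move=> w2; apply: le_trans (cabs_sum _ _ _) _.
have : \sum_(k < K) cabs ((-1) ^+ k * w ^+ k.+1 / k.+1%:R) <=
   \sum_(k < K) cabs w * 2^-1 ^+ k.
  apply: ler_sum => k _; rewrite !cabsM !cabsX cabsN cabs1 expr1n mul1r cabsV cabs_nat.
  rewrite exprS -mulrA ler_wpM2l ?cabs_ge0// -[leRHS]mulr1 ler_pM //.
  - by rewrite exprn_ge0 ?cabs_ge0.
  - by rewrite lerXn2r // nnegrE ?cabs_ge0.
  - by rewrite invf_le1 ?ltr0n // ler1n.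
move=> /le_trans; apply; rewrite -mulr_sumr mulrC ler_wpM2r ?cabs_ge0//.
have -> : \sum_(k < K) 2^-1 ^+ k = 2 - 2 * 2^-1 ^+ K :> R.
  elim: K => [|K IH]; first by rewrite big_ord0 expr0 mulr1 subrr.
  by rewrite big_ord_recr /= IH exprS; field.
by rewrite lerBlDr lerDl mulr_ge0 ?exprn_ge0.
Qed.

(** Along y w the derivative of exp (- logT) (1 + y w) collapses to w exp (- logT) (- y w)^K, since
    the geometric sum cancels all other terms. The exponential is at most exp 1, as |logT| <= 2 |w|
    <= 1. *)
Lemma cexp_logT_bound K w : cabs w <= 2^-1 ->
  cabs (cexp (- logT K w) * (1 + w) - 1) <= expR 1 * cabs w ^+ K.+1.
Proof.
move=> w2; pose a := cabs w.
pose f (y : R) : C := cexp (- logT K (y%:C * w)) * (1 + y%:C * w).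
pose df (y : R) : C := w * cexp (- logT K (y%:C * w)) * (- (y%:C * w)) ^+ K.
pose c := expR 1 * a ^+ K.+1.
have F (x : R) : 0 <= x <= 1 ->
    [/\ cderive f x (df x), is_derive x 1 (fun y => y * c) c & cabs (df x) <= c].
  move=> /andP[x0 x1]; split.
  - have d1 := cderiveM (cderive_cst (-1) x) (cderive_logT K w x).
    have d2 := cderiveD (cderive_cst 1 x) (cderive_scal x w).
    rewrite /f; under eq_fun do rewrite -mulN1r.
    apply: cderive_eq (cderiveM (cderive_cexp d1) d2) _.
    rewrite mul0r add0r mulN1r /df.
    have := sum_geometric_N K (x%:C * w); set S := \sum_(k < K) _.
    set u := x%:C * w => h.
    have -> : (- u) ^+ K = 1 - (1 + u) * S by rewrite h; ring.
    by rewrite mulN1r; ring.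
  - rewrite (_ : (fun y => y * c) = id * cst c) //.
    by apply: is_derive_eq; rewrite /GRing.scale/= mulr0 add0r mulr1.
  - rewrite /df !cabsM cabsX cabsN cabsM cabs_real ger0_norm // -/a /c exprS mulrCA -mulrA.
    have a0 : 0 <= a by exact: cabs_ge0.
    have xa : x * a <= a by rewrite ler_piMl.
    rewrite ler_wpM2l // ler_pM ?cabs_ge0 ?exprn_ge0 ?mulr_ge0 //.
      rewrite (le_trans (cabs_cexp_le _)) // ler_expR cabsN.
      rewrite (le_trans (cabs_logT_le _ _)) // cabsM cabs_real ger0_norm // -/a.
        by rewrite (le_trans xa).
      rewrite -ler_pdivlMl // mulr1 (le_trans xa) //.
    by rewrite lerXn2r // nnegrE ?mulr_ge0.
have := cderive_bound F; rewrite /f realC1 realC0 !(mul1r, mul0r) addr0 subr0.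
have -> : logT K 0 = 0.
  rewrite /logT big1 // => k _.
  by rewrite expr0n /= mulr0 mul0r.
by rewrite oppr0 cexp0 mul1r.
Qed.

End TaylorBounds.

(** * Integrals of complex-valued functions *)

Section ComplexIntegral.
Variable R : realType.
Local Notation C := (Cx R).
Local Notation mu := (@lebesgue_measure R).
Implicit Types (D : set R) (f g : R -> C).

Definition rintegrable D (f : R -> R) := mu.-integrable D (EFin \o f).

Lemma le_rintegrable D (f g : R -> R) : measurable D -> measurable_fun D f ->
  (forall x, D x -> `|f x| <= g x) -> rintegrable D g -> rintegrable D f.
Proof.
move=> mD mf fg; apply: le_integrable => //; first exact/measurable_EFinP.
by move=> x Dx /=; rewrite lee_fin (le_trans (fg _ Dx)) ?ler_norm.
Qed.

Lemma rintegrable_measurable D (f : R -> R) : rintegrable D f -> measurable_fun D f.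
Proof. by move=> /(measurable_int mu) /measurable_EFinP. Qed.

Lemma rintegrableD D (f g : R -> R) : measurable D -> rintegrable D f -> rintegrable D g ->
  rintegrable D (fun x => f x + g x).
Proof. by move=> mD hf hg; exact: integrableD hf hg. Qed.

Lemma rintegrableZ D (k : R) (f : R -> R) : measurable D -> rintegrable D f ->
  rintegrable D (fun x => k * f x).
Proof. by move=> mD hf; exact: (@integrableZl _ (measurableTypeR R) R mu D mD k _ hf). Qed.

Lemma rintegrableB D (f g : R -> R) : measurable D -> rintegrable D f -> rintegrable D g ->
  rintegrable D (fun x => f x - g x).
Proof. by move=> mD hf hg; exact: integrableB hf hg. Qed.

Lemma eq_rintegrable D (f g : R -> R) : measurable D -> (forall x, D x -> f x = g x) ->
  rintegrable D f -> rintegrable D g.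
Proof.
move=> mD fg; apply: eq_integrable => // x /set_mem Dx /=; by rewrite fg.
Qed.

Lemma eq_Rint D (f g : R -> R) : (forall x, D x -> f x = g x) ->
  Rintegral mu D f = Rintegral mu D g.
Proof. by move=> fg; apply: eq_Rintegral => x /set_mem /fg. Qed.

Definition cintegrable D f :=
  rintegrable D (fun x => Rez (f x)) /\ rintegrable D (fun x => Imz (f x)).

Definition cmeasurable D f :=
  measurable_fun D (fun x => Rez (f x)) /\ measurable_fun D (fun x => Imz (f x)).

Lemma Re_cintegral D f : Rez (cintegral D f) = Rintegral mu D (fun x => Rez (f x)).
Proof. by []. Qed.

Lemma Im_cintegral D f : Imz (cintegral D f) = Rintegral mu D (fun x => Imz (f x)).
Proof. by []. Qed.

Lemma eq_cintegral D f g : (forall x, D x -> f x = g x) -> cintegral D f = cintegral D g.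
Proof.
move=> fg; apply: eqC; rewrite !(Re_cintegral, Im_cintegral);
by apply: eq_Rint => x /fg ->.
Qed.

Lemma eq_cintegrable D f g : measurable D -> (forall x, D x -> f x = g x) ->
  cintegrable D f -> cintegrable D g.
Proof.
by move=> mD fg [fr fi]; split; [move: fr|move: fi]; apply: eq_rintegrable => // x /fg ->.
Qed.

Lemma le_cintegrable D f (g : R -> R) : measurable D -> cmeasurable D f ->
  (forall x, D x -> cabs (f x) <= g x) -> rintegrable D g -> cintegrable D f.
Proof.
move=> mD [mr mi] fg ig; split; apply: le_rintegrable ig => // x Dx;
by apply: le_trans (fg _ Dx); rewrite ?Re_le_cabs ?Im_le_cabs.
Qed.

Lemma cintegrable_measurable D f : cintegrable D f -> cmeasurable D f.
Proof. by move=> [/rintegrable_measurable ? /rintegrable_measurable ?]. Qed.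

Lemma cintegrableD D f g : measurable D -> cintegrable D f -> cintegrable D g ->
  cintegrable D (fun x => f x + g x).
Proof.
move=> mD [fr fi] [gr gi]; split.
  by apply: eq_rintegrable (rintegrableD mD fr gr) => // x _; rewrite reimE.
by apply: eq_rintegrable (rintegrableD mD fi gi) => // x _; rewrite reimE.
Qed.

Lemma cintegralD D f g : measurable D -> cintegrable D f -> cintegrable D g ->
  cintegral D (fun x => f x + g x) = cintegral D f + cintegral D g.
Proof.
move=> mD [fr fi] [gr gi]; apply: eqC; rewrite !reimE !(Re_cintegral, Im_cintegral).
  by rewrite -RintegralD//; apply: eq_Rint => x _; rewrite reimE.
by rewrite -RintegralD//; apply: eq_Rint => x _; rewrite reimE.
Qed.

Lemma cintegrableZ D (k : C) f : measurable D -> cintegrable D f ->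
  cintegrable D (fun x => k * f x).
Proof.
move=> mD [fr fi]; split.
  apply: eq_rintegrable (rintegrableB mD (rintegrableZ (Rez k) mD fr)
    (rintegrableZ (Imz k) mD fi)) => // x _; by rewrite reimE.
apply: eq_rintegrable (rintegrableD mD (rintegrableZ (Rez k) mD fi)
  (rintegrableZ (Imz k) mD fr)) => // x _; by rewrite reimE.
Qed.

Lemma cintegralZ D (k : C) f : measurable D -> cintegrable D f ->
  cintegral D (fun x => k * f x) = k * cintegral D f.
Proof.
move=> mD [fr fi]; apply: eqC; rewrite !reimE !(Re_cintegral, Im_cintegral).
  rewrite -!RintegralZl// -RintegralB//; try exact: rintegrableZ.
  by apply: eq_Rint => x _; rewrite reimE.
rewrite -!RintegralZl// -RintegralD//; try exact: rintegrableZ.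
by apply: eq_Rint => x _; rewrite reimE.
Qed.

Lemma cintegrableB D f g : measurable D -> cintegrable D f -> cintegrable D g ->
  cintegrable D (fun x => f x - g x).
Proof.
move=> mD hf hg; apply: eq_cintegrable (cintegrableD mD hf (cintegrableZ (-1) mD hg)) => //.
by move=> x _; rewrite mulN1r.
Qed.

Lemma cintegralB D f g : measurable D -> cintegrable D f -> cintegrable D g ->
  cintegral D (fun x => f x - g x) = cintegral D f - cintegral D g.
Proof.
move=> mD hf hg; rewrite -mulN1r -cintegralZ// -cintegralD//; last exact: cintegrableZ.
by apply: eq_cintegral => x _; rewrite mulN1r.
Qed.

Lemma cintegral0 D : cintegral D (fun=> 0) = 0.
Proof.
by apply: eqC; rewrite !(Re_cintegral, Im_cintegral) /= /Rintegral integral0_eq.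
Qed.

Lemma cintegrable0 D : measurable D -> cintegrable D (fun=> 0).
Proof. by move=> mD; split; exact: integrable0. Qed.

Lemma cintegrable_sum D n (F : nat -> R -> C) : measurable D ->
  (forall i, cintegrable D (F i)) -> cintegrable D (fun x => \sum_(i < n) F i x).
Proof.
move=> mD h; elim: n => [|n IH].
  apply: eq_cintegrable (cintegrable0 mD) => // x _; by rewrite big_ord0.
apply: eq_cintegrable (cintegrableD mD IH (h n)) => // x _; by rewrite big_ord_recr.
Qed.

Lemma cintegral_sum D n (F : nat -> R -> C) : measurable D ->
  (forall i, cintegrable D (F i)) ->
  cintegral D (fun x => \sum_(i < n) F i x) = \sum_(i < n) cintegral D (F i).
Proof.
move=> mD h; elim: n => [|n IH].
  rewrite [RHS]big_ord0; apply: etrans (cintegral0 D).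
  by apply: eq_cintegral => x _; rewrite big_ord0.
rewrite big_ord_recr /= -IH -cintegralD//; last exact: cintegrable_sum.
by apply: eq_cintegral => x _; rewrite big_ord_recr.
Qed.

Lemma cintegrable_real D (f : R -> R) : measurable D -> rintegrable D f ->
  cintegrable D (fun x => (f x)%:C).
Proof. by move=> mD h; split => //; exact: integrable0. Qed.

Lemma cintegral_real D (f : R -> R) : cintegral D (fun x => (f x)%:C) = (Rintegral mu D f)%:C.
Proof. by apply: eqC => //; rewrite Im_cintegral /= /Rintegral integral0_eq. Qed.

Lemma Rintegral_le D (f g : R -> R) : measurable D -> rintegrable D f -> rintegrable D g ->
  (forall x, D x -> f x <= g x) -> Rintegral mu D f <= Rintegral mu D g.
Proof. by move=> mD hf hg fg; exact: le_Rintegral. Qed.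

(** The factor 2 comes from bounding the real and imaginary parts separately. *)
Lemma cabs_cintegral_le D f (g : R -> R) : measurable D -> cintegrable D f ->
  rintegrable D g -> (forall x, D x -> cabs (f x) <= g x) ->
  cabs (cintegral D f) <= 2 * Rintegral mu D g.
Proof.
move=> mD [fr fi] ig fg; apply: le_trans (cabs_le _) _.
rewrite !(Re_cintegral, Im_cintegral) mulr_natl mulr2n lerD//.
  rewrite (le_trans (@le_normr_Rintegral _ (measurableTypeR R) R mu D _ mD fr))//; apply: le_Rintegral => //.
    exact: (integrable_norm fr).
  by move=> x Dx; apply: le_trans (fg x Dx); exact: Re_le_cabs.
rewrite (le_trans (@le_normr_Rintegral _ (measurableTypeR R) R mu D _ mD fi))//; apply: le_Rintegral => //.
  exact: (integrable_norm fi).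
by move=> x Dx; apply: le_trans (fg x Dx); exact: Im_le_cabs.
Qed.

End ComplexIntegral.

(** * Fundamental theorem of calculus on a set exhausted by compact intervals *)

Section FTC.
Variable R : realType.
Local Notation C := (Cx R).
Local Notation mu := (@lebesgue_measure R).
Variables (a b : nat -> R) (D : set R).
Hypothesis ab : forall n, a n < b n.
Hypothesis a_noninc : {homo a : m n / (m <= n)%N >-> n <= m}.
Hypothesis b_nondec : {homo b : m n / (m <= n)%N >-> m <= n}.
Hypothesis DE : D = \bigcup_n `[a n, b n]%classic.

Lemma exhausted_measurable : measurable D.
Proof. by rewrite DE; exact: bigcup_measurable. Qed.

Lemma exhausted_subset n : `[a n, b n] `<=` D.
Proof. by rewrite DE => x xn; exists n. Qed.

Lemma exhausted_nondecreasing : nondecreasing_seq (fun n => `[a n, b n]%classic).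
Proof.
move=> m n mn; rewrite subsetEset => x /=; rewrite !in_itv /= => /andP[h1 h2].
by rewrite (le_trans (a_noninc mn)) //= (le_trans h2) // b_nondec.
Qed.

Lemma exhausted_continuous_measurable (f : R -> R) :
  {in D, continuous f} -> measurable_fun D f.
Proof.
move=> cf; rewrite {1}DE; apply/measurable_fun_bigcup => // n.
apply: subspace_continuous_measurable_fun => //.
apply: continuous_in_subspaceT => x /set_mem xn; apply: cf; apply/mem_set.
exact: exhausted_subset xn.
Qed.

Lemma ftc_piece (F f : R -> R) n :
  {in D, continuous f} -> (forall x, D x -> is_derive x 1 F (f x)) ->
  (\int[mu]_(x in `[a n, b n]) (f x)%:E = (F (b n) - F (a n))%:E)%E.
Proof.
move=> cf dF; rewrite EFinB; apply: continuous_FTC2 => //.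
- apply: continuous_in_subspaceT => x /set_mem xn; apply: cf; apply/mem_set.
  exact: exhausted_subset xn.
- have cF x : D x -> F @ x --> F x.
    move=> /dF h; apply: differentiable_continuous; apply/derivable1_diffP.
    exact: ex_derive.
  split.
  + move=> x xn; have /dF h : D x.
      by apply: (@exhausted_subset n); move: xn; rewrite /= !in_itv/= => /andP[/ltW -> /ltW ->].
    exact: ex_derive.
  + apply: cvg_at_right_filter; apply: cF; apply: (@exhausted_subset n).
    by rewrite /= in_itv/= lexx ltW.
  + apply: cvg_at_left_filter; apply: cF; apply: (@exhausted_subset n).
    by rewrite /= in_itv/= lexx ltW.
- move=> x xn; have /dF h : D x.
    by apply: (@exhausted_subset n); move: xn; rewrite /= !in_itv/= => /andP[/ltW -> /ltW ->].
  by rewrite derive1E derive_val.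
Qed.

(** Monotone convergence gives integrability and the value at the same time. *)
Lemma ge0_ftc_exhaust (F f : R -> R) (L : R) :
  {in D, continuous f} -> (forall x, D x -> is_derive x 1 F (f x)) ->
  (forall x, D x -> 0 <= f x) ->
  (fun n => F (b n) - F (a n)) @ \oo --> L ->
  rintegrable D f /\ Rintegral mu D f = L.
Proof.
move=> cf dF f0 FL.
have mf := exhausted_continuous_measurable cf.
have E : (\int[mu]_(x in D) (f x)%:E = L%:E)%E.
  have := @ge0_nondecreasing_set_cvg_integral _ (measurableTypeR R) R (fun n => `[a n, b n]%classic)
    (EFin \o f) mu exhausted_nondecreasing _ _ _.
  rewrite -DE => h.
  apply: (cvg_unique _ (h _ _ _)) => //.
  - by move=> n; apply/measurable_EFinP; exact: (measurable_funS exhausted_measurable (@exhausted_subset n) mf).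
  - by move=> n x /exhausted_subset Dx; rewrite lee_fin f0.
  - rewrite /=; under eq_cvg do rewrite (ftc_piece _ cf dF).
    by apply: cvg_EFin => //; exact: nearW.
split; last by rewrite /Rintegral E.
apply/integrableP; split; first exact/measurable_EFinP.
have -> : (\int[mu]_(x in D) `|(EFin \o f) x| = \int[mu]_(x in D) (f x)%:E)%E.
  by apply: eq_integral => x /set_mem Dx /=; rewrite ger0_norm // f0.
by rewrite E ltry.
Qed.

Lemma ge0_Rintegral_exhaust (f : R -> R) :
  (forall x, D x -> 0 <= f x) -> rintegrable D f ->
  (fun n => Rintegral mu `[a n, b n] f) @ \oo --> Rintegral mu D f.
Proof.
move=> f0 fi; have mf := rintegrable_measurable fi.
have := @ge0_nondecreasing_set_cvg_integral _ (measurableTypeR R) R (fun n => `[a n, b n]%classic)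
    (EFin \o f) mu exhausted_nondecreasing _ _ _.
rewrite -DE => h; apply: fine_cvg; rewrite fineK; last first.
  exact: (@integrable_fin_num _ (measurableTypeR R) R mu D exhausted_measurable _ fi).
apply: h => //.
- by move=> n; apply/measurable_EFinP; exact: (measurable_funS exhausted_measurable (@exhausted_subset n) mf).
- by move=> n x /exhausted_subset Dx; rewrite lee_fin f0.
Qed.

(** Writing f as (f + |f|) - |f| reduces the claim to nonnegative functions. *)
Lemma Rintegral_exhaust (f : R -> R) : rintegrable D f ->
  (fun n => Rintegral mu `[a n, b n] f) @ \oo --> Rintegral mu D f.
Proof.
move=> fi; have mD := exhausted_measurable.
have ni : rintegrable D (fun x => `|f x|) by exact: (integrable_norm fi).
have pi : rintegrable D (fun x => f x + `|f x|) by exact: rintegrableD.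
have c1 := ge0_Rintegral_exhaust (fun x _ => normr_ge0 (f x)) ni.
have c2 : (fun n => Rintegral mu `[a n, b n] (fun x => f x + `|f x|)) @ \oo -->
   Rintegral mu D (fun x => f x + `|f x|).
  apply: ge0_Rintegral_exhaust pi => x _.
  by have := ler_norm (- f x); rewrite normrN; lra.
have E A (hA : measurable A) : A `<=` D -> Rintegral mu A f =
    Rintegral mu A (fun x => f x + `|f x|) - Rintegral mu A (fun x => `|f x|).
  move=> AD; rewrite -RintegralB //; try exact: (@integrableS _ (measurableTypeR R) R mu D A).
  by apply: eq_Rint => x _; rewrite addrK.
rewrite (E D) //.
under eq_cvg => n do rewrite (E _ (measurable_itv _) (@exhausted_subset n)).
exact: cvgB.
Qed.

Lemma ftc_exhaust (F f : R -> R) (L : R) :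
  {in D, continuous f} -> (forall x, D x -> is_derive x 1 F (f x)) ->
  rintegrable D f ->
  (fun n => F (b n) - F (a n)) @ \oo --> L -> Rintegral mu D f = L.
Proof.
move=> cf dF fi FL; apply: (cvg_unique _ (Rintegral_exhaust fi)) => //.
by rewrite /=; under eq_cvg do rewrite /Rintegral (ftc_piece _ cf dF) /=.
Qed.

Lemma cftc_exhaust (F f : R -> C) (L : C) :
  {in D, continuous (fun x => Rez (f x))} -> {in D, continuous (fun x => Imz (f x))} ->
  (forall x, D x -> cderive F x (f x)) -> cintegrable D f ->
  (fun n => F (b n) - F (a n)) @ \oo --> L -> cintegral D f = L.
Proof.
move=> cr ci dF [ir ii] FL; apply: eqC; rewrite !(Re_cintegral, Im_cintegral).
  apply: ftc_exhaust cr (fun x Dx => (dF x Dx).1) ir _.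
  have := cvg_Re FL; apply: cvg_trans; apply: near_eq_cvg.
  by apply: nearW => n; rewrite !reimE.
apply: ftc_exhaust ci (fun x Dx => (dF x Dx).2) ii _.
have := cvg_Im FL; apply: cvg_trans; apply: near_eq_cvg.
by apply: nearW => n; rewrite !reimE.
Qed.

End FTC.

(** * Complex powers and concentration *)

Section ComplexPower.
Variable R : realType.
Local Notation C := (Cx R).
Local Notation mu := (@lebesgue_measure R).
Implicit Types (z s t : C) (a u x : R).

(* Agrees with [cpowR] for [0 < a], but is differentiable without a case distinction. *)
Definition pw (a : R) (s : C) : C := cexp (s * (ln a)%:C).

Lemma cpowRE a s : 0 < a -> cpowR a s = pw a s.
Proof. by rewrite /cpowR => ->. Qed.

Lemma pwD a s t : pw a (s + t) = pw a s * pw a t.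
Proof. by rewrite /pw mulrDl cexpD. Qed.

Lemma pw0 a : pw a 0 = 1.
Proof. by rewrite /pw mul0r cexp0. Qed.

Lemma pw_nat a n : 0 < a -> pw a n%:R = (a ^+ n)%:C.
Proof.
move=> a0; rewrite /pw -realC_nat -realCM cexp_real mulr_natl -lnXn //.
by rewrite lnK // posrE exprn_gt0.
Qed.

Lemma pwM a b s : 0 < a -> 0 < b -> pw (a * b) s = pw a s * pw b s.
Proof. by move=> a0 b0; rewrite /pw lnM ?posrE // realCD mulrDr cexpD. Qed.

Lemma pw_exp a n s : 0 < a -> pw (a ^+ n) s = pw a (s *+ n).
Proof. by move=> a0; rewrite /pw lnXn// -mulr_natl realCM realC_nat mulrA mulr_natr. Qed.

Lemma pw_neq0 a s : pw a s != 0.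
Proof. exact: cexp_neq0. Qed.

Lemma pwN a s : pw a (- s) = (pw a s)^-1.
Proof. by rewrite /pw mulNr cexpN. Qed.

Lemma cabs_pw a s : cabs (pw a s) = expR (Rez s * ln a).
Proof. by rewrite /pw cabs_cexp ReM /= mulr0 subr0. Qed.

Lemma cmeasurable_pw (D : set R) (f : R -> R) s : measurable D ->
  measurable_fun D f -> cmeasurable D (fun x => pw (f x) s).
Proof.
move=> mD mf.
have ml : measurable_fun D (fun x => ln (f x)).
  exact: (measurableT_comp (@measurable_ln R)).
have mk (k : R) : measurable_fun D (fun x => k * ln (f x)).
  by apply: measurable_funM => //; exact: measurable_cst.
have me : measurable_fun D (fun x => expR (Rez s * ln (f x))).
  exact: (measurableT_comp (@measurable_expR R)).
have mc : measurable_fun D (fun x => cos (Imz s * ln (f x))).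
  exact: (measurableT_comp (continuous_measurable_fun (@continuous_cos R))).
have ms : measurable_fun D (fun x => sin (Imz s * ln (f x))).
  exact: (measurableT_comp (continuous_measurable_fun (@continuous_sin R))).
split.
  rewrite (_ : (fun x => _) = (fun x => expR (Rez s * ln (f x)) * cos (Imz s * ln (f x)))).
    exact: measurable_funM.
  by apply/funext => x; rewrite /pw Re_cexp !reimE /= !mulr0 subr0 add0r.
rewrite (_ : (fun x => _) = (fun x => expR (Rez s * ln (f x)) * sin (Imz s * ln (f x)))).
  exact: measurable_funM.
by apply/funext => x; rewrite /pw Im_cexp !reimE /= !mulr0 subr0 add0r.
Qed.

Lemma cmeasurableM (D : set R) (f g : R -> C) :
  cmeasurable D f -> cmeasurable D g -> cmeasurable D (fun x => f x * g x).
Proof.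
move=> [fr fi] [gr gi]; split.
  under eq_fun do rewrite ReM.
  by apply: measurable_funB; exact: measurable_funM.
under eq_fun do rewrite ImM.
by apply: measurable_funD; exact: measurable_funM.
Qed.

Lemma cmeasurable_real (D : set R) (f : R -> R) :
  measurable_fun D f -> cmeasurable D (fun x => (f x)%:C).
Proof. by move=> mf; split => //=; exact: measurable_cst. Qed.

Lemma cderive_pw (f : R -> R) (x df : R) s : 0 < f x -> is_derive x 1 f df ->
  cderive (fun y => pw (f y) s) x (s * (df / f x)%:C * pw (f x) s).
Proof.
move=> fx0 fd; apply: cderive_cexp.
have hl : is_derive x 1 (@ln R \o f) (df / f x).
  have := @is_derive1_comp R (@ln R) f x (f x)^-1 df (is_derive1_ln fx0) fd.
  by rewrite mulrC.
by apply: cderive_eq (cderiveM (cderive_cst s x) (cderive_real hl)) _; rewrite mul0r add0r.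
Qed.

Lemma cderive_continuous (f : R -> C) (x : R) d : cderive f x d ->
  {for x, continuous (fun y => Rez (f y))} /\ {for x, continuous (fun y => Imz (f y))}.
Proof.
by move=> [fr fi]; split; apply: differentiable_continuous; apply/derivable1_diffP;
  exact: ex_derive.
Qed.

(** The inequality ln v <= v - 1 at v = u bounds ln u from above, at v = 1 / u from below. *)
Lemma norm_ln_le u : `|u - 1| <= 2^-1 -> `|ln u| <= 2 * `|u - 1|.
Proof.
rewrite ler_norml => /andP[h1 h2]; have u0 : 0 < u by lra.
have l1 : ln u <= u - 1.
  by have := @le_ln1Dx R (u - 1); rewrite subrKC; apply; lra.
have l2 : - ln u <= u^-1 - 1.
  rewrite -lnV ?posrE //.
  have := @le_ln1Dx R (u^-1 - 1); rewrite subrKC; apply.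
  by have := invr_gt0 u; rewrite u0; lra.
have l3 : u^-1 - 1 <= 2 * `|u - 1|.
  rewrite -(ler_pM2r u0) mulrBl mulVf ?gt_eqF// mul1r.
  have h3 : 1 <= 2 * u by lra.
  apply: le_trans (_ : `|u - 1| <= _); first by rewrite distrC ler_norm.
  by rewrite mulrAC ler_peMl.
rewrite ler_norml; apply/andP; split; first by lra.
by apply: le_trans l1 _; have := ler_norm (u - 1); have := normr_ge0 (u - 1); lra.
Qed.

Lemma pw_sub1_le u z : `|u - 1| <= 2^-1 ->
  cabs (pw u z - 1) <= 2 * cabs z * expR (cabs z) * `|u - 1|.
Proof.
move=> u1; have l := norm_ln_le u1.
have := cabs_cexp_sub_expT 1 (z * (ln u)%:C); rewrite /expT big_ord1 expr0 fact0 divr1.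
move/le_trans; apply; rewrite expr1 divr1 cabsM cabs_real.
have zl : cabs z * `|ln u| <= cabs z.
  by rewrite ler_piMr ?cabs_ge0//; lra.
rewrite -mulrA mulrAC [X in _ <= X](_ : _ = (cabs z * (2 * `|u - 1|)) * expR (cabs z)); last by ring.
by rewrite mulrA ler_pM ?mulr_ge0 ?cabs_ge0 ?expR_ge0// ?ler_wpM2l ?cabs_ge0// ler_expR.
Qed.

(* Laplace's method: if the mass of the weights [w n] concentrates where [phi n] vanishes,
   then the normalised integrals of functions dominated by [phi n] vanish in the limit. *)
Lemma concentration (D : set R) (w phi : nat -> R -> R) (h : nat -> R -> C) :
  measurable D ->
  (forall n x, D x -> 0 <= w n x) -> (forall n, rintegrable D (w n)) ->
  (forall n, 0 < Rintegral mu D (w n)) ->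
  (forall n, rintegrable D (fun x => phi n x * w n x)) ->
  (forall n, cintegrable D (fun x => h n x * (w n x)%:C)) ->
  (forall n x, D x -> cabs (h n x) ^+ 2 <= phi n x) ->
  (fun n => Rintegral mu D (fun x => phi n x * w n x) / Rintegral mu D (w n)) @ \oo --> (0 : R) ->
  (fun n => cintegral D (fun x => h n x * (w n x)%:C) / (Rintegral mu D (w n))%:C : C)
    @ \oo --> (0 : C).
Proof.
move=> mD w0 iw W0 ipw ihw hphi lim; apply/cvgCP/cvgrPdist_le => e e0.
(* With d = e / 4 both terms of the bound below are at most d times the mass, and
   [cabs_cintegral_le] doubles their sum. *)
have d0 : 0 < e / 4 by rewrite divr_gt0.
have K0 : 0 < (e / 4) ^+ 2 by rewrite exprn_gt0.
move/cvgrPdist_le : lim => /(_ _ K0); apply: filterS => n.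
set W := Rintegral mu D (w n); set P := Rintegral _ _ _ => lePW.
have Wp : 0 < W by exact: W0.
rewrite sub0r normrN ger0_norm ?cabs_ge0// subr0 cabsM cabsV cabs_real (gtr0_norm Wp).
rewrite ler_pdivrMr//.
pose d := e / 4.
(* AM-GM: |h| <= d + |h|^2 / d *)
have bnd x : D x -> cabs (h n x * (w n x)%:C) <= d * w n x + d^-1 * (phi n x * w n x).
  move=> Dx; rewrite cabsM cabs_real ger0_norm ?w0// mulrA -mulrDl ler_wpM2r ?w0//.
  apply: le_trans (_ : d + d^-1 * cabs (h n x) ^+ 2 <= _); last first.
    by rewrite lerD2l ler_wpM2l ?hphi// invr_ge0 ltW.
  set c := cabs _; rewrite -(ler_pM2l d0) -/d mulrDr (mulVKf (lt0r_neq0 d0)).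
  rewrite -subr_ge0; have -> : d * d + c ^+ 2 - d * c = (d - c / 2) ^+ 2 + 3 / 4 * c ^+ 2 by field.
  by rewrite addr_ge0 ?sqr_ge0 // mulr_ge0 ?sqr_ge0 // divr_ge0.
have i1 := rintegrableZ d mD (iw n).
have i2 := rintegrableZ d^-1 mD (ipw n).
apply: le_trans (cabs_cintegral_le mD (ihw n) (rintegrableD mD i1 i2) bnd) _.
rewrite RintegralD// RintegralZl//; last exact: iw.
rewrite RintegralZl//; last exact: ipw.
rewrite -/W -/P.
have PW : P <= d ^+ 2 * W.
  rewrite -ler_pdivrMr//; apply: le_trans lePW.
  by rewrite sub0r normrN ler_norm.
have : d^-1 * P <= d * W.
  by rewrite -(ler_pM2l d0) -/d (mulVKf (lt0r_neq0 d0)) mulrA -expr2.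
rewrite /d; lra.
Qed.

End ComplexPower.

(** * The Gamma function *)

Section GammaFunction.
Variable R : realType.
Local Notation C := (Cx R).
Local Notation mu := (@lebesgue_measure R).
Implicit Types (z s t : C) (x : R).

(** Continuity of the integrand is obtained from a derivative, which for products of powers is
    produced mechanically. *)
Lemma cftc (a b : nat -> R) (D : set R) (F f : R -> C) (L : C) :
  (forall n, a n < b n) -> {homo a : m n / (m <= n)%N >-> n <= m} ->
  {homo b : m n / (m <= n)%N >-> m <= n} -> D = \bigcup_n `[a n, b n]%classic ->
  (forall x, D x -> cderive F x (f x) /\ exists d, cderive f x d) ->
  cintegrable D f -> (fun n => F (b n) - F (a n)) @ \oo --> L -> cintegral D f = L.
Proof.
move=> ab ha hb DE H fi FL; apply: (cftc_exhaust ab ha hb DE _ _ _ fi FL).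
- by move=> x /set_mem /H[_ [d /cderive_continuous[]]].
- by move=> x /set_mem /H[_ [d /cderive_continuous[]]].
- by move=> x /H[].
Qed.

Lemma cvgC0_le (u : nat -> C) (v : nat -> R) : (forall n, cabs (u n) <= v n) ->
  v @ \oo --> (0 : R) -> u @ \oo --> (0 : C).
Proof.
move=> uv v0; apply/cvgCP/cvgrPdist_le => e e0.
move/cvgrPdist_le : v0 => /(_ _ e0); apply: filterS => n.
rewrite !sub0r !normrN subr0 [`|cabs _|]ger0_norm ?cabs_ge0// => h.
exact: le_trans (uv n) (le_trans (ler_norm _) h).
Qed.

Lemma cvgn_comp (f : R -> R) (u : nat -> R) (l : R) : {for l, continuous f} ->
  u @ \oo --> l -> (fun n => f (u n)) @ \oo --> f l.
Proof. by move=> cf ul; exact: continuous_cvg. Qed.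

Lemma cvg_expR_ln (c : R) : 0 < c ->
  (fun n => expR (- c * ln (n.+1%:R : R))) @ \oo --> (0 : R).
Proof.
move=> c0; apply/cvgrPdist_lt => e e0; near=> n.
rewrite sub0r normrN ger0_norm ?expR_ge0//.
rewrite -[ltRHS]lnK ?posrE// ltr_expR mulNr ltrNl mulrC -ltr_pdivrMr//.
rewrite -[ltLHS]expRK ltr_ln ?posrE ?expR_gt0 ?ltr0n//.
apply: lt_le_trans (_ : n%:R <= _); last by rewrite ler_nat.
by near: n; exact: nbhs_infty_gtr.
Unshelve. all: by end_near. Qed.

Let D0 : set R := `]0, +oo[%classic.
Let a (n : nat) : R := n.+1%:R^-1.
(** Starting at 2 ensures [a 0 < b 0], as [a 0] is 1. *)
Let b (n : nat) : R := n.+2%:R.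

Let ab n : a n < b n.
Proof.
apply: (@le_lt_trans _ _ 1); first by rewrite invf_le1 ?ltr0n// ler1n.
by rewrite ltr1n.
Qed.

Let a_noninc : {homo a : m n / (m <= n)%N >-> n <= m}.
Proof. by move=> m n mn; rewrite lef_pV2 ?posrE ?ltr0n// ler_nat ltnS. Qed.

Let b_nondec : {homo b : m n / (m <= n)%N >-> m <= n}.
Proof. by move=> m n mn; rewrite ler_nat !ltnS. Qed.

Let D0E : D0 = \bigcup_n `[a n, b n]%classic.
Proof.
apply/seteqP; split => x; rewrite /D0 /= in_itv /= andbT.
  move=> x0; have s0 : 0 <= x + x^-1 by rewrite addr_ge0 ?invr_ge0 ?ltW.
  have := archi_boundP s0; set n := Num.bound _ => ln.
  exists n => //; rewrite /= in_itv /= /a /b.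
  have xV : 0 < x^-1 by rewrite invr_gt0.
  have n1 : (n.+1%:R : R) = n%:R + 1 by rewrite natr1.
  have n2 : (n.+2%:R : R) = n%:R + 2 by rewrite -addn2 natrD.
  apply/andP; split; last by rewrite n2; lra.
  by rewrite -[leRHS]invrK lef_pV2 ?posrE ?ltr0n// n1; lra.
move=> [n _]; rewrite /= in_itv /= => /andP[h _].
by apply: lt_le_trans h; rewrite invr_gt0 ltr0n.
Qed.

Let D0P x : D0 x <-> 0 < x.
Proof. by rewrite /D0 /= in_itv /= andbT. Qed.

Let mD0 : measurable D0.
Proof. exact: measurable_itv. Qed.

(** By concavity [ln] lies below its tangent at p; multiplied by p, the tangent is cancelled by - x
    up to a constant. *)
Lemma powR_expR_le (p x : R) : 0 < p -> 0 < x ->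
  expR (p * ln (1 + x)) * expR (- x) <= expR (1 + p * ln p).
Proof.
move=> p0 x0; rewrite -expRD ler_expR.
have x1 : 0 < 1 + x by rewrite addr_gt0.
have := @le_ln1Dx R ((1 + x) / p - 1); rewrite subrKC ln_div ?posrE// => h.
have /h {}h : -1 < (1 + x) / p - 1 by have := divr_gt0 x1 p0; lra.
have : p * (ln (1 + x) - ln p) <= p * ((1 + x) / p - 1) by rewrite ler_pM2l.
rewrite !mulrBr mulrCA divff ?gt_eqF// !mulr1; lra.
Qed.

Lemma rintegrable_powR_expR (c : R) : 0 < c ->
  rintegrable D0 (fun x => expR ((c - 1) * ln x) * expR (- x)).
Proof.
move=> c0.
have x1P (x : R) : 0 < x -> 0 < 1 + x by move=> x0; rewrite addr_gt0.
(* [G] is (x / (1 + x))^c, with derivative c x^(c - 1) / (1 + x)^(c + 1). This has the behaviour of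
   the integrand at 0 and decays like x^(-2), so it dominates the integrand up to a constant by
   [powR_expR_le] with exponent c + 1. *)
pose G (x : R) : R := expR (- c * ln (1 + x^-1)).
pose g (x : R) : R := c / (x * (1 + x)) * G x.
have Gd (x : R) : 0 < x -> is_derive x 1 G (g x).
  move=> x0; have x1 := x1P _ x0; have xV1 : 0 < 1 + x^-1 by rewrite x1P ?invr_gt0.
  have hV : is_derive x 1 (fun y : R => y^-1) (- x ^- 2).
    apply: DeriveDef; first by apply: derivableV => //; rewrite gt_eqF.
    by rewrite deriveV ?gt_eqF// derive_id /GRing.scale/= mulr1.
  have h1 := is_deriveD (is_derive_cst (1 : R) x (1 : R)) hV.
  have h2 := @is_derive1_comp R (@ln R) (cst 1 + (fun y : R => y^-1)) x _ _ (is_derive1_ln xV1) h1.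
  have h4 := is_deriveZ (- c) h2.
  have := @is_derive1_comp R (@expR R) _ x _ _ (is_derive_expR _) h4.
  move=> h5; apply: (is_derive_eq h5).
  rewrite /g /G add0r /GRing.scale /= !fctE /= /cst.
  by field; rewrite !gt_eqF //= addr_gt0.
have g0 (x : R) : 0 < x -> 0 <= g x.
  by move=> x0; rewrite mulr_ge0 ?expR_ge0// divr_ge0 ?mulr_ge0 ?ltW // x1P.
have gd (x : R) : 0 < x -> {for x, continuous g}.
  move=> x0; have x1 := x1P _ x0.
  apply: continuousM; last first.
    have dG := Gd _ x0; apply: differentiable_continuous; apply/derivable1_diffP; exact: ex_derive.
  apply: continuousM; first exact: cvg_cst.
  apply: continuousV; first by rewrite mulf_neq0 ?gt_eqF.
  by apply: continuousM; [exact: cvg_id|apply: continuousD; [exact: cvg_cst|exact: cvg_id]].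
have limG : (fun n => G (b n) - G (a n)) @ \oo --> (1 - 0 : R).
  apply: cvgB.
    have -> : (1 : R) = expR (- c * ln (1 + 0)) by rewrite addr0 ln1 mulr0 expR0.
    apply: (@cvgn_comp (@expR R) (fun n => - c * ln (1 + (b n)^-1))); first exact: continuous_expR.
    apply: cvgM; first exact: cvg_cst.
    apply: (@cvgn_comp (@ln R) (fun n => 1 + (b n)^-1)); first by apply: continuous_ln; rewrite addr0.
    apply: cvgD; first exact: cvg_cst.
    have := @cvg_harmonic R; rewrite -(cvg_shiftS) /=; exact.
  have := cvg_expR_ln c0; rewrite -(cvg_shiftS) /=.
  apply: cvg_trans; apply: near_eq_cvg; apply: nearW => n.
  by rewrite /G /a invrK nat1r.
have [ig _] : rintegrable D0 g /\ Rintegral mu D0 g = 1 - 0.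
  apply: (ge0_ftc_exhaust ab a_noninc b_nondec D0E (F := G)) limG.
  - by move=> x /set_mem /D0P; exact: gd.
  - by move=> x /D0P; exact: Gd.
  - by move=> x /D0P; exact: g0.
pose M := expR (1 + (c + 1) * ln (c + 1)).
apply: (@le_rintegrable R D0 _ (fun x => M / c * g x) mD0); last exact: rintegrableZ.
  apply: measurable_funM.
    apply: (measurableT_comp (@measurable_expR R)); apply: measurable_funM; first exact: measurable_cst.
    exact: measurable_funTS (@measurable_ln R).
  apply: (measurableT_comp (@measurable_expR R)).
  exact: oppr_measurable.
move=> x /D0P x0; have x1 := x1P _ x0.
rewrite ger0_norm ?mulr_ge0 ?expR_ge0// /g /G.
have c1 : 0 < c + 1 by rewrite addr_gt0.
have := powR_expR_le c1 x0; rewrite -/M.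
have -> : 1 + x^-1 = (1 + x) / x by field; rewrite gt_eqF.
rewrite ln_div ?posrE//.
rewrite mulrDl mul1r expRD lnK ?posrE//.
have -> : expR ((c - 1) * ln x) = expR (c * ln x) / x.
  by rewrite mulrBl mul1r expRD expRN lnK ?posrE.
have -> : expR (- c * (ln (1 + x) - ln x)) = (expR (c * ln (1 + x)))^-1 * expR (c * ln x).
  by rewrite -expRN -expRD; congr expR; ring.
set A := expR (c * ln (1 + x)); set B := expR (c * ln x) => H.
have A0 : 0 < A by exact: expR_gt0.
have B0 : 0 < B by exact: expR_gt0.
have -> : M / c * (c / (x * (1 + x)) * (A^-1 * B)) = M * (B / x / (A * (1 + x))).
  by field; rewrite !gt_eqF.
rewrite [leRHS]mulrA ler_pdivlMr ?mulr_gt0//.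
have -> : B / x * expR (- x) * (A * (1 + x)) = (A * (1 + x) * expR (- x)) * (B / x) by ring.
by rewrite ler_wpM2r // divr_ge0 ?ltW.
Qed.

Lemma Gamma_integrable z : 0 < Rez z ->
  cintegrable D0 (fun x => pw x (z - 1) * (expR (- x))%:C).
Proof.
move=> z0; apply: (le_cintegrable mD0 _ _ (rintegrable_powR_expR z0)).
  apply: cmeasurableM.
    by apply: cmeasurable_pw => //; exact: measurable_id.
  apply: cmeasurable_real; apply: (measurableT_comp (@measurable_expR R)).
  exact: oppr_measurable.
move=> x _; rewrite cabsM cabs_pw cabs_real ger0_norm ?expR_ge0//.
by rewrite !reimE.
Qed.

Lemma GammaE z : 0 < Rez z ->
  Gamma z = cintegral D0 (fun x => pw x (z - 1) * (expR (- x))%:C).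
Proof.
move=> z0.
pose f (x : R) : C := cpowR x (z - 1) * (expR (- x))%:C.
have [fr fi] : cintegrable D0 f.
  apply: eq_cintegrable (Gamma_integrable z0) => // x /D0P x0.
  by rewrite /f cpowRE.
have -> : Gamma z = cintegral D0 f.
  apply: eqC; rewrite /Gamma !(Re_cintegral, Im_cintegral); symmetry.
    exact: (@Rintegral_itv_obnd_cbnd R 0 +oo%O).
  exact: (@Rintegral_itv_obnd_cbnd R 0 +oo%O).
by apply: eq_cintegral => x /D0P x0; rewrite /f cpowRE.
Qed.

Lemma pw_sub1 x z : 0 < x -> pw x (z - 1) = pw x z * (x^-1)%:C.
Proof.
move=> x0; rewrite pwD pwN realCV; congr (_ * _^-1).
by have := pw_nat 1 x0; rewrite expr1.
Qed.

Lemma cderive_expRN x : cderive (fun y : R => (expR (- y))%:C : C) x (- (expR (- x))%:C).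
Proof.
have h := @is_derive1_comp R (@expR R) -%R x _ _ (is_derive_expR _) (is_deriveNid x 1).
by apply: cderive_eq (cderive_real h) _; rewrite mulrN1 realCN.
Qed.

Lemma cderive_pw_id x z : 0 < x -> cderive (fun y => pw y z) x (z * pw x (z - 1)).
Proof.
move=> x0; apply: cderive_eq (@cderive_pw R id x 1 z x0 (is_derive_id _ _)) _.
by rewrite pw_sub1 // div1r; ring.
Qed.

Lemma GammaS z : 0 < Rez z -> Gamma (z + 1) = z * Gamma z.
Proof.
move=> z0; have z1 : 0 < Rez (z + 1) by rewrite reimE addr_gt0 //=.
pose f1 (x : R) : C := pw x (z - 1) * (expR (- x))%:C.
pose f2 (x : R) : C := pw x (z + 1 - 1) * (expR (- x))%:C.
have i1 : cintegrable D0 f1 := Gamma_integrable z0.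
have i2 : cintegrable D0 f2 := Gamma_integrable z1.
apply/eqP; rewrite eq_sym -subr_eq0 !GammaE // -/f1 -/f2.
rewrite -cintegralZ // -cintegralB //; last exact: cintegrableZ.
apply/eqP.
apply: (cftc (F := fun x => pw x z * (expR (- x))%:C) ab a_noninc b_nondec D0E).
- move=> x /D0P x0; split.
    apply: cderive_eq (cderiveM (cderive_pw_id z x0) (cderive_expRN x)) _.
    by rewrite /f1 /f2 addrK; ring.
  eexists; apply: cderiveD.
    apply: cderiveM (cderive_cst _ _) _.
    exact: cderiveM (cderive_pw_id _ x0) (cderive_expRN x).
  by apply: cderiveN; exact: cderiveM (cderive_pw_id _ x0) (cderive_expRN x).
- by apply: cintegrableB => //; exact: cintegrableZ.
pose c := Rez z.
pose M := expR (1 + (c + 1) * ln (c + 1)).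
(* Boundary terms: [powR_expR_le] with exponent c + 1 leaves a factor 1 / (n + 1) at the upper end,
   and the lower end contributes at most (n + 1)^(- c). *)
apply: (@cvgC0_le _ (fun n => M * n.+1%:R^-1 + expR (- c * ln (n.+1%:R)))); last first.
  rewrite -[0 in X in _ --> X]addr0; apply: cvgD; last exact: cvg_expR_ln.
  by rewrite -[0 in X in _ --> X](mulr0 M); apply: cvgM; [exact: cvg_cst|exact: cvg_harmonic].
move=> n; apply: le_trans (cabsD _ _) _; rewrite cabsN !cabsM !cabs_pw !cabs_real -/c.
rewrite !(ger0_norm (expR_ge0 _)) lerD//.
  have b0 : 0 < b n by rewrite ltr0n.
  have b1 : 0 < 1 + b n by rewrite addr_gt0.
  have c1 : 0 < c + 1 by rewrite addr_gt0.
  have := powR_expR_le c1 b0; rewrite -/M mulrDl mul1r expRD lnK ?posrE// => H.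
  rewrite ler_pdivlMr ?ltr0n//; apply: le_trans H.
  rewrite mulrAC ler_wpM2r ?expR_ge0// ler_pM ?expR_ge0//.
    by rewrite ler_expR ler_pM2l // ler_ln ?posrE// lerDr.
  by rewrite /b nat1r ler_nat -[n.+3]addn2 leq_addr.
rewrite /a lnV ?posrE ?ltr0n // mulrN mulNr -[leRHS]mulr1 ler_wpM2l ?expR_ge0//.
Qed.

Lemma Gamma1 : Gamma (1 : C) = 1.
Proof.
have h1 : 0 < Rez (1 : C) by [].
rewrite GammaE //; apply: (cftc (F := fun x => - (expR (- x))%:C) ab a_noninc b_nondec D0E).
- move=> x /D0P x0; split.
    by apply: cderive_eq (cderiveN (cderive_expRN x)) _; rewrite opprK subrr pw0 mul1r.
  by eexists; exact: cderiveM (cderive_pw_id _ x0) (cderive_expRN x).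
- exact: Gamma_integrable.
have E : (fun n => (expR (- a n) - expR (- b n))%:C : C) @ \oo --> ((1 - 0)%:C : C).
  apply: cvg_realC; apply: cvgB.
    rewrite -[X in _ --> X]expR0 -oppr0.
    apply: (@cvgn_comp (@expR R) (fun n => - a n)); first exact: continuous_expR.
    by apply: cvgN; exact: cvg_harmonic.
  have := @cvgn_expR R; rewrite -(cvg_shiftS) -(cvg_shiftS) /=; exact.
rewrite subr0 in E; apply: cvg_trans E; apply: near_eq_cvg; apply: nearW => n.
by rewrite realCD realCN opprK addrC.
Qed.

Lemma Gamma_nat n : Gamma (n.+1%:R : C) = n`!%:R.
Proof.
elim: n => [|n IH]; first by rewrite Gamma1 fact0.
rewrite -natr1 GammaS ?IH ?factS ?natrM //.
by rewrite -realC_nat /= ltr0n.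
Qed.

End GammaFunction.

Lemma cvgn_eq (T : topologicalType) (u v : nat -> T) (l l' : T) :
  (forall n, u n = v n) -> l = l' -> u @ \oo --> l -> v @ \oo --> l'.
Proof. by move=> /funext -> ->. Qed.

Lemma cvgnM (K : numFieldType) (u v : nat -> K) (l l' : K) : u @ \oo --> l -> v @ \oo --> l' ->
  (fun n => u n * v n) @ \oo --> l * l'.
Proof. by move=> ? ?; exact: cvgM. Qed.

Lemma cvgnD (K : numFieldType) (u v : nat -> K) (l l' : K) : u @ \oo --> l -> v @ \oo --> l' ->
  (fun n => u n + v n) @ \oo --> l + l'.
Proof. by move=> ? ?; exact: cvgD. Qed.

Lemma cvgnV (K : numFieldType) (u : nat -> K) (l : K) : l != 0 -> u @ \oo --> l ->
  (fun n => (u n)^-1) @ \oo --> l^-1.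
Proof. by move=> ? ?; exact: cvgV. Qed.

Lemma cvgn_cst (K : numFieldType) (l : K) : (fun n : nat => l) @ \oo --> l.
Proof. exact: cvg_cst. Qed.


Arguments cvgn_cst {K} l.

Lemma cvgn_sum (K : numFieldType) n (F : nat -> nat -> K) (l : nat -> K) :
  (forall j, F j @ \oo --> l j) ->
  (fun m => \sum_(j < n) F j m) @ \oo --> \sum_(j < n) l j.
Proof.
move=> h; elim: n => [|n IH].
  by apply: (cvgn_eq _ _ (cvgn_cst (0 : K))) => [m|]; rewrite big_ord0.
by apply: (cvgn_eq _ _ (cvgnD IH (h n))) => [m|]; rewrite big_ord_recr.
Qed.

(** * Gauss's product for the Gamma function *)

Section GaussProduct.
Variable R : realType.
Local Notation C := (Cx R).
Local Notation mu := (@lebesgue_measure R).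
Implicit Types (z s t : C) (x : R).

Let D0 : set R := `]0, +oo[%classic.

Let D0P x : D0 x <-> 0 < x.
Proof. by rewrite /D0 /= in_itv /= andbT. Qed.

Let mD0 : measurable D0.
Proof. exact: measurable_itv. Qed.

Lemma cvgC_unique (u : nat -> C) (l l' : C) : u @ \oo --> l -> u @ \oo --> l' -> l = l'.
Proof. exact: (@cvg_unique C (@norm_hausdorff C C)). Qed.

Lemma rintegrable_sum (D : set R) n (F : nat -> R -> R) : measurable D ->
  (forall i, rintegrable D (F i)) -> rintegrable D (fun x => \sum_(i < n) F i x).
Proof.
move=> mD h; elim: n => [|n IH].
  by apply: eq_rintegrable (@integrable0 _ _ _ _ _) => // x _; rewrite big_ord0.
by apply: eq_rintegrable (rintegrableD mD IH (h n)) => // x _; rewrite big_ord_recr.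
Qed.

Lemma Rintegral_sum (D : set R) n (F : nat -> R -> R) : measurable D ->
  (forall i, rintegrable D (F i)) ->
  Rintegral mu D (fun x => \sum_(i < n) F i x) = \sum_(i < n) Rintegral mu D (F i).
Proof.
move=> mD h; elim: n => [|n IH].
  rewrite big_ord0 -[RHS](@mul0r _ (fine (mu D))) -Rintegral_cst//.
  by apply: eq_Rint => x _; rewrite big_ord0.
rewrite big_ord_recr /= -IH.
rewrite -(@RintegralD _ (measurableTypeR R) R mu D _ _ mD (@rintegrable_sum D n F mD h) (h n)).
by apply: eq_Rint => x _; rewrite big_ord_recr.
Qed.

Lemma factorial_integral k : rintegrable D0 (fun x => x ^+ k * expR (- x)) /\
  Rintegral mu D0 (fun x => x ^+ k * expR (- x)) = k`!%:R.
Proof.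
have k0 : 0 < Rez (k.+1%:R : C) by rewrite -realC_nat /= ltr0n.
have E x : D0 x -> pw x (k.+1%:R - 1) * (expR (- x))%:C = (x ^+ k * expR (- x))%:C :> C.
  by move=> /D0P x0; rewrite -natr1 addrK pw_nat // realCM.
have ic := eq_cintegrable mD0 E (Gamma_integrable k0).
split; first exact: ic.1.
apply: (@realC_inj R); rewrite realC_nat -Gamma_nat GammaE // -cintegral_real.
by apply: eq_cintegral => x Dx; rewrite E.
Qed.

Section Concentration.
Variable n : nat.
Let N : R := n.+1%:R.
(* This weight has its mass near [x = N], since its moments of [x / N] all tend to 1. *)
Let w (x : R) : R := x ^+ n.+1 * expR (- x).

Let N0 : 0 < N. Proof. by rewrite ltr0n. Qed.

Lemma moment_integral j : rintegrable D0 (fun x => (x / N) ^+ j * w x) /\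
  Rintegral mu D0 (fun x => (x / N) ^+ j * w x) = (n.+1 + j)`!%:R / N ^+ j.
Proof.
have [i1 e1] := factorial_integral (n.+1 + j).
have E x : D0 x -> N ^- j * (x ^+ (n.+1 + j) * expR (- x)) = (x / N) ^+ j * w x.
  by move=> _; rewrite /w expr_div_n exprD; ring.
split; first exact: eq_rintegrable E (rintegrableZ _ mD0 i1).
by rewrite -(eq_Rint E) RintegralZl // e1 mulrC.
Qed.

(** The dominating functions will be polynomials in x / N, so that concentration becomes a statement
    about ratios of factorials. *)
Lemma poly_moment_integral (p : {poly R}) :
  rintegrable D0 (fun x => p.[x / N] * w x) /\
  Rintegral mu D0 (fun x => p.[x / N] * w x) =
    \sum_(j < size p) p`_j * ((n.+1 + j)`!%:R / N ^+ j).
Proof.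
have E x : D0 x -> \sum_(j < size p) p`_j * ((x / N) ^+ j * w x) = p.[x / N] * w x.
  by move=> _; rewrite horner_coef big_distrl /=; apply: eq_bigr => j _; rewrite mulrA.
have h i : rintegrable D0 (fun x => p`_i * ((x / N) ^+ i * w x)).
  by apply: rintegrableZ => //; have [] := moment_integral i.
split; first exact: eq_rintegrable E (rintegrable_sum _ mD0 h).
rewrite -(eq_Rint E) (@Rintegral_sum D0 _ (fun j x => p`_j * ((x / N) ^+ j * w x)))//.
apply: eq_bigr => j _; rewrite RintegralZl//; first by have [_ ->] := moment_integral j.
by have [] := moment_integral j.
Qed.

End Concentration.

Lemma cvg_natr_ratio j :
  (fun n => (n.+1 + j)%:R / n.+1%:R : R) @ \oo --> (1 : R).
Proof.
have h : (fun n => 1 + j%:R * n.+1%:R^-1 : R) @ \oo --> (1 + j%:R * 0 : R).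
  by apply: cvgD; [exact: cvg_cst|apply: cvgM; [exact: cvg_cst|exact: cvg_harmonic]].
apply: (cvgn_eq _ _ h) => [n|]; last by rewrite mulr0 addr0.
by rewrite natrD mulrDl divff // pnatr_eq0.
Qed.

Lemma cvg_moment j :
  (fun n => (n.+1 + j)`!%:R / (n.+1%:R ^+ j) / (n.+1)`!%:R : R) @ \oo --> (1 : R).
Proof.
elim: j => [|j IH].
  apply: (cvgn_eq _ _ (cvg_cst (1 : R))) => // n.
  by rewrite addn0 expr0 divr1 divff // pnatr_eq0 -lt0n fact_gt0.
apply: (cvgn_eq _ _ (cvgnM IH (@cvg_natr_ratio j.+1))) => [n|]; last exact: mulr1.
rewrite addnS [((_ + _).+1)`!]factS natrM exprS.
have : n.+1%:R != 0 :> R by rewrite pnatr_eq0.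
have : (n.+1)`!%:R != 0 :> R by rewrite pnatr_eq0 -lt0n fact_gt0.
move: (n.+1%:R : R) ((n.+1)`!%:R : R) ((n.+1 + j)`!%:R : R) ((n.+1 + j).+1%:R : R).
by move=> u v a b v0 u0; field; rewrite u0 v0 expf_neq0.
Qed.

Lemma expR_ln_le (c u : R) (m : nat) : 0 <= c -> c <= m%:R -> 0 < u ->
  expR (c * ln u) <= 1 + u ^+ m.
Proof.
move=> c0 cm u0; have [u1|/ltW u1] := leP u 1.
  apply: (@le_trans _ _ 1); last by rewrite lerDl exprn_ge0 // ltW.
  by rewrite -expR0 ler_expR mulr_ge0_le0 // ln_le0.
apply: (@le_trans _ _ (u ^+ m)); last by rewrite lerDr.
rewrite -[u in leRHS]lnK ?posrE// -expRM_natl ler_expR ler_wpM2r// ln_ge0 //.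
Qed.

(** Near 1 this is [pw_sub1_le]. Elsewhere |u - 1| >= 1/2 absorbs the crude bound 2 + u^m <= 2 (1 +
    u^m), whence the constant 4. *)
Lemma pw_sub1_le_poly z (m : nat) (u : R) : 0 <= Rez z -> Rez z <= m%:R -> 0 < u ->
  cabs (pw u z - 1) <= (2 * cabs z * expR (cabs z) + 4) * (`|u - 1| * (1 + u ^+ m)).
Proof.
move=> z0 zm u0; have um : 0 <= u ^+ m by rewrite exprn_ge0 // ltW.
set K := 2 * cabs z * expR (cabs z).
have K0 : 0 <= K by rewrite !mulr_ge0 ?cabs_ge0 ?expR_ge0.
have [u1|/ltW u1] := leP `|u - 1| 2^-1.
  apply: le_trans (pw_sub1_le z u1) _; rewrite -/K mulrA.
  apply: (@le_trans _ _ ((K + 4) * `|u - 1|)); first by rewrite ler_wpM2r// lerDl.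
  by rewrite ler_peMr ?mulr_ge0 ?addr_ge0// lerDl.
apply: (@le_trans _ _ (4 * (`|u - 1| * (1 + u ^+ m)))); last first.
  by rewrite ler_wpM2r ?mulr_ge0 ?addr_ge0// lerDr.
apply: le_trans (cabsD _ _) _; rewrite cabsN cabs1 cabs_pw.
have := expR_ln_le z0 zm u0.
have : 2^-1 * (1 + u ^+ m) <= `|u - 1| * (1 + u ^+ m) by rewrite ler_wpM2r ?addr_ge0.
lra.
Qed.

(** Gamma (z + n + 2) is the integral of x^z against a weight of mass (n + 1)!, and concentration at
    n + 1 allows x^z to be replaced by (n + 1)^z. *)
Lemma Gamma_asymp_ge0 z : 0 <= Rez z ->
  (fun n => Gamma (z + n.+2%:R) / ((n.+1)`!%:R * pw n.+1%:R z) : C) @ \oo --> (1 : C).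
Proof.
move=> z0.
pose m := Num.bound (Rez z); have zm : Rez z <= m%:R by rewrite ltW// archi_boundP.
pose K := 2 * cabs z * expR (cabs z) + 4.
(* The square of the bound in [pw_sub1_le_poly], after (1 + v)^2 <= 2 (1 + v^2). All normalised
   moments tend to 1, so the mean of [p] tends to p(1), which is 0 because of the factor (X -
   1)^2. *)
pose p : {poly R} := (2 * K ^+ 2)%:P * ('X - 1%:P) ^+ 2 * (1%:P + 'X^(m + m)).
pose w n (x : R) : R := x ^+ n.+1 * expR (- x).
pose h n (x : R) : C := pw (x / n.+1%:R) z - 1.
have N0 n : 0 < n.+1%:R :> R by rewrite ltr0n.
have W n : Rintegral mu D0 (w n) = (n.+1)`!%:R by have [_ ->] := factorial_integral n.+1.
have Rz n : 0 < Rez (z + n.+2%:R) by rewrite reimE -realC_nat ltr_wpDl //= ltr0n.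
have E n x : D0 x -> h n x * (w n x)%:C =
    (pw n.+1%:R z)^-1 * (pw x (z + n.+2%:R - 1) * (expR (- x))%:C) - (w n x)%:C.
  move=> /D0P x0; rewrite /h mulrBl mul1r; congr (_ - _).
  rewrite -[n.+2%:R]natr1 addrA addrK pwD pw_nat // pwM ?invr_gt0 //.
  have -> : pw (n.+1%:R^-1) z = (pw n.+1%:R z)^-1.
    by rewrite -pwN /pw lnV ?posrE // realCN mulrN mulNr.
  by rewrite /w realCM; ring.
have iG n := cintegrableZ (pw n.+1%:R z)^-1 mD0 (Gamma_integrable (Rz n)).
have iw n : rintegrable D0 (w n) by have [] := factorial_integral n.+1.
have iwc n := cintegrable_real mD0 (iw n).
have conc := @concentration R D0 w (fun n x => p.[x / n.+1%:R]) h mD0.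
have {conc} lim : (fun n => cintegral D0 (fun x => h n x * (w n x)%:C) /
   (Rintegral mu D0 (w n))%:C : C) @ \oo --> (0 : C).
  apply: conc => //.
  - by move=> n x /D0P x0; rewrite /w mulr_ge0 ?exprn_ge0 ?expR_ge0 // ltW.
  - by move=> n; rewrite W ltr0n fact_gt0.
  - by move=> n; have [] := poly_moment_integral n p.
  - move=> n; apply: (eq_cintegrable mD0 (fun x Dx => esym (E n x Dx))).
    exact: cintegrableB.
  - move=> n x /D0P x0; rewrite /h; set u := x / _.
    have u0 : 0 < u by rewrite divr_gt0.
    have um : 0 <= u ^+ m by rewrite exprn_ge0 // ltW.
    have b := pw_sub1_le_poly z0 zm u0; rewrite -/K in b.
    have : cabs (pw u z - 1) ^+ 2 <= (K * (`|u - 1| * (1 + u ^+ m))) ^+ 2.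
      by rewrite lerXn2r // nnegrE ?cabs_ge0 // (le_trans (cabs_ge0 _) b).
    move/le_trans; apply; rewrite /p 2!hornerM horner_exp hornerXsubC hornerD hornerXn !hornerC exprD.
    have -> : (K * (`|u - 1| * (1 + u ^+ m))) ^+ 2 =
       K ^+ 2 * `|u - 1| ^+ 2 * (1 + u ^+ m) ^+ 2 by ring.
    rewrite real_normK ?num_real //.
    have -> : 2 * K ^+ 2 * (u - 1) ^+ 2 * (1 + u ^+ m * u ^+ m) =
       K ^+ 2 * (u - 1) ^+ 2 * (2 * (1 + u ^+ m * u ^+ m)) by ring.
    rewrite ler_wpM2l //; first by apply: mulr_ge0; exact: sqr_ge0.
    have := sqr_ge0 (1 - u ^+ m); lra.
  - have : (fun n => \sum_(j < size p) p`_j *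
       ((n.+1 + j)`!%:R / n.+1%:R ^+ j / (n.+1)`!%:R)) @ \oo --> (\sum_(j < size p) p`_j * 1).
      apply: (@cvgn_sum R _ (fun j n => p`_j * ((n.+1 + j)`!%:R / n.+1%:R ^+ j / (n.+1)`!%:R)) (fun j => p`_j * 1)) => j.
      by apply: cvgnM; [exact: cvgn_cst|exact: cvg_moment].
    have -> : \sum_(j < size p) p`_j * 1 = 0.
      transitivity p.[1].
        by rewrite horner_coef; apply: eq_bigr => j _; rewrite expr1n.
      by rewrite /p 2!hornerM horner_exp hornerXsubC subrr expr0n mulr0 mul0r.
    apply: cvg_trans; apply: near_eq_cvg; apply: nearW => n.
    have [_ ->] := poly_moment_integral n p; rewrite W big_distrl /=.
    by apply: eq_bigr => j _; rewrite mulrA.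
have : (fun n => cintegral D0 (fun x => h n x * (w n x)%:C) /
   (Rintegral mu D0 (w n))%:C + 1 : C) @ \oo --> (0 + 1 : C).
  exact: cvgnD lim (cvgn_cst (1 : C)).
rewrite add0r; apply: cvg_trans; apply: near_eq_cvg; apply: nearW => n.
rewrite (eq_cintegral (E n)) cintegralB// cintegralZ//; last exact: Gamma_integrable.
rewrite cintegral_real W realC_nat -GammaE//.
have f0 : (n.+1)`!%:R != 0 :> C by rewrite pnatr_eq0 -lt0n fact_gt0.
have p0 := pw_neq0 n.+1%:R z.
by field; rewrite f0 p0.
Qed.

Lemma Gamma_prod z n : -1 < Rez z ->
  Gamma (z + n.+1%:R) = Gamma (z + 1) * n`!%:R * \prod_(1 <= k < n.+1) (1 + z / k%:R).
Proof.
move=> z1; elim: n => [|n IH]; first by rewrite big_geq // fact0 !mulr1.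
have p0 : 0 < Rez (z + n.+1%:R).
  rewrite reimE -realC_nat /= -natr1 -subr_gt0.
  by have := ler0n R n; move: (n%:R : R) => y; lra.
have -> : z + n.+2%:R = z + n.+1%:R + 1 by rewrite -addrA natr1.
rewrite GammaS // IH factS natrM [X in _ = _ * X]big_nat_recr //=.
have : n.+1%:R != 0 :> C by rewrite pnatr_eq0.
set P := \prod_(_ <= _ < _) _; move: (n.+1%:R : C) => u u0.
by field.
Qed.

Lemma cvg_pw_ratio z : (fun n => pw (n.+2%:R / n.+1%:R : R) z) @ \oo --> (1 : C).
Proof.
pose K := 2 * cabs z * expR (cabs z).
have H : (fun n => K * n.+2%:R^-1 : R) @ \oo --> (0 : R).
  rewrite -[0 in X in _ --> X](mulr0 K); apply: cvgM; first exact: cvg_cst.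
  by have := @cvg_harmonic R; rewrite -cvg_shiftS; exact.
rewrite -cvg_shiftS.
have h : (fun n => pw (n.+3%:R / n.+2%:R : R) z - 1) @ \oo --> (0 : C).
  apply: cvgC0_le H => n; have e : n.+3%:R / n.+2%:R - 1 = n.+2%:R^-1 :> R.
    by rewrite -natr1 mulrDl divff ?pnatr_eq0// mul1r addrAC subrr add0r.
  have l : `|n.+3%:R / n.+2%:R - 1 : R| <= 2^-1.
    by rewrite e ger0_norm ?invr_ge0 // lef_pV2 ?posrE // ler_nat.
  by apply: le_trans (pw_sub1_le z l) _; rewrite -/K e ger0_norm ?invr_ge0.
apply: (cvgn_eq _ _ (cvgnD h (cvgn_cst (1 : C)))) => [n|]; last exact: add0r.
by rewrite /= subrK.
Qed.

(** The multiplied form comes first, because it is what shows that Gamma (z + 1) is nonzero. The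
    asymptotics are used at z + 1, whose real part is positive; the shift in the index is corrected
    by ratios tending to 1. *)
Lemma Gamma_Gauss_mul z : -1 < Rez z ->
  (fun n => Gamma (z + 1) * ((\prod_(1 <= k < n.+1) (1 + z / k%:R)) / pw (n%:R : R) z) : C)
    @ \oo --> (1 : C).
Proof.
move=> z1; rewrite -(cvg_shiftn 2).
have z1' : 0 <= Rez (z + 1) by rewrite reimE /=; lra.
have h1 := Gamma_asymp_ge0 z1'.
have h2 : (fun n => ((n.+1%:R / n.+2%:R : R)%:C : C)) @ \oo --> ((1 : R)%:C : C).
  apply: cvg_realC; 
  apply: (cvgn_eq _ _ (cvgnV (@oner_neq0 R) (@cvg_natr_ratio 1))) => [n|]; last exact: invr1.
  by rewrite addn1 invf_div.
have h3   := cvgnV (@oner_neq0 C) (cvg_pw_ratio z).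
apply: (cvgn_eq _ _ (cvgnM (cvgnM h1 h2) h3)) => [n|]; last by rewrite invr1 !mulr1.
rewrite /=.
rewrite addnS addn1.
have -> : z + 1 + n.+2%:R = z + n.+3%:R by rewrite -addrA nat1r.
rewrite Gamma_prod // pwM ?invr_gt0 ?ltr0n //.
have -> : pw (n.+1%:R^-1) z = (pw n.+1%:R z)^-1.
  by rewrite -pwN /pw lnV ?posrE ?ltr0n // realCN mulrN mulNr.
have -> : pw n.+1%:R (z + 1) = pw n.+1%:R z * n.+1%:R.
  rewrite pwD; congr (_ * _); have := @pw_nat R n.+1%:R 1; rewrite ltr0n expr1 => ->//.
  exact: realC_nat.
rewrite realCM realCV !realC_nat factS natrM.
have : (n.+1)`!%:R != 0 :> C by rewrite pnatr_eq0 -lt0n fact_gt0.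
have : n.+1%:R != 0 :> C by rewrite pnatr_eq0.
have : n.+2%:R != 0 :> C by rewrite pnatr_eq0.
have := pw_neq0 n.+1%:R z; have := pw_neq0 n.+2%:R z.
set P := \prod_(_ <= _ < _) _; set G := Gamma _.
move: (n.+1%:R : C) (n.+2%:R : C) ((n.+1)`!%:R : C) (pw n.+1%:R z) (pw n.+2%:R z).
by move=> a b c d e e0 d0 b0 a0 c0; field; rewrite a0 b0 c0 d0 e0.
Qed.

Lemma Gamma_neq0 z : -1 < Rez z -> Gamma (z + 1) != 0.
Proof.
move=> z1; apply/eqP => G0; have h := Gamma_Gauss_mul z1.
have h0 : (fun n : nat => 0 : C) @ \oo --> (1 : C).
  by apply: (cvgn_eq _ _ h) => // n; rewrite G0 mul0r.
have /eqP : (0 : C) = 1 := cvgC_unique (cvgn_cst (0 : C)) h0.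
by rewrite eq_sym oner_eq0.
Qed.

Lemma Gamma_Gauss z : -1 < Rez z ->
  (fun n => (\prod_(1 <= k < n.+1) (1 + z / k%:R)) / pw (n%:R : R) z : C)
    @ \oo --> ((Gamma (z + 1))^-1 : C).
Proof.
move=> z1; apply: (cvgn_eq _ _ (cvgnM (cvgn_cst (Gamma (z + 1))^-1) (Gamma_Gauss_mul z1))) => [n|].
  by rewrite /= mulKf // Gamma_neq0.
exact: mulr1.
Qed.

End GaussProduct.

(** * The integral Z(s, t) *)

Section ExhaustBounded.
Variable R : realType.
Local Notation mu := (@lebesgue_measure R).

(** Integrability alone needs no limits at the end points, only a primitive with bounded
    increments. *)
Lemma ge0_rintegrable_exhaust (a b : nat -> R) (D : set R) (F f : R -> R) (B : R) :
  (forall n, a n < b n) -> {homo a : m n / (m <= n)%N >-> n <= m} ->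
  {homo b : m n / (m <= n)%N >-> m <= n} -> D = \bigcup_n `[a n, b n]%classic ->
  {in D, continuous f} -> (forall x, D x -> is_derive x 1 F (f x)) ->
  (forall x, D x -> 0 <= f x) -> (forall n, F (b n) - F (a n) <= B) -> rintegrable D f.
Proof.
move=> ab ha hb DE cf dF f0 FB.
have mf := exhausted_continuous_measurable DE cf.
have mD := exhausted_measurable DE.
have E : (\int[mu]_(x in D) (f x)%:E <= B%:E)%E.
  have := @ge0_nondecreasing_set_cvg_integral _ (measurableTypeR R) R (fun n => `[a n, b n]%classic)
    (EFin \o f) mu (exhausted_nondecreasing ha hb) _ _ _.
  rewrite -DE => h; apply: (cvge_le _ (h _ _ _)) => //.
  - by apply: nearW => n; rewrite (ftc_piece ab DE _ cf dF) lee_fin.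
  - by move=> n; apply/measurable_EFinP; exact: (measurable_funS mD (@exhausted_subset _ _ _ _ DE n) mf).
  - by move=> n x /(@exhausted_subset _ _ _ _ DE) Dx; rewrite lee_fin f0.
apply/integrableP; split; first exact/measurable_EFinP.
have -> : (\int[mu]_(x in D) `|(EFin \o f) x| = \int[mu]_(x in D) (f x)%:E)%E.
  by apply: eq_integral => x /set_mem Dx /=; rewrite ger0_norm // f0.
by rewrite (le_lt_trans E) // ltry.
Qed.

Lemma rintegrable_setU (A B : set R) (f : R -> R) : measurable A -> measurable B ->
  [disjoint A & B] -> rintegrable A f -> rintegrable B f -> rintegrable (A `|` B) f.
Proof.
move=> mA mB AB /integrableP[mfA iA] /integrableP[mfB iB].
have mf : measurable_fun (A `|` B) (EFin \o f) by apply/measurable_funU.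
apply/integrableP; split => //.
rewrite (@ge0_integral_setU _ (measurableTypeR R)) //; first exact: lte_add_pinfty.
exact: measurableT_comp.
Qed.

End ExhaustBounded.

(** * Powers of sine and cosine on an arc where neither vanishes *)

Section Arc.
Variable R : realType.
Local Notation C := (Cx R).
Local Notation mu := (@lebesgue_measure R).
(* [f] and [g] stand for |2 sin (pi x)| and |2 cos (pi x)| on an interval where neither
   vanishes; [eps] is the sign of sin (pi x) * cos (pi x) there. *)
Variables (lo hi eps : R) (f g : R -> R).
Hypothesis lohi : lo < hi.
Hypothesis eps1 : eps = 1 \/ eps = -1.
Let D : set R := `]lo, hi[%classic.
Hypothesis f_gt0 : forall x, D x -> 0 < f x.
Hypothesis g_gt0 : forall x, D x -> 0 < g x.
Hypothesis f_derive : forall x, D x -> is_derive x 1 f (eps * pi * g x).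
Hypothesis g_derive : forall x, D x -> is_derive x 1 g (- (eps * pi * f x)).
Hypothesis fg4 : forall x, D x -> f x ^+ 2 + g x ^+ 2 = 4.
(** The denominators start at 3 so that [a 0 < b 0]. *)
Let a (n : nat) : R := lo + (hi - lo) / n.+3%:R.
Let b (n : nat) : R := hi - (hi - lo) / n.+3%:R.
Hypothesis fg_a : (fun n => f (a n) * g (a n)) @ \oo --> (0 : R).
Hypothesis fg_b : (fun n => f (b n) * g (b n)) @ \oo --> (0 : R).

Let mD : measurable D. Proof. exact: measurable_itv. Qed.

Let DP x : D x <-> lo < x < hi.
Proof. by rewrite /D /= in_itv. Qed.

Let step_gt0 n : 0 < (hi - lo) / n.+3%:R.
Proof. by rewrite divr_gt0 ?subr_gt0. Qed.

Let ab n : a n < b n.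
Proof.
rewrite /a /b -subr_gt0.
have -> : hi - (hi - lo) / n.+3%:R - (lo + (hi - lo) / n.+3%:R) =
    (hi - lo) * (1 - 2 / n.+3%:R) by ring.
by rewrite mulr_gt0 ?subr_gt0// ltr_pdivrMr ?ltr0n// mul1r ltr_nat.
Qed.

Let a_noninc : {homo a : m n / (m <= n)%N >-> n <= m}.
Proof.
move=> m n mn; rewrite lerD2l ler_pM2l ?subr_gt0// lef_pV2 ?posrE ?ltr0n//.
by rewrite ler_nat !ltnS.
Qed.

Let b_nondec : {homo b : m n / (m <= n)%N >-> m <= n}.
Proof.
move=> m n mn; rewrite lerD2l lerN2 ler_pM2l ?subr_gt0// lef_pV2 ?posrE ?ltr0n//.
by rewrite ler_nat !ltnS.
Qed.

Let DE : D = \bigcup_n `[a n, b n]%classic.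
Proof.
apply/seteqP; split => x.
  move=> /DP /andP[lx xh].
  have [lx0 xh0] : 0 < x - lo /\ 0 < hi - x by rewrite !subr_gt0.
  pose c := (hi - lo) * ((x - lo)^-1 + (hi - x)^-1).
  have hl : 0 < hi - lo by rewrite subr_gt0.
  have c0 : 0 <= c.
    by apply: mulr_ge0; [exact: ltW|rewrite addr_ge0 ?invr_ge0 ?ltW].
  have := archi_boundP c0; set n := Num.bound _ => cn.
  exists n => //; rewrite /= in_itv /= /a /b.
  have n3 : c <= n.+3%:R by rewrite (le_trans (ltW cn)) // ler_nat -addn3 leq_addr.
  have h1 : (hi - lo) / (x - lo) <= n.+3%:R.
    by apply: le_trans n3; rewrite /c mulrDr lerDl divr_ge0 // ltW.
  have h2 : (hi - lo) / (hi - x) <= n.+3%:R.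
    by apply: le_trans n3; rewrite /c mulrDr lerDr divr_ge0 // ltW.
  rewrite ler_pdivrMr// mulrC -ler_pdivrMr ?ltr0n// in h1.
  rewrite ler_pdivrMr// mulrC -ler_pdivrMr ?ltr0n// in h2.
  by move: ((hi - lo) / n.+3%:R) h1 h2 => q h1 h2; apply/andP; split; lra.
move=> [n _]; rewrite /= in_itv /= => /andP[h1 h2]; apply/DP; apply/andP; split.
  by apply: lt_le_trans h1; rewrite ltrDl.
by apply: le_lt_trans h2 _; rewrite gtrDl oppr_lt0.
Qed.

Let aD n : D (a n).
Proof. by rewrite DE; exists n => //; rewrite /= in_itv /= lexx ltW. Qed.

Let bD n : D (b n).
Proof. by rewrite DE; exists n => //; rewrite /= in_itv /= lexx ltW. Qed.

Lemma arc_le2 x : D x -> f x <= 2 /\ g x <= 2.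
Proof.
move=> Dx; have := fg4 Dx; have f0 := f_gt0 Dx; have g0 := g_gt0 Dx => h.
have f20 := sqr_ge0 (f x); have g20 := sqr_ge0 (g x).
by split; rewrite leNgt; apply/negP => h2; nra.
Qed.

Lemma arc_measurable_f : measurable_fun D f.
Proof.
apply: (exhausted_continuous_measurable DE) => x /set_mem Dx.
have := f_derive Dx => df; apply: differentiable_continuous; apply/derivable1_diffP; exact: ex_derive.
Qed.

Lemma arc_measurable_g : measurable_fun D g.
Proof.
apply: (exhausted_continuous_measurable DE) => x /set_mem Dx.
have := g_derive Dx => df; apply: differentiable_continuous; apply/derivable1_diffP; exact: ex_derive.
Qed.

Let cont_of_derive (h : R -> R) (x d : R) : is_derive x 1 h d -> {for x, continuous h}.
Proof. by move=> dh; apply: differentiable_continuous; apply/derivable1_diffP; exact: ex_derive. Qed.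

Lemma expR_mul_ln_le2 (c u : R) : 0 <= c -> 0 < u -> u <= 2 -> expR (c * ln u) <= expR (c * ln 2).
Proof. by move=> c0 u0 u2; rewrite ler_expR ler_wpM2l // ler_ln ?posrE. Qed.

Lemma is_derive_expR_ln (h : R -> R) (x d c : R) : 0 < h x -> is_derive x 1 h d ->
  is_derive x 1 (fun y => expR (c * ln (h y))) (c * d * expR ((c - 1) * ln (h x))).
Proof.
move=> h0 hd.
have h2 := @is_derive1_comp R (@ln R) h x _ _ (is_derive1_ln h0) hd.
have := @is_derive1_comp R (@expR R) _ x _ _ (is_derive_expR _) (is_deriveZ c h2).
move=> h5; apply: (is_derive_eq h5); rewrite /GRing.scale /= mulrBl mul1r expRD expRN lnK ?posrE //.
have -> : c *: ln (h x) = c * ln (h x) by [].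
have hx0 : h x != 0 by rewrite gt_eqF.
by field.
Qed.

(** Up to a constant, g f^c is the derivative of f^(c + 1), which is bounded because 0 < f <= 2 and
    c + 1 > 0; the roles of f and g are exchanged by changing the sign [eps]. *)
Lemma arc_integrable_aux (c : R) : -1 < c ->
  rintegrable D (fun x => g x * expR (c * ln (f x))) /\
  rintegrable D (fun x => f x * expR (c * ln (g x))).
Proof.
move=> c1; have c0 : 0 < c + 1 by rewrite -ltrBlDr sub0r.
have cpi : 0 < (c + 1) * pi by rewrite mulr_gt0 ?pi_gt0.
have E (h k : R -> R) (e : R) : e = 1 \/ e = -1 -> (forall x, D x -> 0 < h x /\ h x <= 2) ->
    (forall x, D x -> 0 <= k x) ->
    (forall x, D x -> is_derive x 1 h (e * pi * k x)) ->
    (forall x, D x -> {for x, continuous k}) ->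
    rintegrable D (fun x => k x * expR (c * ln (h x))).
  move=> e1 h0 k0 hd ck.
  pose F x := e * expR ((c + 1) * ln (h x)).
  pose df x := (c + 1) * pi * (k x * expR (c * ln (h x))).
  have Fd x : D x -> is_derive x 1 F (df x).
    move=> Dx; have [hx _] := h0 _ Dx.
    have h5 := is_deriveZ e (is_derive_expR_ln (c + 1) hx (hd _ Dx)).
    apply: (is_derive_eq h5); rewrite /GRing.scale /= addrK /df.
    by case: e1 => ->; ring.
  have ig : rintegrable D df.
    apply: (@ge0_rintegrable_exhaust R a b D F df (expR ((c + 1) * ln 2)) ab a_noninc b_nondec DE) => //.
    - move=> x /set_mem Dx; have [hx _] := h0 _ Dx.
      apply: (@continuousM _ _ (fun=> (c + 1) * pi) (fun x => k x * expR (c * ln (h x)))); first exact: cvg_cst.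
      apply: (@continuousM _ _ k (fun x => expR (c * ln (h x)))); first exact: ck.
      exact: cont_of_derive (is_derive_expR_ln c hx (hd _ Dx)).
    - by move=> x Dx; rewrite mulr_ge0 ?(ltW cpi)// mulr_ge0 ?k0 ?expR_ge0.
    - move=> n; have [hb hb2] := h0 _ (bD n); have [ha ha2] := h0 _ (aD n); rewrite /F.
      have := expR_mul_ln_le2 (ltW c0) hb hb2; have := expR_ge0 ((c + 1) * ln (h (a n))).
      have := expR_mul_ln_le2 (ltW c0) ha ha2; have := expR_ge0 ((c + 1) * ln (h (b n))).
      by case: e1 => ->; lra.
  apply: eq_rintegrable (rintegrableZ ((c + 1) * pi)^-1 mD ig) => // x _.
  by rewrite /df mulKf // gt_eqF.
split.
  apply: (E f g eps) => //.
  - by move=> x Dx; split; [exact: f_gt0|have [] := arc_le2 Dx].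
  - by move=> x Dx; rewrite ltW // g_gt0.
  - by move=> x Dx; exact: cont_of_derive (g_derive Dx).
apply: (E g f (- eps)) => //.
- by case: eps1 => ->; [right|left; rewrite opprK].
- by move=> x Dx; split; [exact: g_gt0|have [] := arc_le2 Dx].
- by move=> x Dx; rewrite ltW // f_gt0.
- by move=> x Dx; rewrite mulNr mulNr; exact: g_derive.
- by move=> x Dx; exact: cont_of_derive (f_derive Dx).
Qed.

(** As f^2 + g^2 = 4, f and g are never both small: either g >= 1 and g^d is at most a constant
    times g, or f >= 1 and f^c is at most a constant times f. Both cases fall under
    [arc_integrable_aux]. *)
Lemma arc_rintegrable (c d : R) : -1 < c -> -1 < d ->
  rintegrable D (fun x => expR (c * ln (f x)) * expR (d * ln (g x))).
Proof.
move=> c1 d1.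
have [i1 _] := arc_integrable_aux c1; have [_ i2] := arc_integrable_aux d1.
pose A := expR (`|d - 1| * ln 2); pose B := expR (`|c - 1| * ln 2).
apply: (@le_rintegrable R D _ (fun x => A * (g x * expR (c * ln (f x))) +
   B * (f x * expR (d * ln (g x)))) mD); last by apply: rintegrableD => //; exact: rintegrableZ.
  have me (h : R -> R) e : measurable_fun D h -> measurable_fun D (fun x => expR (e * ln (h x))).
    move=> mh; apply: (measurableT_comp (@measurable_expR R)); apply: measurable_funM.
      exact: measurable_cst.
    exact: (measurableT_comp (@measurable_ln R)).
  by apply: measurable_funM; apply: me; [exact: arc_measurable_f|exact: arc_measurable_g].
have K (u e : R) : 1 <= u -> u <= 2 -> expR (e * ln u) <= expR (`|e - 1| * ln 2) * u.
  move=> u1 u2; have u0 : 0 < u by exact: lt_le_trans u1.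
  have -> : e * ln u = (e - 1) * ln u + ln u by ring.
  rewrite expRD lnK ?posrE// ler_wpM2r ?(ltW u0)// ler_expR.
  apply: (@le_trans _ _ (`|e - 1| * ln u)).
    by rewrite ler_wpM2r ?ler_norm// ln_ge0.
  by rewrite ler_wpM2l // ler_ln ?posrE.
move=> x Dx; have [f2 g2] := arc_le2 Dx; have f0 := f_gt0 Dx; have g0 := g_gt0 Dx.
rewrite ger0_norm ?mulr_ge0 ?expR_ge0//.
have T1 : 0 <= A * (g x * expR (c * ln (f x))) by rewrite !mulr_ge0 ?expR_ge0 ?ltW.
have T2 : 0 <= B * (f x * expR (d * ln (g x))) by rewrite !mulr_ge0 ?expR_ge0 ?ltW.
have [g1|g1] := leP 1 (g x).
  apply: (@le_trans _ _ (A * (g x * expR (c * ln (f x))))); last by rewrite lerDl.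
  by rewrite mulrA [leLHS]mulrC ler_wpM2r ?expR_ge0// K.
apply: (@le_trans _ _ (B * (f x * expR (d * ln (g x))))); last by rewrite lerDr.
rewrite mulrA ler_wpM2r ?expR_ge0// K //.
have := fg4 Dx; have : g x ^+ 2 < 1 by rewrite expr_lt1 // ltW.
move=> h4 h; rewrite -(@ler_pXn2r _ 2) ?nnegrE ?ltW//; rewrite expr1n; lra.
Qed.

Lemma arc_cintegrable (s t : C) : -1 < Rez s -> -1 < Rez t ->
  cintegrable D (fun x => pw (f x) s * pw (g x) t).
Proof.
move=> s1 t1; apply: (le_cintegrable mD _ _ (arc_rintegrable s1 t1)).
  apply: cmeasurableM; apply: cmeasurable_pw => //.
    exact: arc_measurable_f.
  exact: arc_measurable_g.
by move=> x _; rewrite cabsM !cabs_pw.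
Qed.

Lemma cvg_expR_ln0 (c : R) (v : nat -> R) : 0 < c -> (forall n, 0 < v n) ->
  v @ \oo --> (0 : R) -> (fun n => expR (c * ln (v n))) @ \oo --> (0 : R).
Proof.
move=> c0 v0 /cvgrPdist_lt vl; apply/cvgrPdist_lt => e e0.
have := vl _ (expR_gt0 (ln e / c)); apply: filterS => n.
rewrite !sub0r !normrN (ger0_norm (expR_ge0 _)) gtr0_norm // => h.
rewrite -[ltRHS]lnK ?posrE// ltr_expR mulrC -ltr_pdivlMr//.
by rewrite -[ltRHS]expRK ltr_ln ?posrE ?expR_gt0.
Qed.

(** With r the smaller real part, |f^s g^t| is at most a constant times (f g)^r. A single hypothesis
    on f g thus covers end points where f vanishes as well as those where g does. *)
Lemma arc_boundary (s t : C) (v : nat -> R) : 0 < Rez s -> 0 < Rez t -> (forall n, D (v n)) ->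
  (fun n => f (v n) * g (v n)) @ \oo --> (0 : R) ->
  (fun n => pw (f (v n)) s * pw (g (v n)) t) @ \oo --> (0 : C).
Proof.
move=> s0 t0 Dv lim; pose r := Num.min (Rez s) (Rez t).
have r0 : 0 < r by rewrite lt_min s0.
have rs : 0 <= Rez s - r by rewrite subr_ge0 ge_min lexx.
have rt : 0 <= Rez t - r by rewrite subr_ge0 ge_min lexx orbT.
pose K := expR ((Rez s - r) * ln 2) * expR ((Rez t - r) * ln 2).
have h := @cvg_expR_ln0 r (fun n => f (v n) * g (v n)) r0
   (fun n => mulr_gt0 (f_gt0 (Dv n)) (g_gt0 (Dv n))) lim.
apply: (@cvgC0_le _ _ (fun n => K * expR (r * ln (f (v n) * g (v n))))); last first.
  by rewrite -[0 in X in _ --> X](mulr0 K); apply: cvgnM h; exact: cvgn_cst.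
move=> n; rewrite cabsM !cabs_pw.
have [f2 g2] := arc_le2 (Dv n); have f0 := f_gt0 (Dv n); have g0 := g_gt0 (Dv n).
rewrite lnM ?posrE // mulrDr expRD.
have -> : Rez s * ln (f (v n)) = (Rez s - r) * ln (f (v n)) + r * ln (f (v n)) by ring.
have -> : Rez t * ln (g (v n)) = (Rez t - r) * ln (g (v n)) + r * ln (g (v n)) by ring.
rewrite !expRD mulrACA ler_wpM2r ?mulr_ge0 ?expR_ge0//.
by rewrite ler_pM ?expR_ge0 // expR_mul_ln_le2.
Qed.

Let I (s t : C) : C := cintegral D (fun x => pw (f x) s * pw (g x) t).

Lemma pw_succ (u : R) (s : C) : 0 < u -> pw u (s + 1) = pw u s * u%:C.
Proof. by move=> u0; rewrite pwD; have := pw_nat 1 u0; rewrite expr1 => ->. Qed.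

Lemma cderive_arc_f x s : D x ->
  cderive (fun y => pw (f y) (s + 1)) x ((eps * pi)%:C * (s + 1) * (g x)%:C * pw (f x) s).
Proof.
move=> Dx; have f0 := f_gt0 Dx.
apply: cderive_eq (cderive_pw (s + 1) f0 (f_derive Dx)) _.
rewrite pw_succ // !realCM realCV.
have : (f x)%:C != 0 :> C by rewrite -cabs_gt0 cabs_real normr_gt0 gt_eqF.
by move: ((f x)%:C : C) => u u0; field.
Qed.

Lemma cderive_arc_g x s : D x ->
  cderive (fun y => pw (g y) (s + 1)) x (- ((eps * pi)%:C * (s + 1) * (f x)%:C * pw (g x) s)).
Proof.
move=> Dx; have g0 := g_gt0 Dx.
apply: cderive_eq (cderive_pw (s + 1) g0 (g_derive Dx)) _.
rewrite pw_succ // mulNr realCN !realCM realCV.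
have : (g x)%:C != 0 :> C by rewrite -cabs_gt0 cabs_real normr_gt0 gt_eqF.
by move: ((g x)%:C : C) => u u0; field.
Qed.

(** The derivative of f^(s + 1) g^(t + 1) is eps pi ((s + 1) f^s g^(t + 2) - (t + 1) f^(s + 2) g^t),
    and the boundary terms vanish since both exponents have positive real part. *)
Lemma arc_parts (s t : C) : -1 < Rez s -> -1 < Rez t ->
  (s + 1) * I s (t + 2) = (t + 1) * I (s + 2) t.
Proof.
move=> s1 t1.
have s3 : -1 < Rez (s + 2) by rewrite reimE /=; lra.
have t3 : -1 < Rez (t + 2) by rewrite reimE /=; lra.
have i1 := arc_cintegrable s1 t3; have i2 := arc_cintegrable s3 t1.
apply/eqP; rewrite -subr_eq0 -!cintegralZ // -cintegralB //; try exact: cintegrableZ.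
have e0 : (eps * pi)%:C != 0 :> C.
  rewrite -cabs_gt0 cabs_real normr_gt0 mulf_neq0 ?(gt_eqF (pi_gt0 R))//.
  by case: eps1 => ->; rewrite ?oppr_eq0 oner_eq0.
rewrite -(inj_eq (mulfI e0)) mulr0 -cintegralZ //; last first.
  by apply: cintegrableB => //; exact: cintegrableZ.
apply/eqP.
apply: (cftc (F := fun x => pw (f x) (s + 1) * pw (g x) (t + 1)) ab a_noninc b_nondec DE).
- move=> x Dx; have f0 := f_gt0 Dx; have g0 := g_gt0 Dx; split.
    apply: cderive_eq (cderiveM (cderive_arc_f s Dx) (cderive_arc_g t Dx)) _.
    have -> : s + 2 = s + 1 + 1 by ring.
    have -> : t + 2 = t + 1 + 1 by ring.
    by rewrite !(pw_succ _ f0) !(pw_succ _ g0); ring.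
  eexists; apply: cderiveM; first exact: cderive_cst.
  apply: cderiveD.
    apply: cderiveM; first exact: cderive_cst.
    exact: cderiveM (cderive_pw _ f0 (f_derive Dx)) (cderive_pw _ g0 (g_derive Dx)).
  apply: cderiveN; apply: cderiveM; first exact: cderive_cst.
  exact: cderiveM (cderive_pw _ f0 (f_derive Dx)) (cderive_pw _ g0 (g_derive Dx)).
- by apply: cintegrableZ => //; apply: cintegrableB => //; exact: cintegrableZ.
have s2 : 0 < Rez (s + 1) by rewrite reimE /=; lra.
have t2 : 0 < Rez (t + 1) by rewrite reimE /=; lra.
have hb := arc_boundary s2 t2 bD fg_b; have ha := arc_boundary s2 t2 aD fg_a.
have := cvgnM (cvgn_cst (-1 : C)) ha; rewrite mulr0 => ha'.
apply: (cvgn_eq _ _ (cvgnD hb ha')) => [n|]; last by rewrite addr0.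
by rewrite mulN1r.
Qed.

Lemma arc_split (s t : C) : -1 < Rez s -> -1 < Rez t ->
  I (s + 2) t + I s (t + 2) = 4 * I s t.
Proof.
move=> s1 t1.
have s3 : -1 < Rez (s + 2) by rewrite reimE /=; lra.
have t3 : -1 < Rez (t + 2) by rewrite reimE /=; lra.
have i1 := arc_cintegrable s1 t3; have i2 := arc_cintegrable s3 t1.
rewrite -cintegralD // -cintegralZ //; last exact: arc_cintegrable.
apply: eq_cintegral => x Dx; have f0 := f_gt0 Dx; have g0 := g_gt0 Dx.
have -> : s + 2 = s + 1 + 1 by ring.
have -> : t + 2 = t + 1 + 1 by ring.
rewrite !(pw_succ _ f0) !(pw_succ _ g0).
have -> : (4 : C) = (f x)%:C ^+ 2 + (g x)%:C ^+ 2.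
  by rewrite -!realCX -realCD fg4 // realC_nat.
by ring.
Qed.

End Arc.

(** * The integral over the two arcs of the unit interval *)

Section ZetaMahlerIntegral.
Variable R : realType.
Local Notation C := (Cx R).
Local Notation mu := (@lebesgue_measure R).
Implicit Types (s t : C) (x : R).

Definition sinabs x : R := `|2 * sin (pi * x)|.
Definition cosabs x : R := `|2 * cos (pi * x)|.
Local Notation f := sinabs.
Local Notation g := cosabs.

Let D1 : set R := `]0, 2^-1[%classic.
Let D2 : set R := `]2^-1, 1[%classic.
(** The zeros 0, 1/2 and 1 of sine and cosine are removed: they form a null set, and on the rest
    [cpowR] agrees with [pw]. *)
Definition arcs : set R := `]0, 2^-1[ `|` `]2^-1, 1[.
Local Notation D := arcs.

Lemma measurable_arcs : measurable D.
Proof. by apply: measurableU; exact: measurable_itv. Qed.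

Let disj : [disjoint D1 & D2].
Proof.
apply/disj_setPS => x []; rewrite /D1 /D2 /= !in_itv /= => /andP[_ h1] /andP[h2 _].
by have := lt_trans h1 h2; rewrite ltxx.
Qed.

Let trig1 x : D1 x -> 0 < sin (pi * x) /\ 0 < cos (pi * x).
Proof.
rewrite /D1 /= in_itv /= => /andP[x0 x2]; have p0 := pi_gt0 R.
have px0 : 0 < pi * x by rewrite mulr_gt0.
have px2 : pi * x < pi / 2 by rewrite ltr_pM2l.
split; first by apply: sin_gt0_pihalf; rewrite px0.
by apply: cos_gt0_pihalf; rewrite px2 andbT (lt_trans _ px0)// oppr_lt0 divr_gt0.
Qed.

Let trig2 x : D2 x -> 0 < sin (pi * x) /\ 0 < - cos (pi * x).
Proof.
rewrite /D2 /= in_itv /= => /andP[x0 x2]; have p0 := pi_gt0 R.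
have px0 : pi / 2 < pi * x by rewrite ltr_pM2l.
have px2 : pi * x < pi by rewrite gtr_pMr.
split; first by apply: sin_gt0_pi; rewrite px2 (lt_trans _ px0)// divr_gt0.
rewrite -(opprK (cos _)) opprK -[pi * x](subrK pi) cosDpi opprK.
apply: cos_gt0_pihalf; lra.
Qed.

Let sinpix_derive x : is_derive x 1 (fun y : R => 2 * sin (pi * y)) (pi * (2 * cos (pi * x))).
Proof.
have h := is_deriveZ (pi : R) (is_derive_id x (1 : R)).
have h2 := @is_derive1_comp R (@sin R) _ x _ _ (is_derive_sin _) h.
apply: (is_derive_eq (is_deriveZ (2 : R) h2)).
by rewrite /GRing.scale /= mulr1; ring.
Qed.

Let cospix_derive x : is_derive x 1 (fun y : R => 2 * cos (pi * y)) (- (pi * (2 * sin (pi * x)))).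
Proof.
have h := is_deriveZ (pi : R) (is_derive_id x (1 : R)).
have h2 := @is_derive1_comp R (@cos R) _ x _ _ (is_derive_cos _) h.
apply: (is_derive_eq (is_deriveZ (2 : R) h2)).
by rewrite /GRing.scale /= mulr1; ring.
Qed.

Let f1 (x : R) : R := 2 * sin (pi * x).
Let g1 (x : R) : R := 2 * cos (pi * x).
Let g2 (x : R) : R := - (2 * cos (pi * x)).

Let g2_derive x : is_derive x 1 g2 (pi * (2 * sin (pi * x))).
Proof. by apply: (is_derive_eq (is_deriveN (cospix_derive x))); rewrite opprK. Qed.

Let f1_gt0 x : D1 x -> 0 < f1 x. Proof. by move=> /trig1[h _]; rewrite mulr_gt0. Qed.
Let g1_gt0 x : D1 x -> 0 < g1 x. Proof. by move=> /trig1[_ h]; rewrite mulr_gt0. Qed.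
Let f2_gt0 x : D2 x -> 0 < f1 x. Proof. by move=> /trig2[h _]; rewrite mulr_gt0. Qed.
Let g2_gt0 x : D2 x -> 0 < g2 x. Proof. by move=> /trig2[_ h]; rewrite /g2 -mulrN mulr_gt0. Qed.

Let sq4 x : (2 * sin (pi * x)) ^+ 2 + (2 * cos (pi * x)) ^+ 2 = 4.
Proof. by rewrite !exprMn -mulrDr addrC cos2Dsin2; ring. Qed.

Let e1 : (1 : R) = 1 \/ (1 : R) = -1. Proof. by left. Qed.
Let e2 : (-1 : R) = 1 \/ (-1 : R) = -1. Proof. by right. Qed.
Let h01 : (0 : R) < 2^-1. Proof. by rewrite invr_gt0. Qed.
Let h12 : (2^-1 : R) < 1. Proof. by rewrite invf_lt1 // ltr1n. Qed.

Let fd1 x : D1 x -> is_derive x 1 f1 (1 * pi * g1 x).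
Proof. by move=> _; rewrite mul1r; exact: sinpix_derive. Qed.
Let gd1 x : D1 x -> is_derive x 1 g1 (- (1 * pi * f1 x)).
Proof. by move=> _; rewrite mul1r; exact: cospix_derive. Qed.
Let fd2 x : D2 x -> is_derive x 1 f1 (-1 * pi * g2 x).
Proof. by move=> _; apply: (is_derive_eq (sinpix_derive x)); rewrite /g2; ring. Qed.
Let gd2 x : D2 x -> is_derive x 1 g2 (- (-1 * pi * f1 x)).
Proof. by move=> _; apply: (is_derive_eq (g2_derive x)); rewrite /f1; ring. Qed.
Let sq1 x : D1 x -> f1 x ^+ 2 + g1 x ^+ 2 = 4. Proof. by move=> _; exact: sq4. Qed.
Let sq2 x : D2 x -> f1 x ^+ 2 + g2 x ^+ 2 = 4.
Proof. by move=> _; rewrite /g2 sqrrN; exact: sq4. Qed.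

Let lim_step (c d : R) : (fun n => c + d / n.+3%:R) @ \oo --> c.
Proof.
have h : (fun n => n.+3%:R^-1 : R) @ \oo --> (0 : R).
  by have := @cvg_harmonic R; rewrite -2!cvg_shiftS; exact.
by apply: (cvgn_eq _ _ (cvgnD (cvgn_cst c) (cvgnM (cvgn_cst d) h))) => //; rewrite mulr0 addr0.
Qed.

Let lim_fg (v : nat -> R) (l : R) : v @ \oo --> l -> sin (pi * l) * cos (pi * l) = 0 ->
  (fun n => f1 (v n) * g1 (v n)) @ \oo --> (0 : R).
Proof.
move=> vl z; have pl := cvgnM (cvgn_cst (pi : R)) vl.
have hs := @cvgn_comp R (@sin R) _ _ (@continuous_sin R _) pl.
have hc := @cvgn_comp R (@cos R) _ _ (@continuous_cos R _) pl.
apply: (cvgn_eq _ _ (cvgnM (cvgnM (cvgn_cst (2:R)) hs) (cvgnM (cvgn_cst (2:R)) hc))) => //.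
by rewrite mulrACA z mulr0.
Qed.

Let lim_fg2 (v : nat -> R) (l : R) : v @ \oo --> l -> sin (pi * l) * cos (pi * l) = 0 ->
  (fun n => f1 (v n) * g2 (v n)) @ \oo --> (0 : R).
Proof.
move=> vl z; apply: (cvgn_eq _ _ (cvgnM (cvgn_cst (-1 : R)) (lim_fg vl z))) => [n|].
  by rewrite mulN1r /g2 mulrN.
by rewrite mulr0.
Qed.

Let z0 : sin (pi * 0 : R) * cos (pi * 0) = 0. Proof. by rewrite mulr0 sin0 mul0r. Qed.
Let z2 : sin (pi * 2^-1 : R) * cos (pi * 2^-1) = 0. Proof. by rewrite cos_pihalf mulr0. Qed.
Let z1 : sin (pi * 1 : R) * cos (pi * 1) = 0. Proof. by rewrite mulr1 sinpi mul0r. Qed.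

Let lim_stepN (c d : R) : (fun n => c - d / n.+3%:R) @ \oo --> c.
Proof.
by apply: (cvgn_eq _ _ (@lim_step c (- d))) => // n; rewrite mulNr.
Qed.

Let fga1 := lim_fg (@lim_step 0 (2^-1 - 0)) z0.
Let fgb1 := lim_fg (@lim_stepN 2^-1 (2^-1 - 0)) z2.
Let fga2 := lim_fg2 (@lim_step 2^-1 (1 - 2^-1)) z2.
Let fgb2 := lim_fg2 (@lim_stepN 1 (1 - 2^-1)) z1.

Lemma arcs_gt0 x : D x -> 0 < f x /\ 0 < g x.
Proof.
rewrite /f /g => -[/trig1[h1 h2]|/trig2[h1 h2]].
  by rewrite !normr_gt0 !mulf_neq0 ?gt_eqF.
have c0 : cos (pi * x) != 0 by rewrite -oppr_eq0 gt_eqF.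
by rewrite !normr_gt0 !mulf_neq0 ?(gt_eqF h1).
Qed.

Lemma sinabs2_cosabs2 x : f x ^+ 2 + g x ^+ 2 = 4.
Proof. by rewrite /f /g !real_normK ?num_real. Qed.

Let fgD1 x : D1 x -> f x = f1 x /\ g x = g1 x.
Proof. by move=> /trig1[h1 h2]; rewrite /f /g !gtr0_norm ?mulr_gt0. Qed.

Let fgD2 x : D2 x -> f x = f1 x /\ g x = g2 x.
Proof.
move=> /trig2[h1 h2]; rewrite /f /g gtr0_norm ?mulr_gt0//; split => //.
by rewrite ltr0_norm // -oppr_gt0 -mulrN mulr_gt0.
Qed.

Lemma measurable_sinabs : measurable_fun D f.
Proof.
apply: measurable_funTS; apply: (measurableT_comp (@normr_measurable R setT)).
apply: continuous_measurable_fun => x; have h := sinpix_derive x.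
by apply: differentiable_continuous; apply/derivable1_diffP; exact: ex_derive.
Qed.

Lemma measurable_cosabs : measurable_fun D g.
Proof.
apply: measurable_funTS; apply: (measurableT_comp (@normr_measurable R setT)).
apply: continuous_measurable_fun => x; have h := cospix_derive x.
by apply: differentiable_continuous; apply/derivable1_diffP; exact: ex_derive.
Qed.

Lemma arcs_rintegrable (c d : R) : -1 < c -> -1 < d ->
  rintegrable D (fun x => expR (c * ln (f x)) * expR (d * ln (g x))).
Proof.
move=> c1 d1; apply: rintegrable_setU; [exact: measurable_itv|exact: measurable_itv|exact: disj| |].
  apply: eq_rintegrable (arc_rintegrable h01 e1 f1_gt0 g1_gt0 fd1 gd1 sq1 c1 d1) => //.
  by move=> x /fgD1[-> ->].
apply: eq_rintegrable (arc_rintegrable h12 e2 f2_gt0 g2_gt0 fd2 gd2 sq2 c1 d1) => //.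
by move=> x /fgD2[-> ->].
Qed.

Lemma Z_integrable s t : -1 < Rez s -> -1 < Rez t ->
  cintegrable D (fun x => pw (f x) s * pw (g x) t).
Proof.
move=> s1 t1; apply: (le_cintegrable measurable_arcs _ _ (arcs_rintegrable s1 t1)).
  apply: cmeasurableM; apply: cmeasurable_pw => //; try exact: measurable_arcs.
    exact: measurable_sinabs.
  exact: measurable_cosabs.
by move=> x _; rewrite cabsM !cabs_pw.
Qed.

Definition Z s t : C := cintegral D (fun x => pw (f x) s * pw (g x) t).

Lemma cintegral_setU (A B : set R) (F : R -> C) : measurable A -> measurable B ->
  [disjoint A & B] -> cintegrable (A `|` B) F ->
  cintegral (A `|` B) F = cintegral A F + cintegral B F.
Proof.
move=> mA mB AB [Fr Fi]; apply: eqC; rewrite !reimE !(Re_cintegral, Im_cintegral).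
  exact: Rintegral_setU.
exact: Rintegral_setU.
Qed.

Let ZE s t : -1 < Rez s -> -1 < Rez t ->
  Z s t = cintegral D1 (fun x => pw (f1 x) s * pw (g1 x) t) +
          cintegral D2 (fun x => pw (f1 x) s * pw (g2 x) t).
Proof.
move=> hs ht.
rewrite /Z (cintegral_setU (measurable_itv _) (measurable_itv _) disj (Z_integrable hs ht)).
by congr (_ + _); apply: eq_cintegral => x; [move=> /fgD1[-> ->]|move=> /fgD2[-> ->]].
Qed.

Lemma Z_parts s t : -1 < Rez s -> -1 < Rez t -> (s + 1) * Z s (t + 2) = (t + 1) * Z (s + 2) t.
Proof.
move=> s1 t1.
have s3 : -1 < Rez (s + 2) by rewrite reimE /=; lra.
have t3 : -1 < Rez (t + 2) by rewrite reimE /=; lra.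
rewrite !ZE // !mulrDr; congr (_ + _).
  exact: (arc_parts h01 e1 f1_gt0 g1_gt0 fd1 gd1 sq1 fga1 fgb1 s1 t1).
exact: (arc_parts h12 e2 f2_gt0 g2_gt0 fd2 gd2 sq2 fga2 fgb2 s1 t1).
Qed.

Lemma Z_split s t : -1 < Rez s -> -1 < Rez t -> Z (s + 2) t + Z s (t + 2) = 4 * Z s t.
Proof.
move=> s1 t1.
have s3 : -1 < Rez (s + 2) by rewrite reimE /=; lra.
have t3 : -1 < Rez (t + 2) by rewrite reimE /=; lra.
rewrite !ZE // addrACA mulrDr; congr (_ + _).
  exact: (arc_split h01 e1 f1_gt0 g1_gt0 fd1 gd1 sq1 s1 t1).
exact: (arc_split h12 e2 f2_gt0 g2_gt0 fd2 gd2 sq2 s1 t1).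
Qed.

Lemma measurable_fun_setD1 (A : set R) (r : R) (F : R -> \bar R) : measurable (A `\ r) ->
  measurable_fun (A `\ r) F -> measurable_fun A F.
Proof.
move=> mA mF; have [Ar|nAr] := pselect (A r); last by rewrite not_setD1 in mF.
rewrite -(setD1K Ar); apply/measurable_funU => //.
by split => //; exact: measurable_fun_set1.
Qed.

(** The three points are removed one at a time. Measurability is given on the smallest set only, so
    it is first carried back to each larger one. *)
Lemma Rintegral_unit_arcs (F : R -> R) : measurable_fun D F ->
  Rintegral mu `[0, 1] F = Rintegral mu D F.
Proof.
move=> mF; congr fine.
have DE : D = (((`[0, 1]%classic `\ (0 : R)) `\ (2^-1 : R)) `\ (1 : R)).
  apply/seteqP; split => x; rewrite /D /= !in_itv /=.
    move=> h; have {h} : 0 < x < 1 /\ x != 2^-1.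
      case: h => /andP[h1 h2]; split.
      - by rewrite h1 (lt_trans h2).
      - by rewrite lt_eqF.
      - by rewrite h2 (lt_trans _ h1).
      - by rewrite gt_eqF.
    move=> [/andP[x0 x1] x2]; split; [split; [split|]|].
    - by rewrite !ltW.
    - by move=> h; rewrite h ltxx in x0.
    - exact/eqP.
    - by move=> h; rewrite h ltxx in x1.
  move=> [[[/andP[x0 x1] h0] h2] h1].
  have [xlt|xgt|xe] := ltgtP x 2^-1.
  - by left; rewrite andbT lt_neqAle x0 andbT eq_sym; apply/eqP.
  - by right; rewrite lt_neqAle x1 andbT; apply/eqP.
  - by [].
have m1 : measurable (`[0, 1]%classic `\ (0 : R)) by apply: measurableD.
have m2 : measurable ((`[0, 1]%classic `\ (0 : R)) `\ (2^-1 : R)) by apply: measurableD.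
have m3 : measurable (((`[0, 1]%classic `\ (0 : R)) `\ (2^-1 : R)) `\ (1 : R)) by apply: measurableD.
have f3 : measurable_fun (((`[0, 1]%classic `\ (0 : R)) `\ (2^-1 : R)) `\ (1 : R)) (EFin \o F).
  by rewrite -DE; exact/measurable_EFinP.
have f2 := measurable_fun_setD1 m3 f3; have f1' := measurable_fun_setD1 m2 f2.
by rewrite DE (integral_setD1 m3 f3) (integral_setD1 m2 f2) (integral_setD1 m1 f1').
Qed.

End ZetaMahlerIntegral.

(** * Recurrence, concentration and product formula for Z *)

Section ZetaMahlerProduct.
Variable R : realType.
Local Notation C := (Cx R).
Local Notation mu := (@lebesgue_measure R).
Implicit Types (s t z : C) (x : R).
Local Notation f := (@sinabs R).
Local Notation g := (@cosabs R).
Local Notation D := (@arcs R).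

Lemma cintegral_unit_arcs (F : R -> C) : cmeasurable D F -> cintegral `[0, 1] F = cintegral D F.
Proof.
move=> [mr mi]; apply: eqC; rewrite !(Re_cintegral, Im_cintegral).
  exact: Rintegral_unit_arcs.
exact: Rintegral_unit_arcs.
Qed.

Lemma ZxxE s t : -1 < Rez s -> -1 < Rez t -> Zxx s t = Z s t.
Proof.
move=> s1 t1; have E x : D x -> cpowR (f x) s * cpowR (g x) t = pw (f x) s * pw (g x) t.
  by move=> /arcs_gt0[f0 g0]; rewrite !cpowRE.
have mE : cmeasurable D (fun x => cpowR (f x) s * cpowR (g x) t).
  apply: cintegrable_measurable.
  by apply: eq_cintegrable (Z_integrable s1 t1); [exact: measurable_arcs|move=> x /E].
by rewrite /Z -(eq_cintegral E) -(cintegral_unit_arcs mE).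
Qed.

Lemma Z00 : Z (0 : C) 0 = 1.
Proof.
have m1 : cmeasurable D (fun=> 1 : C) by split; exact: measurable_cst.
transitivity (cintegral D (fun=> 1 : C)).
  by apply: eq_cintegral => x _; rewrite !pw0 mulr1.
rewrite -(cintegral_unit_arcs m1) (@cintegral_real R _ (fun=> 1)).
have m01 : mu `[0, 1]%classic = 1%E.
  by rewrite lebesgue_measure_itv /= lte_fin ltr01 -EFinD subr0.
rewrite (@Rintegral_cst _ (measurableTypeR R) R mu `[0, 1]%classic) // mul1r.
exact: (congr1 (fun y => (fine y)%:C) m01).
Qed.

Lemma ReD_nat s n : Rez (s + n%:R) = Rez s + n%:R.
Proof. by rewrite reimE -realC_nat. Qed.

(** [Z_parts] and [Z_split] form a linear system for Z(s + 2, t) and Z(s, t + 2), with solution (s +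
    t + 2) Z(s + 2, t) = 4 (s + 1) Z(s, t). The same step in t, started at (s + 2, t), completes the
    shift. *)
Lemma Z_succ2 s t : -1 < Rez s -> -1 < Rez t ->
  (s + t + 2) * (s + t + 4) * Z (s + 2) (t + 2) = 16 * (s + 1) * (t + 1) * Z s t.
Proof.
move=> s1 t1.
have s3 : -1 < Rez (s + 2) by rewrite (ReD_nat s 2); lra.
have t3 : -1 < Rez (t + 2) by rewrite (ReD_nat t 2); lra.
have p1 := Z_parts s1 t1; have q1 := Z_split s1 t1.
have p2 := Z_parts s3 t1; have q2 := Z_split s3 t1.
have h1 : (s + t + 2) * Z (s + 2) t = 4 * (s + 1) * Z s t.
  have -> : 4 * (s + 1) * Z s t = (s + 1) * (4 * Z s t) by ring.
  by rewrite -q1 mulrDr p1; ring.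
have h2 : (s + t + 4) * Z (s + 2) (t + 2) = 4 * (t + 1) * Z (s + 2) t.
  have -> : 4 * (t + 1) * Z (s + 2) t = (t + 1) * (4 * Z (s + 2) t) by ring.
  by rewrite -q2 mulrDr -p2; ring.
rewrite -mulrA h2.
have -> : (s + t + 2) * (4 * (t + 1) * Z (s + 2) t) = 4 * (t + 1) * ((s + t + 2) * Z (s + 2) t) by ring.
by rewrite h1; ring.
Qed.

(* As [f ^ 2 + g ^ 2 = 4], these weights concentrate where [f = g = sqrt 2]. *)
Let w (n : nat) x : R := (f x * g x) ^+ n.*2.
Let W n : R := Rintegral mu D (w n).

Let wE n x : D x -> pw (f x) (n.*2%:R : C) * pw (g x) n.*2%:R = (w n x)%:C.
Proof. by move=> /arcs_gt0[f0 g0]; rewrite !pw_nat // -realCM -exprMn. Qed.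

Let Re_nat n : -1 < Rez (n%:R : C).
Proof. by rewrite -realC_nat /= (lt_le_trans _ (ler0n _ n)) // oppr_lt0. Qed.

Let iw n : rintegrable D (w n).
Proof.
have h := eq_cintegrable (@measurable_arcs R) (@wE n) (Z_integrable (Re_nat n.*2) (Re_nat n.*2)).
exact: h.1.
Qed.

Let WE n : Z (n.*2%:R : C) n.*2%:R = (W n)%:C.
Proof. by rewrite -cintegral_real; exact: eq_cintegral (@wE n). Qed.

Let W_rec n : (n.+1%:R) * W n.+1 = 2 * (n.*2.+1%:R) * W n.
Proof.
have := Z_succ2 (Re_nat n.*2) (Re_nat n.*2).
have -> : (n.*2%:R + 2 : C) = n.+1.*2%:R by rewrite -natrD addn2 doubleS.
rewrite !WE.
have -> : (n.*2%:R : C) = (n.*2%:R : R)%:C by rewrite realC_nat.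
have -> : ((n.*2%:R : R)%:C + (n.*2%:R : R)%:C + 2) * ((n.*2%:R : R)%:C + (n.*2%:R : R)%:C + 4)
   * (W n.+1)%:C = ((n.*2%:R + n.*2%:R + 2) * (n.*2%:R + n.*2%:R + 4) * W n.+1)%:C :> C.
  by rewrite !realCM !realCD !realC_nat.
have -> : 16 * ((n.*2%:R : R)%:C + 1) * ((n.*2%:R : R)%:C + 1) * (W n)%:C =
   (16 * (n.*2%:R + 1) * (n.*2%:R + 1) * W n)%:C :> C.
  by rewrite !realCM !realCD !realC_nat.
move/realC_inj; rewrite -[n.*2.+1%:R]natr1 -[n.+1%:R]natr1 -mul2n natrM.
have n0 : 0 <= n%:R :> R by [].
move: (n%:R : R) n0 => y y0 h.
(* At s = t = 2n both sides of [Z_succ2] share the factor 8 (2n + 1). *)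
have k : 8 * (2 * y + 1) != 0 by rewrite gt_eqF //; lra.
apply: (mulfI k); rewrite -[LHS]addr0.
transitivity ((2 * y + 2 * y + 2) * (2 * y + 2 * y + 4) * W n.+1); first by ring.
by rewrite h; ring.
Qed.

Let W_gt0 n : 0 < W n.
Proof.
elim: n => [|n IH].
  have := WE 0; rewrite double0 Z00 -[1]/((1:R)%:C) => /realC_inj <-.
  exact: ltr01.
have : 0 < n.+1%:R * W n.+1 by rewrite W_rec mulr_gt0 // mulr_gt0.
by rewrite pmulr_rgt0.
Qed.

Lemma pw_double_sqr (u : R) s : 0 < u -> pw u s = pw (u ^+ 2) (s / 2).
Proof. by move=> u0; rewrite pw_exp // -(mulr_natr (s / 2)) mulfVK // pnatr_eq0. Qed.

Lemma Re_half s : Rez (s / 2) = Rez s / 2.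
Proof.
have -> : (2^-1 : C) = (2^-1 : R)%:C by rewrite realCV realC_nat.
by rewrite reimE /= mulr0 subr0.
Qed.

(** Put f^2 = 2 (1 + y) and g^2 = 2 (1 - y), which explains the halved exponents. Replacing f^s g^t
    by 2^((s + t) / 2) costs a relative error O(|y|), while y^2 = 1 - (f g)^2 / 4 has weighted mean
    1 / (2n + 2) by [W_rec]. *)
Lemma Z_concentrates_ge0 s t : 0 <= Rez s -> 0 <= Rez t ->
  (fun n => Z (s + n.*2%:R) (t + n.*2%:R) / (W n)%:C) @ \oo --> (pw 2 ((s + t) / 2) : C).
Proof.
move=> s0 t0.
have s20 : 0 <= Rez (s / 2) by rewrite Re_half divr_ge0.
have t20 : 0 <= Rez (t / 2) by rewrite Re_half divr_ge0.
pose m1 := Num.bound (Rez (s / 2)); have sm : Rez (s / 2) <= m1%:R by rewrite ltW// archi_boundP.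
pose m2 := Num.bound (Rez (t / 2)); have tm : Rez (t / 2) <= m2%:R by rewrite ltW// archi_boundP.
pose K1 := (2 * cabs (s / 2) * expR (cabs (s / 2)) + 4) * (1 + 2 ^+ m1).
pose K2 := (2 * cabs (t / 2) * expR (cabs (t / 2)) + 4) * (1 + 2 ^+ m2).
have K10 : 0 <= K1.
  by rewrite mulr_ge0 ?addr_ge0 ?mulr_ge0 ?cabs_ge0 ?expR_ge0 ?exprn_ge0.
have K20 : 0 <= K2.
  by rewrite mulr_ge0 ?addr_ge0 ?mulr_ge0 ?cabs_ge0 ?expR_ge0 ?exprn_ge0.
(* From A B - 1 = (A - 1) B + (B - 1), where A and B are the powers of 1 + y and 1 - y, and |B| <= 1
   + K2. *)
pose K := K1 * (1 + K2) + K2.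
have K0 : 0 <= K by rewrite addr_ge0 // mulr_ge0 // addr_ge0.
pose h (n : nat) x : C := (pw 2 ((s + t) / 2))^-1 * (pw (f x) s * pw (g x) t) - 1.
pose phi (n : nat) x : R := K ^+ 2 * (1 - (f x * g x) ^+ 2 / 4).
have mD := @measurable_arcs R.
have bnd (u : R) z m : 0 <= Rez z -> Rez z <= m%:R -> 0 < u -> u <= 2 ->
    cabs (pw u z - 1) <= (2 * cabs z * expR (cabs z) + 4) * (1 + 2 ^+ m) * `|u - 1|.
  move=> z0 zm u0 u2; apply: le_trans (pw_sub1_le_poly z0 zm u0) _.
  rewrite -[leRHS]mulrA ler_wpM2l ?addr_ge0 ?mulr_ge0 ?cabs_ge0 ?expR_ge0//.
  by rewrite mulrC ler_wpM2r // lerD2l lerXn2r // nnegrE ltW.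
have phiE n x : phi n x * w n x = K ^+ 2 * w n x - K ^+ 2 / 4 * w n.+1 x.
  have e : (f x * g x) ^+ n.+1.*2 = (f x * g x) ^+ n.*2 * (f x * g x) ^+ 2.
    by rewrite doubleS [LHS]exprSr [X in X * _]exprSr -mulrA -expr2.
  by rewrite /phi /w e; move: (_ ^+ n.*2) => y; field.
have iphi n : rintegrable D (fun x => phi n x * w n x).
  apply: (@eq_rintegrable R D (fun x => K ^+ 2 * w n x - K ^+ 2 / 4 * w n.+1 x)) => //.
  by apply: rintegrableB => //; apply: rintegrableZ => //; exact: iw.
have Rs n : -1 < Rez (s + n.*2%:R) by rewrite ReD_nat (lt_le_trans _ (addr_ge0 s0 (ler0n _ _))) // oppr_lt0.
have Rt n : -1 < Rez (t + n.*2%:R) by rewrite ReD_nat (lt_le_trans _ (addr_ge0 t0 (ler0n _ _))) // oppr_lt0.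
have hE n x : D x -> h n x * (w n x)%:C =
   (pw 2 ((s + t) / 2))^-1 * (pw (f x) (s + n.*2%:R) * pw (g x) (t + n.*2%:R)) - (w n x)%:C.
  move=> Dx; rewrite /h mulrBl mul1r; congr (_ - _).
  by rewrite !pwD -(wE _ Dx); ring.
have iZ n := Z_integrable (Rs n) (Rt n).
have iwc n := cintegrable_real mD (iw n).
have lim := @concentration R D w phi h mD.
have {}lim : (fun n => cintegral D (fun x => h n x * (w n x)%:C) / (W n)%:C) @ \oo --> (0 : C).
  apply: lim => //.
  - move=> n x /arcs_gt0[f0 g0]; by rewrite exprn_ge0 // mulr_ge0 // ltW.
  - move=> n; apply: (eq_cintegrable mD (fun x Dx => esym (hE n x Dx))).
    by apply: cintegrableB => //; exact: cintegrableZ.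
  - move=> n x /arcs_gt0[f0 g0].
    have sq := sinabs2_cosabs2 x.
    pose y := f x ^+ 2 / 2 - 1.
    have u1 : f x ^+ 2 = 2 * (1 + y) by rewrite /y; field.
    have u2 : g x ^+ 2 = 2 * (1 - y).
      by rewrite /y; move: sq; move: (g x ^+ 2) (f x ^+ 2) => p q e; lra.
    have f2 : 0 < f x ^+ 2 by rewrite exprn_gt0.
    have g2 : 0 < g x ^+ 2 by rewrite exprn_gt0.
    have y1 : 0 < 1 + y by lra.
    have y2 : 0 < 1 - y by lra.
    have -> : phi n x = (K * `|y|) ^+ 2.
      rewrite /phi !exprMn [`|y| ^+ 2]real_normK ?num_real //.
      by rewrite u1 u2; field.
    rewrite lerXn2r ?nnegrE ?cabs_ge0 ?(mulr_ge0 K0) //.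
    have -> : h n x = (pw (1 + y) (s / 2) - 1) * pw (1 - y) (t / 2) + (pw (1 - y) (t / 2) - 1).
      rewrite /h (pw_double_sqr _ f0) (pw_double_sqr _ g0) u1 u2 !pwM //.
      rewrite mulrDl pwD.
      have := pw_neq0 2 (s / 2); have := pw_neq0 2 (t / 2).
      move: (pw 2 (s / 2)) (pw 2 (t / 2)) (pw (1 + y) _) (pw (1 - y) _) => p q A B q0 p0.
      by field; rewrite p0 q0.
    have yn : `|y| <= 1 by rewrite ler_norml; lra.
    have b1 : cabs (pw (1 + y) (s / 2) - 1) <= K1 * `|y|.
      have -> : `|y| = `|1 + y - 1| by congr `|_|; ring.
      by apply: bnd => //; lra.
    have b2 : cabs (pw (1 - y) (t / 2) - 1) <= K2 * `|y|.
      have -> : `|y| = `|1 - y - 1| by rewrite addrAC subrr sub0r normrN.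
      by apply: bnd => //; lra.
    have b3 : cabs (pw (1 - y) (t / 2)) <= 1 + K2.
      rewrite -[X in cabs X](subrK 1) addrC (le_trans (cabsD _ _))// cabs1 lerD2l.
      by rewrite (le_trans b2) // ler_piMr.
    apply: le_trans (cabsD _ _) _; rewrite cabsM /K mulrDl lerD//.
    by rewrite mulrAC ler_pM ?cabs_ge0.
  - have lim0 : (fun n => K ^+ 2 / 2 * n.+1%:R^-1 : R) @ \oo --> (0 : R).
      apply: (cvgn_eq _ _ (cvgnM (cvgn_cst (K ^+ 2 / 2)) (@cvg_harmonic R))) => //.
      by rewrite mulr0.
    apply: (cvgn_eq _ _ lim0) => // n.
    rewrite (eq_Rint (fun x _ => phiE n x)) RintegralB //; last 2 first.
    + by apply: rintegrableZ => //; exact: iw.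
    + by apply: rintegrableZ => //; exact: iw.
    rewrite !RintegralZl //; try exact: iw.
    rewrite -/(W n) -/(W n.+1).
    have W0 : W n != 0 by rewrite gt_eqF.
    have n1 : n.+1%:R != 0 :> R by [].
    have -> : W n.+1 = 2 * n.*2.+1%:R * W n / n.+1%:R by rewrite -W_rec mulrAC divff // mul1r.
    rewrite -[n.*2.+1%:R]natr1 -mul2n natrM.
    have -> : n%:R = n.+1%:R - 1 :> R by rewrite -natr1 addrK.
    by move: (n.+1%:R : R) n1 => y y0; field; rewrite y0 W0.
apply: (cvgn_eq _ _ (cvgnM (cvgn_cst (pw 2 ((s + t) / 2))) (cvgnD lim (cvgn_cst (1 : C))))) => [n|].
  rewrite (eq_cintegral (hE n)) cintegralB//; last exact: cintegrableZ.
  rewrite cintegralZ // -/(Z _ _) cintegral_real -/(W n).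
  have W0 : (W n)%:C != 0 :> C by rewrite -cabs_gt0 cabs_real normr_gt0 gt_eqF.
  have p0 := pw_neq0 2 ((s + t) / 2).
  by move: (pw 2 _) p0 ((W n)%:C : C) W0 => p p0 q q0; field; rewrite p0 q0.
by rewrite add0r mulr1.
Qed.

Lemma cvgn_double (T : topologicalType) (u : nat -> T) (l : T) : u @ \oo --> l ->
  (fun n => u n.*2) @ \oo --> l.
Proof.
move=> ul A /ul [N _ NA]; exists N => // n /= Nn; apply: NA => /=.
by rewrite (leq_trans Nn) // -addnn leq_addr.
Qed.

Let cvg_W_ratio : (fun n => (W n / W n.+1)%:C : C) @ \oo --> ((4^-1 : R)%:C : C).
Proof.
apply: cvg_realC.
have h : (fun n => 4 + (-2) * n.+1%:R^-1 : R) @ \oo --> (4 + (-2) * 0 : R).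
  by apply: cvgnD; [exact: cvgn_cst|apply: cvgnM; [exact: cvgn_cst|exact: cvg_harmonic]].
rewrite mulr0 addr0 in h; have k : (4 : R) != 0 by [].
apply: (cvgn_eq _ _ (cvgnV k h)) => // n.
have W0 : W n != 0 by rewrite gt_eqF.
have n1 : n.+1%:R != 0 :> R by [].
have -> : W n.+1 = 2 * n.*2.+1%:R * W n / n.+1%:R by rewrite -W_rec mulrAC divff // mul1r.
have d1 : n.*2.+1%:R != 0 :> R by [].
have e : n.*2.+1%:R = 2 * n.+1%:R - 1 :> R.
  by rewrite -natrM mul2n doubleS -[in RHS]natr1 addrK.
have e2 : 4 + -2 * n.+1%:R^-1 = 2 * n.*2.+1%:R / n.+1%:R :> R.
  by rewrite e; move: (n.+1%:R : R) n1 => y y0; field.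
rewrite e2; move: (n.*2.+1%:R : R) (n.+1%:R : R) d1 n1 (W n) W0 => a b a0 b0 c c0.
by field; rewrite a0 b0 c0.
Qed.

Lemma half_add s t : (s + t) / 2 = s / 2 + t / 2.
Proof. exact: mulrDl. Qed.

(** Shifting s and t by 2 makes the real parts nonnegative. The limit then gains a factor 4, which
    is undone by the limit 1/4 of W n / W (n + 1). *)
Lemma Z_concentrates s t : -1 < Rez s -> -1 < Rez t ->
  (fun n => Z (s + n.*2%:R) (t + n.*2%:R) / (W n)%:C) @ \oo --> (pw 2 ((s + t) / 2) : C).
Proof.
move=> s1 t1; rewrite -cvg_shiftS.
have s0 : 0 <= Rez (s + 2) by rewrite (ReD_nat s 2); lra.
have t0 : 0 <= Rez (t + 2) by rewrite (ReD_nat t 2); lra.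
apply: (cvgn_eq _ _ (cvgnM (Z_concentrates_ge0 s0 t0) cvg_W_ratio)) => [n|].
  have W0 m : (W m)%:C != 0 :> C by rewrite -cabs_gt0 cabs_real normr_gt0 gt_eqF.
  have e z : z + n.+1.*2%:R = z + 2 + n.*2%:R by rewrite doubleS -addn2 natrD; ring.
  rewrite /= !e realCM realCV; move: (W0 n) (W0 n.+1).
  move: ((W n)%:C : C) ((W n.+1)%:C : C) => a b a0 b0.
  by field; rewrite a0 b0.
have -> : (s + 2 + (t + 2)) / 2 = (s + t) / 2 + 2 by field.
rewrite pwD (@pw_nat R 2 2) // realCV realCX !realC_nat.
by field.
Qed.

Let P z N : C := \prod_(1 <= k < N.+1) (1 + z / k%:R).

Let PS z N : P z N.+1 = P z N * (1 + z / N.+1%:R).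
Proof. by rewrite /P big_nat_recr. Qed.

(** One use of [Z_succ2], divided by [W_rec], involves the factor of index 2n + 1 for s and for t,
    but those of indices 2n + 1 and 2n + 2 for (s + t) / 2. The products for s / 2 and t / 2 supply
    the missing even factors, as 1 + s / (2k) = 1 + (s / 2) / k, so that every product runs over a
    full range. *)
Lemma Z_ratio_prod s t n : -1 < Rez s -> -1 < Rez t ->
  Z (s + n.*2%:R) (t + n.*2%:R) / (W n)%:C * (P (s / 2) n * P (t / 2) n * P ((s + t) / 2) n.*2) =
  Z s t * (P s n.*2 * P t n.*2).
Proof.
move=> s1 t1; elim: n => [|n IH].
  have W0 : (W 0)%:C = 1 :> C by rewrite -WE Z00.
  by rewrite !addr0 W0 divr1 /P !big_geq // !mulr1.
have e z : z + n.+1.*2%:R = z + n.*2%:R + 2 by rewrite doubleS -addn2 natrD addrA.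
have Rs : -1 < Rez (s + n.*2%:R) by rewrite ReD_nat (lt_le_trans s1) // lerDl.
have Rt : -1 < Rez (t + n.*2%:R) by rewrite ReD_nat (lt_le_trans t1) // lerDl.
rewrite doubleS !PS -doubleS !e.
have W0 m : (W m)%:C != 0 :> C by rewrite -cabs_gt0 cabs_real normr_gt0 gt_eqF.
have k1 : n.+1%:R != 0 :> C by rewrite pnatr_eq0.
have k2 : n.*2.+1%:R != 0 :> C by rewrite pnatr_eq0.
have e2 : n.*2.+2%:R = 2 * n.+1%:R :> C by rewrite -natrM mul2n doubleS.
have e3 : n.*2.+1%:R = 2 * n.+1%:R - 1 :> C by rewrite -e2 -[in RHS]natr1 addrK.
have e4 : n.*2%:R = 2 * n.+1%:R - 2 :> C by rewrite -e2 -[in RHS]addn2 natrD addrK.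
have key : Z (s + n.*2%:R + 2) (t + n.*2%:R + 2) / (W n.+1)%:C *
    ((1 + (s + t) / 2 / n.*2.+1%:R) * (1 + (s + t) / 2 / n.*2.+2%:R)) =
    Z (s + n.*2%:R) (t + n.*2%:R) / (W n)%:C * ((1 + s / n.*2.+1%:R) * (1 + t / n.*2.+1%:R)).
  have h := Z_succ2 Rs Rt.
  have hW : (W n.+1)%:C = 2 * n.*2.+1%:R * (W n)%:C / n.+1%:R :> C.
    apply: (mulIf k1); rewrite mulfVK // mulrC -!realC_nat -!realCM; congr (_%:C).
    exact: W_rec.
  move: h; rewrite hW e2 e4; move: k2; rewrite e3.
  move: (n.+1%:R : C) k1 ((W n)%:C : C) (W0 n) (Z (s + _) (t + _)) (Z (s + _ + 2) _).
  move=> y y0 v v0 Zn Zn' y1 h.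
  have k : 4 * (2 * y - 1) * (2 * y) != 0 by rewrite !mulf_neq0 // pnatr_eq0.
  apply: (mulfI k).
  transitivity ((s + (2 * y - 2) + (t + (2 * y - 2)) + 2) *
    (s + (2 * y - 2) + (t + (2 * y - 2)) + 4) * Zn' * (y / (2 * (2 * y - 1) * v))).
    by field; rewrite y0 v0 y1.
  by rewrite h; field; rewrite ?y0 ?v0 ?y1.
set A := 1 + (s + t) / 2 / _ in key *; set B := 1 + (s + t) / 2 / _ in key *.
set Z' := Z _ _ in key *.
transitivity (Z' / (W n.+1)%:C * (A * B) * (P (s / 2) n * P (t / 2) n * P ((s + t) / 2) n.*2)
   * ((1 + s / 2 / n.+1%:R) * (1 + t / 2 / n.+1%:R))); first by ring.
have c z : 1 + z / n.*2.+2%:R = 1 + z / 2 / n.+1%:R.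
  by rewrite e2 invfM mulrA.
rewrite key [X in X * _]mulrAC IH doubleS !c.
by ring.
Qed.

Let pw_half_mul (u : R) s : pw u (s / 2) * pw u (s / 2) = pw u s.
Proof. by rewrite -pwD; congr pw; field. Qed.

Lemma Z_Gamma s t : -1 < Rez s -> -1 < Rez t ->
  Z s t = Gamma (s + 1) * Gamma (t + 1) /
     (Gamma (s / 2 + 1) * Gamma (t / 2 + 1) * Gamma ((s + t) / 2 + 1)).
Proof.
move=> s1 t1.
have s2 : -1 < Rez (s / 2) by rewrite Re_half; lra.
have t2 : -1 < Rez (t / 2) by rewrite Re_half; lra.
have st2 : -1 < Rez ((s + t) / 2) by rewrite Re_half reimE; lra.
have L1 := cvgnM (cvgnM (cvgnM (Z_concentrates s1 t1) (Gamma_Gauss s2)) (Gamma_Gauss t2))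
  (cvgn_double (Gamma_Gauss st2)).
(* The Gauss normalisations on the two sides are n^(s + t) 2^((s + t) / 2) and (2n)^(s + t); the
   constant factor 2^((s + t) / 2) makes up for the difference. *)
have L2 := cvgnM (cvgnM (cvgnM (cvgn_cst (Z s t)) (cvgn_double (Gamma_Gauss s1)))
  (cvgn_double (Gamma_Gauss t1))) (cvgn_cst (pw 2 ((s + t) / 2))).
have E : pw 2 ((s + t) / 2) / Gamma (s / 2 + 1) / Gamma (t / 2 + 1) / Gamma ((s + t) / 2 + 1) =
    Z s t / Gamma (s + 1) / Gamma (t + 1) * pw 2 ((s + t) / 2).
  rewrite -cvg_shiftS in L1; rewrite -cvg_shiftS in L2.
  apply: (cvgC_unique L1); apply: (cvgn_eq _ _ L2) => // n.
  rewrite /= -/(P s _) -/(P t _) -/(P (s / 2) _) -/(P (t / 2) _) -/(P ((s + t) / 2) _).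
  have H := Z_ratio_prod n.+1 s1 t1.
  have n0 : 0 < n.+1%:R :> R by [].
  have d : n.+1.*2%:R = 2 * n.+1%:R :> R by rewrite -natrM mul2n.
  rewrite !d !(pwM _ _ n0) // !half_add !pwD in H *.
  rewrite -(pw_half_mul 2 s) -(pw_half_mul 2 t) -(pw_half_mul n.+1%:R s) -(pw_half_mul n.+1%:R t).
  have := pw_neq0 2 (s / 2); have := pw_neq0 2 (t / 2).
  have := pw_neq0 n.+1%:R (s / 2); have := pw_neq0 n.+1%:R (t / 2).
  move: H; move: (pw 2 (s / 2)) (pw 2 (t / 2)) (pw n.+1%:R (s / 2)) (pw n.+1%:R (t / 2)).
  move: (Z (s + _) _ / _) (P _ n.+1) (P (t / 2) n.+1) (P _ n.+1.*2) (P s n.+1.*2) (P t n.+1.*2) (Z s t).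
  move=> r p1 p2 p3 q1 q2 z a b c e H e0 c0 b0 a0.
  transitivity (z * (q1 * q2) / (a * b * c ^+ 2 * e ^+ 2)).
    by field; rewrite a0 b0 c0 e0.
  by rewrite -H; field; rewrite a0 b0 c0 e0.
have := Gamma_neq0 s1; have := Gamma_neq0 t1; have := Gamma_neq0 s2; have := Gamma_neq0 t2.
have := Gamma_neq0 st2; have := pw_neq0 2 ((s + t) / 2); move: E.
move: (pw 2 _) (Z s t) (Gamma (s + 1)) (Gamma (t + 1)) (Gamma (s / 2 + 1)) (Gamma (t / 2 + 1))
  (Gamma ((s + t) / 2 + 1)) => p z a b c d e E p0 e0 d0 c0 b0 a0.
apply: (mulIf p0); transitivity (a * b * (z / a / b * p)); first by field; rewrite a0 b0.
by rewrite -E; field; rewrite c0 d0 e0.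
Qed.

(** The partial product is a quotient of Gauss products for the five Gamma values, in which the
    powers of n cancel. *)
Lemma cvg_Z_product s t : -1 < Rez s -> -1 < Rez t ->
  (fun N : nat => \prod_(1 <= n < N.+1)
    ((1 + s / (2 * n%:R)) * (1 + t / (2 * n%:R)) * (1 + (s + t) / (2 * n%:R)) /
       ((1 + s / n%:R) * (1 + t / n%:R)))) @ \oo --> Z s t.
Proof.
move=> s1 t1.
have s2 : -1 < Rez (s / 2) by rewrite Re_half; lra.
have t2 : -1 < Rez (t / 2) by rewrite Re_half; lra.
have st2 : -1 < Rez ((s + t) / 2) by rewrite Re_half reimE; lra.
have V z : -1 < Rez z -> (fun n => (P z n / pw (n%:R : R) z)^-1) @ \oo --> Gamma (z + 1).
  move=> z1; have h := Gamma_Gauss z1.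
  have g0 : (Gamma (z + 1))^-1 != 0 by rewrite invr_eq0 Gamma_neq0.
  by apply: (cvgn_eq _ _ (cvgnV g0 h)) => //; rewrite invrK.
have L := cvgnM (cvgnM (cvgnM (cvgnM (Gamma_Gauss s2) (Gamma_Gauss t2)) (Gamma_Gauss st2)) (V _ s1)) (V _ t1).
rewrite -cvg_shiftS in L; rewrite -cvg_shiftS; apply: (cvgn_eq _ _ L) => [n|]; last first.
  by rewrite Z_Gamma // !invfM; ring.
rewrite /= -/(P (s / 2) _) -/(P (t / 2) _) -/(P ((s + t) / 2) _).
have -> : \prod_(1 <= k < n.+2) ((1 + s / (2 * k%:R)) * (1 + t / (2 * k%:R)) *
     (1 + (s + t) / (2 * k%:R)) / ((1 + s / k%:R) * (1 + t / k%:R))) =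
   P (s / 2) n.+1 * P (t / 2) n.+1 * P ((s + t) / 2) n.+1 / (P s n.+1 * P t n.+1).
  rewrite /P -!big_split /= -prodfV -big_split /=; apply: eq_bigr => k _.
  by rewrite !invfM !mulrA.
rewrite half_add pwD -(pw_half_mul n.+1%:R s) -(pw_half_mul n.+1%:R t) !invfM !invrK.
have := pw_neq0 n.+1%:R (s / 2); have := pw_neq0 n.+1%:R (t / 2).
move: (pw n.+1%:R (s / 2)) (pw n.+1%:R (t / 2)) (P s n.+1)^-1 (P t n.+1)^-1 (P _ _) (P _ _) (P _ _).
by move=> a b c d e f1 g1 b0 a0; field; rewrite a0 b0.
Qed.

End ZetaMahlerProduct.

(** * The logarithm of Z(s, t) *)

Section LogarithmSeries.
Variable R : realType.
Local Notation C := (Cx R).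
Implicit Types (s t w z : C).

(** The expansion of the product minus 1 is majorised by the one with moduli, and 1 + |x| <= exp
    |x|. *)
Lemma cabs_prod_sub1 (I : Type) (r : seq I) (x : I -> C) :
  cabs (\prod_(i <- r) (1 + x i) - 1) <= expR (\sum_(i <- r) cabs (x i)) - 1.
Proof.
elim: r => [|i r IH]; first by rewrite !big_nil expR0 !subrr cabs0.
rewrite !big_cons expRD; set P := \prod_(_ <- _) _ in IH *; set S := \sum_(_ <- _) _ in IH *.
have -> : (1 + x i) * P - 1 = (P - 1) * (1 + x i) + x i by ring.
apply: le_trans (cabsD _ _) _; rewrite cabsM.
have h1 : cabs (1 + x i) <= 1 + cabs (x i) by rewrite (le_trans (cabsD _ _)) // cabs1.
have h2 : 1 + cabs (x i) <= expR (cabs (x i)) := expR_ge1Dx _.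
have x0 := cabs_ge0 (x i); have p0 := cabs_ge0 (P - 1).
apply: (@le_trans _ _ ((expR S - 1) * expR (cabs (x i)) + (expR (cabs (x i)) - 1))); last first.
  by rewrite le_eqVlt; apply/orP; left; apply/eqP; ring.
apply: lerD; last by rewrite lerBrDl.
by apply: ler_pM => //; [exact: cabs_ge0|exact: le_trans h1 h2].
Qed.

Lemma expR1_le4 : expR 1 <= 4 :> R.
Proof.
have h : 2^-1 <= expR (- 2^-1) :> R by have := expR_ge1Dx (- 2^-1 : R); lra.
have h2 : expR (2^-1) <= 2 :> R.
  by rewrite -[leRHS]invrK -[leLHS]invrK -expRN lef_pV2 ?posrE ?expR_gt0.
have -> : expR 1 = expR (2^-1) * expR (2^-1) :> R by rewrite -expRD; congr expR; field.
by have := ler_pM (expR_ge0 _) (expR_ge0 _) h2 h2; rewrite -natrM.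
Qed.

Lemma logT_factor_bound K w : cabs w <= 4^-1 ->
  cabs (cexp (- logT K.+1 w) * (1 + w) - 1) <= 8 * cabs w ^+ K.+2.
Proof.
move=> w4; have w2 : cabs w <= 2^-1 by lra.
apply: le_trans (cexp_logT_bound K.+1 w2) _.
rewrite ler_wpM2r ?exprn_ge0 ?cabs_ge0//; have := expR1_le4; lra.
Qed.

(** This is the inverse of 1 + e with |e| <= 4 |w|^(K + 2) <= 1/4; since |1 + e| >= 1/2, inversion
    at most doubles the constant. *)
Lemma logT_factor_inv_bound K w : cabs w <= 4^-1 ->
  cabs (cexp (logT K.+1 w) / (1 + w) - 1) <= 8 * cabs w ^+ K.+2.
Proof.
move=> w4; have w2 : cabs w <= 2^-1 by lra.
have := cexp_logT_bound K.+1 w2; set e := cexp _ * _ - 1 => he.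
have ee : expR 1 * cabs w ^+ K.+2 <= 4 * cabs w ^+ K.+2.
  by rewrite ler_wpM2r ?exprn_ge0 ?cabs_ge0// expR1_le4.
have wK : cabs w ^+ K.+2 <= 16^-1.
  apply: (@le_trans _ _ (4^-1 ^+ K.+2)); first by rewrite lerXn2r // nnegrE ?cabs_ge0.
  rewrite exprS exprS mulrA; have -> : 4^-1 * 4^-1 = 16^-1 :> R by field.
  rewrite ler_piMr // exprn_ile1 //; lra.
have h4 : cabs e <= 4 * cabs w ^+ K.+2 by exact: le_trans he ee.
have e14 : cabs e <= 4^-1 by lra.
have e1 : 2^-1 <= cabs (1 + e).
  have := cabsD (1 + e) (- e); rewrite addrK cabs1 cabsN; lra.
have e0 : 1 + e != 0 by rewrite -cabs_gt0; lra.
have E1 : cexp (- logT K.+1 w) * (1 + w) = 1 + e by rewrite /e; ring.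
have -> : cexp (logT K.+1 w) / (1 + w) = (1 + e)^-1.
  by rewrite -E1 invfM -cexpN opprK mulrC.
have -> : (1 + e)^-1 - 1 = - (e / (1 + e)) by field.
rewrite cabsN cabsM cabsV ler_pdivrMr; last by lra.
apply: le_trans h4 _.
have W0 : 0 <= cabs w ^+ K.+2 by rewrite exprn_ge0 ?cabs_ge0.
have := ler_wpM2l W0 e1; lra.
Qed.

Lemma sum_invsq_le N : \sum_(1 <= n < N.+1) (n%:R ^+ 2)^-1 <= 2 :> R.
Proof.
case: N => [|N]; first by rewrite big_geq.
suff : \sum_(1 <= n < N.+2) (n%:R ^+ 2)^-1 <= 2 - N.+1%:R^-1 :> R.
  by move/le_trans; apply; rewrite gerBl invr_ge0.
elim: N => [|N IH]; first by rewrite big_nat1 expr1n invr1; lra.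
rewrite big_nat_recr //= (le_trans (lerD IH (lexx _)))//.
have e : N.+2%:R = N.+1%:R + 1 :> R by rewrite natr1.
have : 1 <= N.+1%:R :> R by rewrite ler1n.
rewrite e; move: (N.+1%:R : R) => y y1.
have y0 : y != 0 by rewrite gt_eqF //; lra.
have y10 : y + 1 != 0 by rewrite gt_eqF //; lra.
rewrite -subr_ge0.
have -> : 2 - (y + 1)^-1 - (2 - y^-1 + ((y + 1) ^+ 2)^-1) = (y * (y + 1) ^+ 2)^-1.
  by field; rewrite y0 y10.
by rewrite invr_ge0 mulr_ge0 ?sqr_ge0 //; lra.
Qed.

Definition zetaN (j N : nat) : R := \sum_(1 <= n < N.+1) (n%:R ^+ j)^-1.

Lemma zetaN_series j : zetaN j = series (fun n : nat => ((n.+1)%:R ^+ j)^-1 : R).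
Proof. by apply/funext => N; rewrite /zetaN /series /= big_add1. Qed.

Lemma zetaN_le2 j N : (2 <= j)%N -> zetaN j N <= 2.
Proof.
move=> j2; apply: le_trans (sum_invsq_le N); rewrite /zetaN !big_add1 /=.
apply: ler_sum_nat => n _; rewrite lef_pV2 ?posrE ?exprn_gt0 ?ltr0n //.
by rewrite ler_weXn2l // ler1n.
Qed.

Lemma cvg_zetaN j : (2 <= j)%N -> zetaN j @ \oo --> @zeta R j.
Proof.
move=> j2; rewrite zetaN_series; apply: nondecreasing_is_cvgn.
  apply: nondecreasing_series => n _; by rewrite invr_ge0 exprn_ge0.
by exists 2 => _ [N _ <-]; rewrite -zetaN_series; exact: zetaN_le2.
Qed.

Lemma zeta_le2 j : (2 <= j)%N -> @zeta R j <= 2.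
Proof.
by move=> j2; apply: (cvgr_to_le (cvg_zetaN j2)); apply: nearW => N; exact: zetaN_le2.
Qed.

Lemma zeta_ge0 j : (2 <= j)%N -> 0 <= @zeta R j.
Proof.
move=> j2; apply: (cvgr_to_ge (cvg_zetaN j2)); apply: nearW => N.
by apply: sumr_ge0 => n _; rewrite invr_ge0 exprn_ge0.
Qed.

(** [logZ_term] stripped of its zeta value, so that single terms or partial sums of the zeta series
    can take its place. *)
Definition logZ_coef s t (k : nat) : C := ((-1) ^+ k / k%:R) *
  ((1 - (2 ^+ k)^-1) * (s ^+ k + t ^+ k) - (2 ^+ k)^-1 * (s + t) ^+ k).

Lemma logZ_termE s t k : logZ_term s t k = logZ_coef s t k * (zeta R k)%:C.
Proof. by rewrite /logZ_term /logZ_coef mulrAC. Qed.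

(* The terms of degree 1 of the five truncated logarithms cancel, see [sigmaE]. *)
Let sigma K s t (n : nat) : C :=
  logT K (s / (2 * n%:R)) + logT K (t / (2 * n%:R)) + logT K ((s + t) / (2 * n%:R))
  - logT K (s / n%:R) - logT K (t / n%:R).

Lemma sigmaE K s t n : (0 < n)%N ->
  sigma K.+1 s t n = \sum_(i < K) logZ_coef s t i.+2 * ((n%:R ^+ i.+2)^-1 : R)%:C.
Proof.
move=> n0; have nC0 : n%:R != 0 :> C by rewrite pnatr_eq0 -lt0n.
have logTS w : logT K.+1 w = w + \sum_(i < K) ((-1) ^+ i.+1 / i.+2%:R) * w ^+ i.+2.
  rewrite /logT big_ord_recl /= expr0 mul1r expr1 divr1; congr (_ + _).
  by apply: eq_bigr => i _; rewrite mulrAC.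
rewrite /sigma !logTS.
have aux (a b c d e f g h i j : C) :
  a + f + (b + g) + (c + h) - (d + i) - (e + j) = a + b + c - d - e + (f + g + h - i - j) by ring.
rewrite aux.
have -> : s / (2 * n%:R) + t / (2 * n%:R) + (s + t) / (2 * n%:R) - s / n%:R - t / n%:R = 0.
  by field.
rewrite add0r -!big_split /= -!sumrB; apply: eq_bigr => i _.
rewrite realCV realCX realC_nat /logZ_coef !expr_div_n !exprMn !invfM.
have -> : (-1) ^+ i.+2 = - (-1) ^+ i.+1 :> C by rewrite exprS mulN1r.
have aux2 (u v p q a b d : C) : u * v * (a * (p * q)) + u * v * (b * (p * q))
    + u * v * (d * (p * q)) - u * v * (a * q) - u * v * (b * q) =
    - u * v * ((1 - p) * (a + b) - p * d) * q by ring.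
exact: aux2.
Qed.

(** Five factors with error 8 r^(K + 2) / n^2 each, and the sum of 1 / n^2 is at most 2, give y = 80
    r^(K + 2). As r <= 1/4, y <= 5, and the final bound is y exp y. *)
Definition logZ_const : R := 80 * expR 5.

Lemma logZ_const_ge0 : 0 <= logZ_const.
Proof. by rewrite mulr_ge0 ?expR_ge0. Qed.

Let prodN s t N : C := \prod_(1 <= n < N.+1)
    ((1 + s / (2 * n%:R)) * (1 + t / (2 * n%:R)) * (1 + (s + t) / (2 * n%:R)) /
       ((1 + s / n%:R) * (1 + t / n%:R))).

(** The bound is uniform in N and so survives the passage to the infinite product. Convergence over
    n relies on K + 2 >= 2, that is, on a truncation that contains at least the linear terms. *)
Lemma prodN_bound s t (r : R) K N : r <= 4^-1 -> cabs s <= r -> cabs t <= r ->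
  cabs (prodN s t N * cexp (- \sum_(1 <= n < N.+1) sigma K.+1 s t n) - 1) <=
    logZ_const * r ^+ K.+2.
Proof.
move=> r4 sr tr; have r0 : 0 <= r := le_trans (cabs_ge0 s) sr.
(* The five factors of index [n], normalised so that each is [1 + O(r ^ (K+2) / n ^ 2)]. *)
pose x n : 'I_5 -> C := tnth [tuple
  cexp (- logT K.+1 (s / (2 * n%:R))) * (1 + s / (2 * n%:R)) - 1;
  cexp (- logT K.+1 (t / (2 * n%:R))) * (1 + t / (2 * n%:R)) - 1;
  cexp (- logT K.+1 ((s + t) / (2 * n%:R))) * (1 + (s + t) / (2 * n%:R)) - 1;
  cexp (logT K.+1 (s / n%:R)) / (1 + s / n%:R) - 1;
  cexp (logT K.+1 (t / n%:R)) / (1 + t / n%:R) - 1].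
have aux (a b c d e f g h i j : C) : a * b * c / (d * e) * (f * g * h * i * j) =
    f * a * (g * b * (h * c * (i / d * (j / e * 1)))).
  by rewrite invfM; move: (d^-1) (e^-1) => d' e'; ring.
have -> : prodN s t N * cexp (- \sum_(1 <= n < N.+1) sigma K.+1 s t n) =
    \prod_(q <- [seq (n, i) | n <- index_iota 1 N.+1, i <- enum 'I_5]) (1 + x q.1 q.2).
  rewrite big_allpairs /= -sumrN cexp_sum /prodN -big_split /=; apply: eq_bigr => n _.
  rewrite enumT -[X in _ = \prod_(_ <- X) _]/(index_enum _) !big_ord_recl big_ord0 /x /= ![1 + (_ - 1)]addrC !subrK.
  rewrite /sigma !opprD !opprK !cexpD.
  exact: aux.
apply: le_trans (cabs_prod_sub1 _ _) _; rewrite big_allpairs /=.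
have w4 (u : C) (m : nat) : cabs u <= r -> (0 < m)%N ->
    cabs (u / m%:R) <= 4^-1 /\ cabs (u / m%:R) ^+ K.+2 <= r ^+ K.+2 * (m%:R ^+ 2)^-1.
  move=> ur m0; have m1 : 1 <= m%:R :> R by rewrite ler1n.
  have mp : 0 < m%:R :> R by rewrite ltr0n.
  rewrite cabsM cabsV cabs_nat; split.
    rewrite ler_pdivrMr //; apply: le_trans ur (le_trans r4 _).
    by rewrite ler_peMr.
  rewrite exprMn ler_pM ?exprn_ge0 ?invr_ge0 ?cabs_ge0 //.
    by rewrite lerXn2r // nnegrE ?cabs_ge0.
  by rewrite exprVn lef_pV2 ?posrE ?exprn_gt0 // ler_weXn2l.
have h2 (u : C) : cabs u <= r -> cabs (u / 2) <= r.
  move=> ur; rewrite cabsM cabsV cabs_nat ler_pdivrMr //; lra.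
have st2 : cabs ((s + t) / 2) <= r.
  rewrite cabsM cabsV cabs_nat ler_pdivrMr // (le_trans (cabsD _ _))//; lra.
have bnd n : (0 < n)%N -> \sum_(i <- enum 'I_5) cabs (x n i) <= 40 * r ^+ K.+2 * (n%:R ^+ 2)^-1.
  move=> n0; rewrite enumT -[X in \sum_(_ <- X) _]/(index_enum _) !big_ord_recl big_ord0 /x !(tnth_nth 0) /= addr0.
  have e u : u / (2 * n%:R) = u / 2 / n%:R :> C by rewrite invfM mulrA.
  rewrite !e.
  have B u : cabs u <= r -> cabs (cexp (- logT K.+1 (u / n%:R)) * (1 + u / n%:R) - 1) <=
      8 * (r ^+ K.+2 * (n%:R ^+ 2)^-1).
    move=> ur; have [a1 a2] := w4 u n ur n0.
    by apply: le_trans (logT_factor_bound K a1) _; rewrite ler_wpM2l.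
  have B' u : cabs u <= r -> cabs (cexp (logT K.+1 (u / n%:R)) / (1 + u / n%:R) - 1) <=
      8 * (r ^+ K.+2 * (n%:R ^+ 2)^-1).
    move=> ur; have [a1 a2] := w4 u n ur n0.
    by apply: le_trans (logT_factor_inv_bound K a1) _; rewrite ler_wpM2l.
  have b1 := B _ (h2 _ sr); have b2 := B _ (h2 _ tr); have b3 := B _ st2.
  have b4 := B' _ sr; have b5 := B' _ tr.
  have e5 (y : R) : 40 * y = 8 * y + (8 * y + (8 * y + (8 * y + 8 * y))) by ring.
  by rewrite -[leRHS]mulrA e5 !lerD.
pose y := 80 * r ^+ K.+2.
have rK0 : 0 <= r ^+ K.+2 by rewrite exprn_ge0.
have tot : \sum_(1 <= n < N.+1) \sum_(i <- enum 'I_5) cabs (x n i) <= y.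
  apply: (@le_trans _ _ (\sum_(1 <= n < N.+1) 40 * r ^+ K.+2 * (n%:R ^+ 2)^-1)).
    by rewrite !big_add1; apply: ler_sum_nat => n _; exact: bnd.
  rewrite -mulr_sumr /y; have := sum_invsq_le N.
  have a0 : 0 <= 40 * r ^+ K.+2 by rewrite mulr_ge0.
  move/(ler_wpM2l a0); lra.
have y0 : 0 <= y by rewrite mulr_ge0.
have y5 : y <= 5.
  have : r ^+ K.+2 <= 16^-1.
    apply: (@le_trans _ _ (4^-1 ^+ K.+2)); first by rewrite lerXn2r // nnegrE.
    rewrite exprS exprS mulrA; have -> : 4^-1 * 4^-1 = 16^-1 :> R by field.
    rewrite ler_piMr // exprn_ile1 //; lra.
  rewrite /y; lra.
apply: (@le_trans _ _ (expR y - 1)); first by rewrite lerD2r ler_expR.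
(* This is 1 - y <= exp (- y), multiplied by exp y. *)
apply: (@le_trans _ _ (y * expR y)).
  have h := expR_ge1Dx (- y); have e0 := expR_gt0 y.
  have := ler_wpM2l (ltW e0) h; rewrite -expRD subrr expR0; lra.
have -> : logZ_const * r ^+ K.+2 = y * expR 5 by rewrite /logZ_const /y mulrAC.
by rewrite ler_wpM2l // ler_expR.
Qed.

(** The limit N -> oo is taken at a fixed truncation, where sums over n become zeta values. The m
    terms have degrees 2 to m + 1, hence the error r^(m + 2). *)
Lemma Z_logZ_bound s t (r : R) m : r <= 4^-1 -> cabs s <= r -> cabs t <= r ->
  cabs (Z s t * cexp (- series (fun n => logZ_term s t n.+2) m) - 1) <= logZ_const * r ^+ m.+2.
Proof.
move=> r4 sr tr.
have sm : -1 < Rez s by have := Re_le_cabs s; rewrite ler_norml => /andP[h _]; lra.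
have tm : -1 < Rez t by have := Re_le_cabs t; rewrite ler_norml => /andP[h _]; lra.
have L1 := cvg_Z_product sm tm.
have L2 : (fun N => - \sum_(1 <= n < N.+1) sigma m.+1 s t n) @ \oo -->
    (- series (fun n => logZ_term s t n.+2) m : C).
  apply: cvgN; rewrite /series /= big_mkord.
  have h : (fun N => \sum_(i < m) logZ_coef s t i.+2 * (zetaN i.+2 N)%:C) @ \oo -->
     (\sum_(i < m) logZ_coef s t i.+2 * (zeta R i.+2)%:C).
    apply: (@cvgn_sum C m (fun i N => logZ_coef s t i.+2 * (zetaN i.+2 N)%:C)
      (fun i => logZ_coef s t i.+2 * (zeta R i.+2)%:C)) => i.
    by apply: cvgnM; [exact: cvgn_cst|apply: cvg_realC; exact: cvg_zetaN].
  apply: (cvgn_eq _ _ h) => [N|]; last first.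
    by apply: eq_bigr => i _; rewrite logZ_termE.
  transitivity (\sum_(1 <= n < N.+1) \sum_(i < m) logZ_coef s t i.+2 * ((n%:R ^+ i.+2)^-1 : R)%:C).
    rewrite exchange_big /=; apply: eq_bigr => i _; rewrite -mulr_sumr; congr (_ * _).
    exact: (rmorph_sum (real_complex R)).
  by rewrite !big_add1; apply: eq_big_nat => n _; rewrite sigmaE.
have L := cvg_cabs (cvgnD (cvgnM L1 (cvg_cexp L2)) (cvgn_cst (-1 : C))).
apply: (cvgr_to_le L); apply: nearW => N; exact: prodN_bound.
Qed.

(** The bracket is at most 3 r^(m + 2), since |s + t| / 2 <= r, and a zeta value is at most 2. *)
Lemma norm_logZ_term_le s t (r : R) m : cabs s <= r -> cabs t <= r ->
  cabs (logZ_term s t m.+2) <= 6 * r ^+ m.+2.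
Proof.
move=> sr tr; have r0 : 0 <= r := le_trans (cabs_ge0 s) sr.
rewrite logZ_termE cabsM cabs_real ger0_norm; last exact: zeta_ge0.
have z2 := zeta_le2 (isT : (2 <= m.+2)%N).
have c3 : cabs (logZ_coef s t m.+2) <= 3 * r ^+ m.+2.
  rewrite /logZ_coef cabsM cabsM cabsX cabsN cabs1 expr1n mul1r cabsV cabs_nat.
  have inv1 : m.+2%:R^-1 <= 1 :> R by rewrite invf_le1 ?ltr0n // ler1n.
  apply: (@le_trans _ _ (1 * (3 * r ^+ m.+2))); last by rewrite mul1r.
  apply: ler_pM => //; first exact: cabs_ge0.
  apply: le_trans (cabsD _ _) _; rewrite cabsN (cabsM (1 - _)) (cabsM (2 ^- _)).
  have p1 : cabs (s ^+ m.+2) <= r ^+ m.+2 by rewrite cabsX lerXn2r // nnegrE ?cabs_ge0.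
  have p2 : cabs (t ^+ m.+2) <= r ^+ m.+2 by rewrite cabsX lerXn2r // nnegrE ?cabs_ge0.
  have p3 : cabs ((2 ^+ m.+2)^-1) * cabs ((s + t) ^+ m.+2) <= r ^+ m.+2.
    rewrite -cabsM -exprVn -exprMn cabsX lerXn2r // ?nnegrE ?cabs_ge0 //.
    rewrite cabsM cabsV cabs_nat mulrC ler_pdivrMr // (le_trans (cabsD _ _)) //; lra.
  have p4 : cabs (1 - (2 ^+ m.+2)^-1 : C) <= 1.
    have -> : 1 - (2 ^+ m.+2)^-1 = (1 - (2 ^+ m.+2)^-1 : R)%:C :> C.
      by rewrite realCD realCN realCV realCX realC_nat.
    have h : 0 <= (2 ^+ m.+2)^-1 :> R by rewrite invr_ge0 exprn_ge0.
    have h' : (2 ^+ m.+2)^-1 <= 1 :> R by rewrite invf_le1 ?exprn_gt0 // exprn_ege1 // ler1n.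
    by rewrite cabs_real ger0_norm; lra.
  have p5 := cabsD (s ^+ m.+2) (t ^+ m.+2).
  have p6 : cabs (1 - (2 ^+ m.+2)^-1) * cabs (s ^+ m.+2 + t ^+ m.+2) <= 1 * (2 * r ^+ m.+2).
    by apply: ler_pM => //; try exact: cabs_ge0; lra.
  lra.
have -> : 6 * r ^+ m.+2 = 3 * r ^+ m.+2 * 2 by ring.
by apply: ler_pM => //; [exact: cabs_ge0|exact: zeta_ge0].
Qed.

Lemma cvgC_series_le (u : nat -> C) (v : nat -> R) : (forall n, cabs (u n) <= v n) ->
  cvgn (series v) -> exists L : C, series u @ \oo --> L.
Proof.
move=> uv cv.
have H (p : C -> R) : (forall z, `|p z| <= cabs z) -> cvgn (series (fun n => p (u n))).
  move=> pz; apply: normed_cvg.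
  apply: (@series_le_cvg _ _ v) => //.
  - by move=> n /=; exact: normr_ge0.
  - by move=> n; exact: le_trans (cabs_ge0 _) (uv n).
  - by move=> n; exact: le_trans (pz _) (uv n).
have hr := H (@Rez R) (@Re_le_cabs R); have hi := H (@Imz R) (@Im_le_cabs R).
have sr n : Rez (series u n) = series (fun n => Rez (u n)) n.
  rewrite /series /=; elim: n => [|n IH]; first by rewrite !big_geq.
  by rewrite !big_nat_recr //= reimE IH.
have si n : Imz (series u n) = series (fun n => Imz (u n)) n.
  rewrite /series /=; elim: n => [|n IH]; first by rewrite !big_geq.
  by rewrite !big_nat_recr //= reimE IH.
exists (limn (series (fun n => Rez (u n))) +i* limn (series (fun n => Imz (u n)))).
apply: cvgC_ReIm => /=.
  by apply: (cvgn_eq _ _ hr) => // n; rewrite sr.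
by apply: (cvgn_eq _ _ hi) => // n; rewrite si.
Qed.

(** The series is dominated by a geometric one of ratio 1/4; letting m -> oo in [Z_logZ_bound] at r
    = 1/4 forces Z exp (- L) = 1. *)
Lemma Z_exp_zeta s t : cabs s < 4^-1 -> cabs t < 4^-1 ->
  exists2 L : C, series (fun n => logZ_term s t n.+2) @ \oo --> L & Z s t = cexp L.
Proof.
move=> /ltW s4 /ltW t4.
have g : (fun n => 4^-1 ^+ n : R) @ \oo --> (0 : R) by apply: cvg_expr; rewrite ger0_norm; lra.
have [L hL] : exists L : C, series (fun n => logZ_term s t n.+2) @ \oo --> L.
  apply: (@cvgC_series_le _ (geometric (6 * 4^-1 ^+ 2) (4^-1))).
    move=> n; apply: le_trans (norm_logZ_term_le n s4 t4) _.
    rewrite /geometric /=; have -> : 4^-1 ^+ n.+2 = 4^-1 ^+ 2 * 4^-1 ^+ n :> R by rewrite -exprD.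
    by rewrite mulrA.
  by apply: is_cvg_geometric_series; rewrite ger0_norm; lra.
exists L => //.
have E : Z s t * cexp (- L) + -1 = 0.
  have L1 := cvgnD (cvgnM (cvgn_cst (Z s t)) (cvg_cexp (cvgN hL))) (cvgn_cst (-1 : C)).
  apply: (cvgC_unique (L1 _)).
  apply: (@cvgC0_le _ _ (fun m => logZ_const * 4^-1 ^+ m)).
    move=> m; apply: le_trans (Z_logZ_bound m (lexx _) s4 t4) _.
    rewrite ler_wpM2l ?logZ_const_ge0 //.
    have -> : 4^-1 ^+ m.+2 = 4^-1 ^+ 2 * 4^-1 ^+ m :> R by rewrite -exprD.
    by rewrite ler_piMl ?exprn_ge0 //; lra.
  by apply: (cvgn_eq _ _ (cvgnM (cvgn_cst logZ_const) g)) => //; rewrite mulr0.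
move/eqP: E; rewrite addr_eq0 opprK => /eqP E.
by rewrite -[LHS]mulr1 -(cexpN_mul L) mulrA E mul1r.
Qed.

End LogarithmSeries.

(** * The power series of Z(s, t) *)

Section MahlerSeries.
Variable R : realType.
Local Notation C := (Cx R).
Local Notation mu := (@lebesgue_measure R).
Local Notation D := (@arcs R).
Implicit Types (s t : C) (x : R).

Let lf x : R := ln (sinabs x).
Let lg x : R := ln (cosabs x).
Let U x : R := `|lf x| + `|lg x|.
(** One integrable majorant for all monomials in log f and log g, and for the remainders of exp (s
    log f + t log g) when |s|, |t| <= 1/4. *)
Let W x : R := expR (U x / 2).
Let mD : measurable D := @measurable_arcs R.

Let measurable_lf : measurable_fun D lf.
Proof. exact: (measurableT_comp (@measurable_ln R) (@measurable_sinabs R)). Qed.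

Let measurable_lg : measurable_fun D lg.
Proof. exact: (measurableT_comp (@measurable_ln R) (@measurable_cosabs R)). Qed.

Let measurable_U : measurable_fun D U.
Proof.
by apply: measurable_funD; apply: (measurableT_comp (@normr_measurable R setT)).
Qed.

Lemma expR_norm_le (a : R) : expR `|a| <= expR a + expR (- a).
Proof.
have [h|h] := ger0P a; first by rewrite lerDl expR_ge0.
by rewrite lerDr expR_ge0.
Qed.

(** By exp |a| <= exp a + exp (- a), [W] is at most the sum of the four products of f^(1/2) or
    f^(-1/2) with g^(1/2) or g^(-1/2), whose exponents exceed -1. *)
Let W_integrable : rintegrable D W.
Proof.
have h1 : -1 < 2^-1 :> R by lra.
have h2 : -1 < - 2^-1 :> R by lra.
have i1 := arcs_rintegrable h1 h1; have i2 := arcs_rintegrable h1 h2.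
have i3 := arcs_rintegrable h2 h1; have i4 := arcs_rintegrable h2 h2.
apply: (le_rintegrable mD _ _ (rintegrableD mD (rintegrableD mD i1 i2) (rintegrableD mD i3 i4))).
  apply: (measurableT_comp (@measurable_expR R)).
  by apply: measurable_funM => //; exact: measurable_cst.
move=> x _; rewrite ger0_norm ?expR_ge0 //= /W /U mulrDl expRD.
have e (a : R) : expR (`|a| / 2) <= expR (2^-1 * a) + expR (- 2^-1 * a).
  have -> : `|a| / 2 = `|2^-1 * a| by rewrite normrM ger0_norm ?invr_ge0 // mulrC.
  by apply: le_trans (expR_norm_le _) _; rewrite mulNr.
apply: le_trans (ler_pM (expR_ge0 _) (expR_ge0 _) (e _) (e _)) _.
by rewrite mulrDl !mulrDr.
Qed.

Lemma expn_le_expR (y : R) n : 0 <= y -> y ^+ n / n`!%:R <= expR y.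
Proof.
move=> y0; case: n => [|n]; first by rewrite fact0 divr1 expr0; have := expR_ge1Dx y; lra.
by apply: le_trans (expR_ge1Dxn n y0); rewrite lerDr.
Qed.

Let U_ge0 x : 0 <= U x. Proof. by rewrite addr_ge0. Qed.

Let measurable_monomial i j : measurable_fun D (fun x => lf x ^+ i * lg x ^+ j).
Proof. by apply: measurable_funM; exact: measurable_funX. Qed.

Let monomial_integrable i j : rintegrable D (fun x => lf x ^+ i * lg x ^+ j).
Proof.
have := rintegrableZ ((i + j)`!%:R * 2 ^+ (i + j)) mD W_integrable.
apply: (le_rintegrable mD) => // x _.
have fp : 0 < (i + j)`!%:R :> R by rewrite ltr0n fact_gt0.
rewrite normrM !normrX; apply: (@le_trans _ _ (U x ^+ (i + j))).
  rewrite exprD; apply: ler_pM; rewrite ?exprn_ge0 // lerXn2r ?nnegrE //.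
    by rewrite lerDl.
  by rewrite lerDr.
have := @expn_le_expR (U x / 2) (i + j) (divr_ge0 (U_ge0 x) (ler0n _ _)).
rewrite ler_pdivrMr // expr_div_n ler_pdivrMr ?exprn_gt0 // -/(W x).
by move/le_trans; apply; rewrite [leRHS]mulrC mulrA.
Qed.

Lemma mxxE i j : @mxx R i j = Rintegral mu D (fun x => lf x ^+ i * lg x ^+ j).
Proof. by rewrite /mxx -Rintegral_unit_arcs. Qed.

Definition mahler_coef i j : R := mxx R i j / (i`!%:R * j`!%:R).
Definition mahler_term s t n : C :=
  \sum_(i < n.+1) (mahler_coef i (n - i))%:C * s ^+ i * t ^+ (n - i).

Let Y s t x : C := s * (lf x)%:C + t * (lg x)%:C.

Let YE s t x : pw (sinabs x) s * pw (cosabs x) t = cexp (Y s t x).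
Proof. by rewrite /Y cexpD. Qed.

Let cabs_Y s t (r : R) x : cabs s <= r -> cabs t <= r -> cabs (Y s t x) <= r * U x.
Proof.
move=> sr tr; apply: le_trans (cabsD _ _) _; rewrite !cabsM !cabs_real mulrDr.
by rewrite lerD // ler_wpM2r.
Qed.

Let mono s t n i x : C := (s ^+ i * t ^+ (n - i) / (i`!%:R * (n - i)`!%:R)) *
  (lf x ^+ i * lg x ^+ (n - i))%:C.

Let YnE s t n x : Y s t x ^+ n / n`!%:R = \sum_(i < n.+1) mono s t n i x.
Proof.
rewrite /Y addrC exprDn big_distrl /=; apply: eq_bigr => i _.
have le_in : (i <= n)%N by rewrite -ltnS.
have fn (m : nat) : m`!%:R != 0 :> C by rewrite pnatr_eq0 -lt0n fact_gt0.
have e : n`!%:R = 'C(n, i)%:R * (i`!%:R * (n - i)`!%:R) :> C by rewrite -!natrM bin_fact.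
have bn : 'C(n, i)%:R != 0 :> C by rewrite pnatr_eq0 -lt0n bin_gt0.
rewrite e /mono realCM !realCX !exprMn -mulr_natr.
by field; rewrite bn !fn.
Qed.

Let mono_integrable s t n i : cintegrable D (mono s t n i).
Proof.
by apply: (cintegrableZ _ mD); apply: (cintegrable_real mD); exact: monomial_integrable.
Qed.

Let Yn_integral s t n : cintegrable D (fun x => Y s t x ^+ n / n`!%:R) /\
  cintegral D (fun x => Y s t x ^+ n / n`!%:R) = mahler_term s t n.
Proof.
split.
  exact: (@eq_cintegrable _ _ (fun x => \sum_(i < n.+1) mono s t n i x) _ mD
    (fun x _ => esym (YnE s t n x)) (cintegrable_sum n.+1 mD (mono_integrable s t n))).
apply: (etrans (eq_cintegral (fun x _ => YnE s t n x))).
rewrite (cintegral_sum _ mD (mono_integrable s t n)); apply: eq_bigr => i _.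
rewrite /mono cintegralZ //; last by apply: (cintegrable_real mD); exact: monomial_integrable.
rewrite cintegral_real -mxxE /mahler_coef realCM realCV realCM !realC_nat.
move: (mxx _ _ _)%:C ((_ * _)^-1) => a b; ring.
Qed.

Let expT_integral s t n : cintegrable D (fun x => expT n (Y s t x)) /\
  cintegral D (fun x => expT n (Y s t x)) = series (mahler_term s t) n.
Proof.
split; first exact: (cintegrable_sum n mD (fun k => (Yn_integral s t k).1)).
rewrite /expT (cintegral_sum n mD (fun k => (Yn_integral s t k).1)) /series /= big_mkord.
by apply: eq_bigr => k _; rewrite (Yn_integral s t k).2.
Qed.

Definition mahler_const : R := 2 * Rintegral mu D W.

(** The Taylor remainder is at most (4r)^n ((U / 4)^n / n!) exp (U / 4). The middle factor is again
    at most exp (U / 4), and the two exponentials multiply to [W]. *)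
Lemma Z_mahler_bound s t (r : R) n : r <= 4^-1 -> cabs s <= r -> cabs t <= r ->
  cabs (Z s t - series (mahler_term s t) n) <= mahler_const * (4 * r) ^+ n.
Proof.
move=> r4 sr tr; have r0 : 0 <= r := le_trans (cabs_ge0 s) sr.
have sm : -1 < Rez s by have := Re_le_cabs s; rewrite ler_norml => /andP[h _]; lra.
have tm : -1 < Rez t by have := Re_le_cabs t; rewrite ler_norml => /andP[h _]; lra.
have [i1 e1] := expT_integral s t n.
have iZ := Z_integrable sm tm.
rewrite -e1 /Z -(cintegralB mD iZ i1).
apply: le_trans (cabs_cintegral_le mD (cintegrableB mD iZ i1)
  (rintegrableZ ((4 * r) ^+ n) mD W_integrable) _) _; last first.
  rewrite RintegralZl // /mahler_const le_eqVlt; apply/orP; left; apply/eqP; ring.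
move=> x _; rewrite YE; apply: le_trans (cabs_cexp_sub_expT _ _) _.
have yU := cabs_Y x sr tr; have U0 := U_ge0 x.
have fp : 0 < n`!%:R :> R by rewrite ltr0n fact_gt0.
apply: (@le_trans _ _ ((4 * r) ^+ n * ((U x / 4) ^+ n / n`!%:R) * expR (U x / 4))).
  apply: ler_pM; rewrite ?expR_ge0 ?divr_ge0 ?exprn_ge0 ?cabs_ge0 //.
    rewrite mulrA -exprMn ler_pM2r ?invr_gt0 // lerXn2r ?nnegrE ?cabs_ge0 //.
      by rewrite mulr_ge0 // ?mulr_ge0 // divr_ge0.
    by apply: le_trans yU _; rewrite le_eqVlt; apply/orP; left; apply/eqP; field.
  by rewrite ler_expR (le_trans yU) // mulrC ler_wpM2l.
rewrite -mulrA ler_wpM2l ?exprn_ge0 ?mulr_ge0 //.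
have -> : W x = expR (U x / 4) * expR (U x / 4).
  by rewrite -expRD /W; congr expR; field.
by rewrite ler_wpM2r ?expR_ge0 // expn_le_expR // divr_ge0.
Qed.

Lemma cvg_mahler_series s t : cabs s < 8^-1 -> cabs t < 8^-1 ->
  series (mahler_term s t) @ \oo --> Z s t.
Proof.
move=> /ltW s8 /ltW t8.
(* At radius 1/8 the ratio 4 r of the error bound is 1/2. *)
have g : (fun n => 2^-1 ^+ n : R) @ \oo --> (0 : R) by apply: cvg_expr; rewrite ger0_norm; lra.
have h : (fun n => series (mahler_term s t) n - Z s t) @ \oo --> (0 : C).
  apply: (@cvgC0_le _ _ (fun n => mahler_const * 2^-1 ^+ n)).
    move=> n; rewrite -cabsN opprB; have r4 : 8^-1 <= 4^-1 :> R by lra.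
    apply: le_trans (Z_mahler_bound n r4 s8 t8) _.
    by have -> : 4 * 8^-1 = 2^-1 :> R by field.
  by apply: (cvgn_eq _ _ (cvgnM (cvgn_cst mahler_const) g)) => //; rewrite mulr0.
apply: (cvgn_eq _ _ (cvgnD h (cvgn_cst (Z s t)))) => [n|]; first by rewrite subrK.
by rewrite add0r.
Qed.

End MahlerSeries.

(** * Even zeta values *)

Section ElementarySymmetric.
Variable K : comNzRingType.
Variable y : nat -> K.

(** Elementary symmetric function of degree k in y 0, ..., y (N - 1), split according to whether the
    last variable occurs. *)
Fixpoint elsym (k N : nat) : K :=
  match k, N with
  | 0%N, _ => 1
  | _.+1, 0%N => 0
  | k'.+1, N'.+1 => elsym k N' + y N' * elsym k' N'
  end.

Lemma elsym0 N : elsym 0 N = 1. Proof. by case: N. Qed.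

Lemma elsymS k N : elsym k.+1 N.+1 = elsym k.+1 N + y N * elsym k N. Proof. by []. Qed.

Global Arguments elsym : simpl never.

Let psum i N : K := \sum_(n < N) y n ^+ i.

(** Removal of a variable: the generating function for N variables is the one for N + 1 variables
    divided by 1 + y N X. *)
Let elsym_alternating k N : \sum_(i < k.+1) (-1) ^+ i * elsym (k - i) N.+1 * y N ^+ i = elsym k N.
Proof.
elim: k => [|k IH]; first by rewrite big_ord_recl big_ord0 !elsym0 !expr0 !mulr1 addr0.
rewrite big_ord_recl /= expr0 mul1r mulr1 subn0 elsymS -[RHS]addr0 -addrA; congr (_ + _).
rewrite -IH big_distrr -big_split big1 //= => i _.
by rewrite /bump /= add1n subSS !exprS; ring.
Qed.

(** Induction on the number of variables: the new variable adds its powers to the power sums, and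
    [elsym_alternating] evaluates their contribution. *)
Lemma newton k N :
  k%:R * elsym k N = \sum_(i < k) (-1) ^+ i * elsym (k.-1 - i) N * \sum_(n < N) y n ^+ i.+1.
Proof.
elim: N k => [|N IH] k.
  rewrite big1 => [|i _]; last by rewrite big_ord0 mulr0.
  by case: k => [|k]; rewrite ?mul0r //= mulr0.
case: k => [|k]; first by rewrite mul0r big_ord0.
have S i : \sum_(n < N.+1) y n ^+ i.+1 = psum i.+1 N + y N * y N ^+ i.
  by rewrite big_ord_recr /= exprS.
transitivity (\sum_(i < k.+1) (-1) ^+ i * elsym (k - i) N.+1 * psum i.+1 N
   + y N * \sum_(i < k.+1) (-1) ^+ i * elsym (k - i) N.+1 * y N ^+ i); last first.
  rewrite big_distrr -big_split /=; apply: eq_bigr => i _.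
  by rewrite S mulrDr; congr (_ + _); rewrite mulrCA.
rewrite elsym_alternating.
have -> : \sum_(i < k.+1) (-1) ^+ i * elsym (k - i) N.+1 * psum i.+1 N =
    k.+1%:R * elsym k.+1 N + y N * (k%:R * elsym k N).
  rewrite !IH /= !big_ord_recr /= !subnn !elsym0 [y N * _]big_distrr /= [RHS]addrAC -big_split /=.
  congr (_ + _); apply: eq_bigr => i _.
  have -> : (k - i = (k.-1 - i).+1)%N.
    by case: k i => [[]//|k] i /=; rewrite subSn // -ltnS.
  rewrite elsymS -/(psum i.+1 N); ring.
rewrite elsymS -natr1; ring.
Qed.

End ElementarySymmetric.

(** * Moments of even powers of cosine and the elementary symmetric functions of 1 / m^2 *)

Section EvenZeta.
Variable R : realType.
Local Notation mu := (@lebesgue_measure R).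

Lemma is_derive_exp (f : R -> R) n (x df : R) : is_derive x 1 f df ->
  is_derive x 1 (fun y => f y ^+ n.+1) (n.+1%:R * f x ^+ n * df).
Proof.
move=> h; have := is_deriveX n.+1 h.
by rewrite (_ : f ^+ n.+1 = (fun y => f y ^+ n.+1)) //; apply/funext => z; rewrite fctE.
Qed.

Lemma ftc_itv (F f : R -> R) (a b : R) : a < b -> (forall x : R, is_derive x 1 F (f x)) ->
  continuous f -> Rintegral mu `[a, b] f = F b - F a.
Proof.
move=> ab dF cf.
have cF x : F @ x --> F x.
  by apply: differentiable_continuous; apply/derivable1_diffP; have h := dF x; exact: ex_derive.
rewrite /Rintegral (@continuous_FTC2 R f F) //.
- by apply: continuous_in_subspaceT => x _; exact: cf.
- split.
  + by move=> x _; have h := dF x; exact: ex_derive.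
  + exact: cvg_at_right_filter.
  + exact: cvg_at_left_filter.
- by move=> x _; rewrite derive1E; have := dF x => ?; rewrite derive_val.
Qed.

Lemma continuous_rintegrable (f : R -> R) (a b : R) : continuous f -> rintegrable `[a, b] f.
Proof.
move=> cf; apply: continuous_compact_integrable; first exact: segment_compact.
by apply: continuous_in_subspaceT => x _; exact: cf.
Qed.

Let m k n (x : R) : R := x ^+ k * cos x ^+ n.

Let m_continuous k n : continuous (m k n).
Proof.
move=> x; apply: cvgM; first exact: exprn_continuous.
exact: (@continuous_comp _ _ _ (@cos R) (fun z => z ^+ n) x (@continuous_cos R x) (@exprn_continuous _ _ _)).
Qed.

Definition wallis k n : R := Rintegral mu `[0, pi / 2] (m k.*2 n.*2).
Local Notation J := wallis.

Let pi2_gt0 : 0 < pi / 2 :> R. Proof. by rewrite divr_gt0 // pi_gt0. Qed.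

Let J_integrable k n : rintegrable `[0, pi / 2] (m k n).
Proof. exact/continuous_rintegrable/m_continuous. Qed.

Let mZ c k n : Rintegral mu `[0, pi / 2] (fun x => c * m k n x) =
  c * Rintegral mu `[0, pi / 2] (m k n).
Proof. by rewrite RintegralZl //; exact: J_integrable. Qed.

Let mZ_integrable c k n : rintegrable `[0, pi / 2] (fun x => c * m k n x).
Proof. exact: rintegrableZ. Qed.

Let dcos x := @is_derive_cos R x.
Let dsin x := @is_derive_sin R x.
Let did (x : R) := is_derive_id x (1 : R).

Lemma wallis_rec k n :
  (k.*2.+2)%:R * (k.*2.+1)%:R * J k n.+1 + (n.*2.+2)%:R ^+ 2 * J k.+1 n.+1 =
  (n.*2.+2)%:R * (n.*2.+1)%:R * J k.+1 n.
Proof.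
(* With u = x^(2k + 2) and v = cos^(2n + 2), [F] is the Wronskian u' v - u v', so its derivative is
   u'' v - u v'', where v'' is a combination of cos^(2n) and cos^(2n + 2). It vanishes at both
   ends. *)
pose F (x : R) := k.*2.+2%:R * (x ^+ k.*2.+1 * cos x ^+ n.*2.+2)
  + n.*2.+2%:R * (x ^+ k.*2.+2 * (cos x ^+ n.*2.+1 * sin x)).
pose f (x : R) := (k.*2.+2%:R * k.*2.+1%:R * m k.*2 n.*2.+2 x + n.*2.+2%:R ^+ 2 * m k.*2.+2 n.*2.+2 x)
  - n.*2.+2%:R * n.*2.+1%:R * m k.*2.+2 n.*2 x.
have dF (x : R) : is_derive x 1 F (f x).
  have h1 := is_deriveM (is_derive_exp k.*2 (did x)) (is_derive_exp n.*2.+1 (dcos x)).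
  have h2 := is_deriveM (is_derive_exp k.*2.+1 (did x))
     (is_deriveM (is_derive_exp n.*2 (dcos x)) (dsin x)).
  have h := is_deriveD (is_deriveZ (k.*2.+2%:R : R) h1) (is_deriveZ (n.*2.+2%:R : R) h2).
  apply: (is_derive_eq h); rewrite /f /m.
  rewrite [((fun _ => _) * sin) x](_ : _ = cos x ^+ n.*2.+1 * sin x) // /GRing.scale /= !exprS.
  have e : sin x * sin x = 1 - cos x * cos x by rewrite -!expr2 sin2cos2.
  have e2 : n.*2.+2%:R = n.*2.+1%:R + 1 :> R by rewrite natr1.
  move: (cos x) (sin x) e => c s e; rewrite e2.
  move: (x ^+ k.*2) (c ^+ n.*2) (n.*2.+1%:R : R) (k.*2.+1%:R : R) (k.*2.+2%:R : R) => a b d g l.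
  ring: e.
have cf : continuous f.
  move=> x; apply: cvgB; [apply: cvgD|]; (apply: cvgM; [exact: cvg_cst|exact: m_continuous]).
have := ftc_itv pi2_gt0 dF cf.
have -> : F (pi / 2) - F 0 = 0 by rewrite /F cos_pihalf !exprS !mul0r !mulr0 subrr.
rewrite /f RintegralB //; try exact: mZ_integrable; last exact: rintegrableD.
rewrite RintegralD //; try exact: mZ_integrable.
by rewrite !mZ => /eqP; rewrite subr_eq0 => /eqP.
Qed.

Lemma wallis0_rec n : (n.*2.+2)%:R * J 0 n.+1 = (n.*2.+1)%:R * J 0 n.
Proof.
pose F (x : R) := cos x ^+ n.*2.+1 * sin x.
pose f (x : R) := n.*2.+2%:R * m 0 n.*2.+2 x - n.*2.+1%:R * m 0 n.*2 x.
have dF (x : R) : is_derive x 1 F (f x).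
  apply: (is_derive_eq (is_deriveM (is_derive_exp n.*2 (dcos x)) (dsin x))).
  rewrite /f /m /GRing.scale /= !exprS expr0.
  have e : sin x * sin x = 1 - cos x * cos x by rewrite -!expr2 sin2cos2.
  have e2 : n.*2.+2%:R = n.*2.+1%:R + 1 :> R by rewrite natr1.
  move: (cos x) (sin x) e => c s e; rewrite e2.
  move: (c ^+ n.*2) (n.*2.+1%:R : R) => b d.
  ring: e.
have cf : continuous f.
  move=> x; apply: cvgB; (apply: cvgM; [exact: cvg_cst|exact: m_continuous]).
have := ftc_itv pi2_gt0 dF cf.
have -> : F (pi / 2) - F 0 = 0 by rewrite /F cos_pihalf sin0 !exprS !mul0r !mulr0 subrr.
rewrite /f RintegralB //; try exact: mZ_integrable.
by rewrite !mZ => /eqP; rewrite subr_eq0 => /eqP.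
Qed.

Lemma wallis_0 k : J k 0 = (pi / 2) ^+ k.*2.+1 / k.*2.+1%:R.
Proof.
have k0 : k.*2.+1%:R != 0 :> R by rewrite pnatr_eq0.
pose F (x : R) := k.*2.+1%:R^-1 * x ^+ k.*2.+1.
have dF (x : R) : is_derive x 1 F (m k.*2 0 x).
  apply: (is_derive_eq (is_deriveZ (k.*2.+1%:R^-1 : R) (is_derive_exp k.*2 (did x)))).
  by rewrite /m /GRing.scale /= expr0; field.
by rewrite /wallis (ftc_itv pi2_gt0 dF (@m_continuous _ _)) /F expr0n mulr0 subr0 mulrC.
Qed.

Lemma wallis0_gt0 n : 0 < J 0 n.
Proof.
elim: n => [|n IH]; first by rewrite wallis_0 divr1 expr1.
have : 0 < n.*2.+2%:R * J 0 n.+1 by rewrite wallis0_rec mulr_gt0.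
by rewrite pmulr_rgt0.
Qed.

Definition wallisq k n : R := 4 ^+ k / (k.*2)`!%:R * (J k n / J 0 n).
Local Notation b := wallisq.

Lemma wallisq_0n n : b 0 n = 1.
Proof. by rewrite /wallisq expr0 divr1 mul1r divff // gt_eqF // wallis0_gt0. Qed.

Lemma wallisq_n0 k : b k 0 = pi ^+ k.*2 / (k.*2.+1)`!%:R.
Proof.
have p0 : pi / 2 != 0 :> R by rewrite gt_eqF.
have f0 : (k.*2)`!%:R != 0 :> R by rewrite pnatr_eq0 -lt0n fact_gt0.
have k0 : k.*2.+1%:R != 0 :> R by rewrite pnatr_eq0.
rewrite /wallisq !wallis_0 expr1 divr1 factS natrM exprS.
have -> : 4 ^+ k = 2 ^+ k.*2 :> R by rewrite -mul2n exprM; congr (_ ^+ _); ring.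
have -> : pi ^+ k.*2 = 2 ^+ k.*2 * (pi / 2) ^+ k.*2 :> R.
  by rewrite -exprMn mulrC divfK // pnatr_eq0.
move: (pi / 2) p0 => p p0; move: (2 ^+ k.*2 : R) (p ^+ k.*2) f0 k0 => u v.
move: (k.*2.+1%:R : R) (k.*2`!%:R : R) => a c c0 a0.
by field; rewrite p0 c0 a0.
Qed.

Lemma wallisq_rec k n : b k.+1 n = b k.+1 n.+1 + (n.+1%:R ^+ 2)^-1 * b k n.+1.
Proof.
have h := wallis_rec k n; have h0 := wallis0_rec n.
have I0 := wallis0_gt0 n; have I1 := wallis0_gt0 n.+1.
have f0 : (k.*2)`!%:R != 0 :> R by rewrite pnatr_eq0 -lt0n fact_gt0.
have e1 : n.*2.+2%:R = 2 * n.+1%:R :> R by rewrite -natrM mul2n -doubleS.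
have n0 : n.+1%:R != 0 :> R by rewrite pnatr_eq0.
have k1 : k.*2.+1%:R != 0 :> R by rewrite pnatr_eq0.
have k2 : k.*2.+2%:R != 0 :> R by rewrite pnatr_eq0.
have n1 : n.*2.+1%:R != 0 :> R by rewrite pnatr_eq0.
rewrite /wallisq doubleS !factS !natrM exprS.
rewrite e1 in h h0.
have E1 : J 0 n = 2 * n.+1%:R * J 0 n.+1 / n.*2.+1%:R by rewrite h0 mulrC mulKf.
have E2 : J k.+1 n = (k.*2.+2%:R * k.*2.+1%:R * J k n.+1 + (2 * n.+1%:R) ^+ 2 * J k.+1 n.+1)
    / (2 * n.+1%:R * n.*2.+1%:R).
  by rewrite h mulrC mulKf // !mulf_neq0 // pnatr_eq0.
rewrite E1 E2; move: I1 n0 n1 k1 k2 f0; move: (J 0 n.+1) => I I1.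
move: (n.+1%:R : R) (n.*2.+1%:R : R) (k.*2.+1%:R : R) (k.*2.+2%:R : R) => N M K1 K2 n0 n1 k1 k2.
move: (k.*2`!%:R : R) (J k n.+1) (J k.+1 n.+1) (4 ^+ k : R) => f a c d f0.
by field; rewrite n0 n1 k1 k2 f0 gt_eqF.
Qed.

Let wallis_ge0 k n : 0 <= J k n.
Proof.
apply: Rintegral_ge0 => x; rewrite /= in_itv /= => /andP[x0 x1].
by apply: mulr_ge0; [exact: exprn_ge0|rewrite -mul2n exprM exprn_ge0 // sqr_ge0].
Qed.

Lemma wallisq_ge0 k n : 0 <= b k n.
Proof. by apply: mulr_ge0; apply: divr_ge0; rewrite ?exprn_ge0. Qed.

(** The mean value theorem gives sin x = x cos (c x) with 0 <= c <= 1, and cosine decreases on the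
    interval. *)
Lemma mul_cos_le_sin (x : R) : 0 <= x <= pi / 2 -> 0 <= x * cos x <= sin x.
Proof.
move=> /andP[x0 x1]; have p0 := pi_gt0 R.
have c0 : 0 <= cos x by apply: cos_ge0_pihalf; rewrite x1 andbT; lra.
rewrite mulr_ge0 //=.
have [|c /andP[c0' c1] ec] := @mvt01 R (fun y => sin (y * x)) (fun y => x * cos (y * x)).
  move=> y _; have h : is_derive y 1 (fun y : R => y * x) x.
    by apply: (is_derive_eq (is_deriveM (did y) (is_derive_cst x y 1))); rewrite scaler0 add0r /GRing.scale /= mulr1.
  by apply: (is_derive_eq (@is_derive1_comp R (@sin R) _ y _ _ (dsin _) h)); rewrite mulrC.
rewrite mul1r mul0r sin0 subr0 in ec; rewrite ec ler_wpM2l // leNgt.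
have cx : c * x <= x by rewrite ler_piMl.
by rewrite ltr_cos ?in_itv /= ?mulr_ge0 ?x0 //=; lra.
Qed.

(** One factor (x cos x)^2 is bounded by sin^2 x = 1 - cos^2 x, which produces a difference of
    consecutive integrals; the remaining x^(2k) is at most (pi / 2)^(2k). *)
Lemma wallis_le k n : J k.+1 n.+1 <= (pi / 2) ^+ k.*2 * (J 0 n - J 0 n.+1).
Proof.
have iB : rintegrable `[0, pi / 2] (fun x => m 0 n.*2 x - m 0 n.+1.*2 x) by exact: rintegrableB.
have -> : (pi / 2) ^+ k.*2 * (J 0 n - J 0 n.+1) =
    Rintegral mu `[0, pi / 2] (fun x => (pi / 2) ^+ k.*2 * (m 0 n.*2 x - m 0 n.+1.*2 x)).
  by rewrite RintegralZl // RintegralB //; exact: J_integrable.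
apply: Rintegral_le => //; first exact: rintegrableZ.
move=> x; rewrite /= in_itv /= => xI; have /andP[x0 x1] := xI.
have /andP[xc0 xc] := mul_cos_le_sin xI.
rewrite /m expr0 !mul1r.
have -> : x ^+ k.+1.*2 * cos x ^+ n.+1.*2 = x ^+ k.*2 * (cos x ^+ n.*2 * (x * cos x) ^+ 2).
  by rewrite !doubleS !exprS expr0; ring.
have -> : cos x ^+ n.*2 - cos x ^+ n.+1.*2 = cos x ^+ n.*2 * sin x ^+ 2.
  by rewrite sin2cos2 !doubleS !exprS expr0; ring.
have c0 : 0 <= cos x ^+ n.*2 by rewrite -mul2n exprM exprn_ge0 // sqr_ge0.
apply: ler_pM.
- exact: exprn_ge0.
- by rewrite mulr_ge0 // sqr_ge0.
- by rewrite lerXn2r // nnegrE ltW.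
- by rewrite ler_wpM2l // lerXn2r // nnegrE // (le_trans xc0).
Qed.

(** By [wallis0_rec] the difference in [wallis_le] equals J 0 (n + 1) / (2n + 1), so the mean is O(1
    / n). *)
Lemma cvg_wallisq k : b k.+1 @ \oo --> (0 : R).
Proof.
rewrite -cvg_shiftS /=.
pose M : R := 4 ^+ k.+1 / (k.+1.*2)`!%:R * (pi / 2) ^+ k.*2.
have h n : b k.+1 n.+1 <= M * harmonic n.
  rewrite /wallisq /M -[leRHS]mulrA ler_wpM2l ?divr_ge0 ?exprn_ge0 //.
  rewrite ler_pdivrMr ?wallis0_gt0 //; apply: le_trans (wallis_le k n) _.
  rewrite -[leRHS]mulrA ler_wpM2l ?exprn_ge0 ?(ltW pi2_gt0) //.
  have h0 := wallis0_rec n; have I1 := wallis0_gt0 n.+1.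
  have e : n.*2.+1%:R * (J 0 n - J 0 n.+1) = J 0 n.+1.
    by rewrite mulrBr -h0 -natr1; ring.
  have n0 : 0 < n.*2.+1%:R :> R by rewrite ltr0n.
  have -> : J 0 n - J 0 n.+1 = n.*2.+1%:R^-1 * J 0 n.+1 by rewrite -[X in _ = _ * X]e mulKf // gt_eqF.
  rewrite ler_wpM2r ?(ltW I1) // /harmonic /= lef_pV2 ?posrE // ler_nat ltnS -addnn; exact: leq_addr.
apply: (@squeeze_cvgr _ _ _ _ (fun=> 0) (fun n => M * harmonic n)).
- by apply: nearW => n; rewrite wallisq_ge0 h.
- exact: cvgn_cst.
- by apply: (cvgn_eq _ _ (cvgnM (cvgn_cst M) (@cvg_harmonic R))) => //; rewrite mulr0.
Qed.

Let y (n : nat) : R := (n.+1%:R ^+ 2)^-1.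
Local Notation e := (elsym y).

(* By [wallisq_rec] the left-hand side does not depend on [N]; the value is read off at [N = 0]. *)
Lemma elsym_wallisq k N : \sum_(j < k.+1) e j N * b (k - j) N = pi ^+ k.*2 / (k.*2.+1)`!%:R.
Proof.
elim: N => [|N IH].
  rewrite big_ord_recl elsym0 mul1r subn0 big1 ?addr0 ?wallisq_n0 // => j _.
  by rewrite mul0r.
rewrite -{}IH big_ord_recl elsym0 mul1r subn0 [RHS]big_ord_recr /= subnn wallisq_0n mulr1.
transitivity (\sum_(j < k) (e j N * b (k - j) N.+1 + y N * e j N * b (k.-1 - j) N.+1) + e k N); last first.
  congr (_ + _); apply: eq_bigr => j _.
  have -> : (k - j = (k.-1 - j).+1)%N.
    by case: k j => [[]//|k] j /=; rewrite subSn // -ltnS.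
  by rewrite [b _ N]wallisq_rec -/(y N); ring.
pose A (j : nat) := e j N * b (k - j) N.+1.
have X : \sum_(j < k.+1) A j = b k N.+1 + \sum_(j < k) e j.+1 N * b (k - j.+1) N.+1.
  by rewrite big_ord_recl {1}/A elsym0 mul1r subn0.
have Y : \sum_(j < k.+1) A j = \sum_(j < k) A j + e k N.
  by rewrite big_ord_recr {2}/A /= subnn wallisq_0n mulr1.
rewrite big_split /= addrAC -[\sum_(j < k) _ + e k N]Y X -addrA -big_split /=.
congr (_ + _); apply: eq_bigr => j _.
have -> : (k.-1 - j = k - bump 0 j)%N by rewrite /bump /= add1n -predn_sub -subnS.
by rewrite /bump /= add1n elsymS mulrDl.
Qed.

Let elsym_ge0 k N : 0 <= e k N.
Proof.
elim: N k => [|N IH] [|k]; rewrite ?elsym0 // elsymS.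
by rewrite addr_ge0 // mulr_ge0 // invr_ge0 exprn_ge0.
Qed.

Let elsym_le k N : e k N <= pi ^+ k.*2 / (k.*2.+1)`!%:R.
Proof.
rewrite -(elsym_wallisq k N) big_ord_recr /= subnn wallisq_0n mulr1 lerDr.
by apply: sumr_ge0 => j _; rewrite mulr_ge0 // wallisq_ge0.
Qed.

(** In [elsym_wallisq] only the term j = k survives as N -> oo, since b 0 is 1; the others are a
    bounded [e j] times a mean tending to 0. *)
Lemma cvg_elsym k : e k @ \oo --> (pi ^+ k.*2 / (k.*2.+1)`!%:R : R).
Proof.
pose B (j : nat) : R := pi ^+ j.*2 / (j.*2.+1)`!%:R.
(* The form [(k - j).-1.+1] displays a positive index, as [cvg_wallisq] requires. *)
have h : (fun N => \sum_(j < k) e j N * b (k - j).-1.+1 N) @ \oo --> (\sum_(j < k) 0 : R).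
  apply: (@cvgn_sum R k (fun j N => e j N * b (k - j).-1.+1 N) (fun=> 0)) => j.
  apply: (@squeeze_cvgr _ _ _ _ (fun=> 0) (fun N => B j * b (k - j).-1.+1 N)).
  - apply: nearW => N; rewrite mulr_ge0 ?wallisq_ge0 //= ler_wpM2r ?wallisq_ge0 //.
  - exact: cvgn_cst.
  - by apply: (cvgn_eq _ _ (cvgnM (cvgn_cst (B j)) (@cvg_wallisq _))) => //; rewrite mulr0.
apply: (cvgn_eq _ _ (cvgB (cvgn_cst (B k)) h)) => [N|]; last by rewrite big1 // subr0.
rewrite /B -(elsym_wallisq k N) big_ord_recr /= subnn wallisq_0n mulr1.
rewrite -[LHS]/(\sum_(j < k) e j N * b (k - j) N + e k N - \sum_(j < k) e j N * b (k - j).-1.+1 N).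
rewrite [in X in _ - X](eq_bigr (fun j : 'I_k => e j N * b (k - j) N)); first by rewrite addrC addKr.
by move=> j _; rewrite prednK // subn_gt0.
Qed.

Lemma zeta_newton k : k.+1%:R * (pi ^+ k.+1.*2 / (k.+1.*2.+1)`!%:R) =
  \sum_(i < k.+1) (-1) ^+ i * (pi ^+ (k - i).*2 / ((k - i).*2.+1)`!%:R) * zeta R i.+1.*2.
Proof.
have h1 := cvgnM (cvgn_cst (k.+1%:R : R)) (@cvg_elsym k.+1).
have h2 : (fun N => \sum_(i < k.+1) (-1) ^+ i * e (k - i) N * zetaN R i.+1.*2 N) @ \oo -->
  (\sum_(i < k.+1) (-1) ^+ i * (pi ^+ (k - i).*2 / ((k - i).*2.+1)`!%:R) * zeta R i.+1.*2 : R).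
  apply: (@cvgn_sum R k.+1 (fun i N => (-1) ^+ i * e (k - i) N * zetaN R i.+1.*2 N)
    (fun i => (-1) ^+ i * (pi ^+ (k - i).*2 / ((k - i).*2.+1)`!%:R) * zeta R i.+1.*2)) => i.
  by apply: cvgnM; [apply: cvgnM; [exact: cvgn_cst|exact: cvg_elsym]|exact: cvg_zetaN].
apply: (cvg_unique _ h1) => //; apply: (cvgn_eq _ _ h2) => // N.
rewrite newton /=; apply: eq_bigr => i _; congr (_ * _).
rewrite /zetaN big_add1 big_mkord; apply: eq_bigr => n _.
by rewrite /y exprVn -exprM mul2n.
Qed.

End EvenZeta.

(** * Zeta values in the ring generated by pi^2 and the odd zeta values *)

Section ZetaRing.
Variable R : realType.
Local Notation V := (@zeta_ring R).

Lemma zeta_ring0 : V 0. Proof. by have := zr_rat R 0; rewrite rmorph0. Qed.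
Lemma zeta_ring1 : V 1. Proof. by have := zr_rat R 1; rewrite rmorph1. Qed.

Lemma zeta_ringN x : V x -> V (- x).
Proof. by move=> h; rewrite -mulN1r; apply: zr_mul h; have := zr_rat R (-1); rewrite rmorphN1. Qed.

Lemma zeta_ringB x z : V x -> V z -> V (x - z).
Proof. by move=> hx hz; apply: zr_add => //; exact: zeta_ringN. Qed.

Lemma zeta_ring_nat n : V n%:R.
Proof. by have := zr_rat R n%:R; rewrite rmorph_nat. Qed.

Lemma zeta_ring_natV n : V n%:R^-1.
Proof. by have := zr_rat R n%:R^-1; rewrite fmorphV rmorph_nat. Qed.

Lemma zeta_ringX x n : V x -> V (x ^+ n).
Proof. by move=> h; elim: n => [|n IH]; [exact: zeta_ring1|rewrite exprS; exact: zr_mul]. Qed.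

Lemma zeta_ring_sum (I : Type) (r : seq I) (P : pred I) (F : I -> R) :
  (forall i, P i -> V (F i)) -> V (\sum_(i <- r | P i) F i).
Proof. by move=> h; apply: big_ind => //; [exact: zeta_ring0|exact: zr_add]. Qed.

Let zeta_ring_E k : V (pi ^+ k.*2 / (k.*2.+1)`!%:R).
Proof.
by apply: zr_mul (zeta_ring_natV _); rewrite -mul2n exprM; apply: zeta_ringX; exact: zr_pi2.
Qed.

(** In [zeta_newton] the last term is zeta (2k + 2) with coefficient 1 or -1; all other terms are
    covered by strong induction or are rational multiples of powers of pi^2. *)
Let zeta_ring_zeta_even k : V (zeta R k.+1.*2).
Proof.
elim/ltn_ind: k => k IH; have := zeta_newton R k.
rewrite big_ord_recr /= subnn expr0 divr1 mulr1 => h.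
have s2 : (-1) ^+ k * ((-1) ^+ k * zeta R k.+1.*2) = zeta R k.+1.*2 :> R.
  by rewrite mulrA -exprMn mulrNN mulr1 expr1n mul1r.
have hs i : V ((-1) ^+ i) by apply: zeta_ringX; apply: zeta_ringN; exact: zeta_ring1.
rewrite -s2; apply: zr_mul (hs k) _.
have /(canRL (addKr _)) -> := esym h.
apply: zr_add; last by apply: zr_mul; [exact: zeta_ring_nat|exact: zeta_ring_E].
apply: zeta_ringN; apply: zeta_ring_sum => i _.
by apply: zr_mul; [apply: zr_mul; [exact: hs|exact: zeta_ring_E]|exact: IH].
Qed.

Lemma zeta_ring_zeta k : (2 <= k)%N -> V (zeta R k).
Proof.
move=> k2; rewrite -(odd_double_half k); have := odd_double_half k.
case: (odd k) => /= e.
  by apply: zr_zeta; rewrite lt0n; apply/negP => /eqP h; rewrite h in e; rewrite -e in k2.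
rewrite add0n; have : (0 < k./2)%N by rewrite lt0n; apply/negP => /eqP h; rewrite h in e; rewrite -e in k2.
by case: k./2 => // j _; exact: zeta_ring_zeta_even.
Qed.

End ZetaRing.

(** * Rationality of the coefficients *)

Section PolynomialCoefficients.
Variable R : realType.
Local Notation V := (@zeta_ring R).

Lemma poly_bound (p : {poly R}) : exists2 B : R, 0 <= B & forall x, 0 <= x <= 1 -> `|p.[x]| <= B.
Proof.
exists (\sum_(i < size p) `|p`_i|) => [|x /andP[x0 x1]]; first exact: sumr_ge0.
rewrite horner_coef (le_trans (ler_norm_sum _ _ _)) // ler_sum // => i _.
rewrite normrM ler_piMr // normrX (ger0_norm x0) exprn_ile1 //.
Qed.

Lemma norm_le_mulr_eq0 (a B d : R) : 0 < d -> (forall x, 0 < x < d -> `|a| <= B * x) -> a = 0.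
Proof.
move=> d0 h; apply/eqP; rewrite -normr_le0 leNgt; apply/negP => a0.
have B0 : 0 <= `|B| := normr_ge0 B.
have den : 0 < `|B| + 1 by lra.
pose x := Num.min (d / 2) (`|a| / 2 / (`|B| + 1)).
have x0 : 0 < x by rewrite lt_min !divr_gt0.
have xd : x < d by rewrite gt_min; apply/orP; left; lra.
have xa : x * (`|B| + 1) <= `|a| / 2 by rewrite -ler_pdivlMr // ge_min lexx orbT.
have := h x; rewrite x0 xd => /(_ isT) ax.
have : B * x <= `|B| * x by rewrite ler_wpM2r ?(ltW x0) // ler_norm.
rewrite mulrDr mulr1 mulrC in xa; lra.
Qed.

(** Substitutes for uniqueness of power series: the difference of two truncated expansions is a
    polynomial of size O(x^n) near 0. A vanishing constant term allows division by X. *)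
Lemma small_poly_coef (p : {poly R}) n (K d : R) : 0 < d ->
  (forall x, 0 < x < d -> `|p.[x]| <= K * x ^+ n) -> forall k, (k < n)%N -> p`_k = 0.
Proof.
move=> d0; elim: n p => [//|n IH] p h.
have [q qE] : exists q, p = q * 'X + (p`_0)%:P.
  exists (\poly_(i < (size p).-1) p`_i.+1); apply/polyP => i.
  rewrite coefD coefMX coefC coef_poly; case: i => [|i] /=; first by rewrite add0r.
  rewrite addr0; case: ltnP => // hi; rewrite nth_default //.
  by move: hi; case: (size p).
have [B B0 qB] := poly_bound q.
have p0 : p`_0 = 0.
  apply: (@norm_le_mulr_eq0 _ (B + `|K|) (Num.min d 1)); first by rewrite lt_min d0 /=.
  move=> x /andP[x0]; rewrite lt_min => /andP[xd x1].
  have -> : p`_0 = p.[x] - q.[x] * x by rewrite {2}qE !hornerE addrAC subrr add0r.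
  apply: le_trans (ler_normB _ _) _; rewrite mulrDl addrC lerD //.
    by rewrite normrM (gtr0_norm x0) ler_wpM2r ?(ltW x0) // qB // !ltW.
  apply: (le_trans (h x _)); first by rewrite x0.
  apply: (@le_trans _ _ (`|K| * x ^+ n.+1)); first by rewrite ler_wpM2r ?exprn_ge0 ?(ltW x0) // ler_norm.
  by rewrite ler_wpM2l // exprS ler_piMr ?(ltW x0) // exprn_ile1 ?(ltW x0) // ltW.
have hq x : 0 < x < d -> `|q.[x]| <= K * x ^+ n.
  move=> xI; have /andP[x0 _] := xI; have := h x xI.
  rewrite {1}qE p0 !hornerE normrM (gtr0_norm x0) exprSr mulrA ler_pM2r //.
case=> [_ //|k]; rewrite ltnS => kn; rewrite qE p0 addr0 coefMX /=; exact: IH hq k kn.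
Qed.

Definition zeta_poly (p : {poly R}) := forall i, V p`_i.

Lemma zeta_poly0 : zeta_poly 0.
Proof. by move=> i; rewrite coef0; exact: zeta_ring0. Qed.

Lemma zeta_polyD p q : zeta_poly p -> zeta_poly q -> zeta_poly (p + q).
Proof. by move=> hp hq i; rewrite coefD; exact: zr_add. Qed.

Lemma zeta_polyM p q : zeta_poly p -> zeta_poly q -> zeta_poly (p * q).
Proof. by move=> hp hq i; rewrite coefM; apply: zeta_ring_sum => j _; exact: zr_mul. Qed.

Lemma zeta_polyC c : V c -> zeta_poly c%:P.
Proof. by move=> h i; rewrite coefC; case: ifP => _ //; exact: zeta_ring0. Qed.

Lemma zeta_polyZ c p : V c -> zeta_poly p -> zeta_poly (c *: p).
Proof. by move=> hc hp i; rewrite coefZ; exact: zr_mul. Qed.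

Lemma zeta_polyXn n : zeta_poly 'X^n.
Proof. by move=> i; rewrite coefXn; exact: zeta_ring_nat. Qed.

Lemma zeta_poly_exp p n : zeta_poly p -> zeta_poly (p ^+ n).
Proof.
move=> hp; elim: n => [|n IH]; last by rewrite exprS; exact: zeta_polyM.
exact: (zeta_polyXn 0).
Qed.

Lemma zeta_poly_sum n (F : 'I_n -> {poly R}) : (forall i, zeta_poly (F i)) ->
  zeta_poly (\sum_(i < n) F i).
Proof. by move=> h; apply: big_ind => //; [exact: zeta_poly0|exact: zeta_polyD]. Qed.

(** Divided differences: (p - p(m)) / (X - m) has smaller degree, and its value at a > m is (p(a) -
    p(m)) / (a - m), again in the ring. Raising the threshold to m + 1 avoids the zero denominator
    at a = m. *)
Lemma zeta_poly_nat_values (p : {poly R}) m : (forall a : nat, (m <= a)%N -> V p.[a%:R]) ->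
  zeta_poly p.
Proof.
have [n] := ubnP (size p); elim: n p m => // n IH p m; rewrite ltnS => sp h.
have [q qE] : exists q, p - p.[m%:R]%:P = q * ('X - m%:R%:P).
  by apply/factor_theorem; rewrite /root !hornerE subrr.
have pE : p = q * ('X - m%:R%:P) + p.[m%:R]%:P by rewrite -qE subrK.
have hq : zeta_poly q.
  have [->|q0] := eqVneq q 0; first exact: zeta_poly0.
  apply: (IH q m.+1).
    have sq : size (q * ('X - m%:R%:P)) = (size q).+1 by rewrite size_Mmonic ?monicXsubC // size_XsubC addn2.
    have : (size (p - p.[m%:R]%:P)%R <= maxn (size p) 1)%N.
      by rewrite (leq_trans (size_polyD _ _)) // size_polyN geq_max leq_max leqnn /= leq_max size_polyC_leq1 orbT.
    rewrite qE sq; case: (leqP (size p) 1) => sp1; last first.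
      by move=> /leq_trans; apply.
    rewrite ltnS leqn0 size_poly_eq0 => /eqP q00; by rewrite q00 eqxx in q0.
  move=> a ma.
  have am : a%:R - m%:R != 0 :> R by rewrite subr_eq0 eqr_nat gtn_eqF.
  have e : q.[a%:R] = (p.[a%:R] - p.[m%:R]) / (a - m)%:R.
    by rewrite natrB ?(ltnW ma) // {1}pE !hornerE addrK mulfK.
  rewrite e; apply: zr_mul (zeta_ring_natV _ _); apply: zeta_ringB; apply: h => //.
  exact: ltnW.
rewrite pE; apply: zeta_polyD; last by apply: zeta_polyC; exact: h.
apply: zeta_polyM => //; apply: zeta_polyD; first exact: (zeta_polyXn 1).
rewrite -polyCN; apply: zeta_polyC; apply: zeta_ringN; exact: zeta_ring_nat.
Qed.

End PolynomialCoefficients.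

(** * Comparison of the two expansions of Z along the line (a x, x) *)

Section MahlerCoefficients.
Variable R : realType.
Local Notation C := (Cx R).
Local Notation V := (@zeta_ring R).
Variables (a n : nat).
Let A : R := a%:R.

(** Along the line, [z k] and [l k] are the coefficients of x^k in Z and in the exponent of the zeta
    formula. *)
Let z (k : nat) : R := \sum_(i < k.+1) mahler_coef R i (k - i) * A ^+ i.
Let l (k : nat) : R := (-1) ^+ k / k%:R * zeta R k *
  ((1 - (2 ^+ k)^-1) * (A ^+ k + 1) - (2 ^+ k)^-1 * (A + 1) ^+ k).

Let s (x : R) : C := (x * A)%:C.
Let t (x : R) : C := x%:C.

Let mahlerE x k : mahler_term (s x) (t x) k = (z k * x ^+ k)%:C.
Proof.
rewrite /mahler_term /z big_distrl /= (rmorph_sum (real_complex R)) /=; apply: eq_bigr => i _.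
rewrite /s /t -!realCX -!realCM; congr (_%:C).
have -> : x ^+ k = x ^+ i * x ^+ (k - i) by rewrite -exprD subnKC // -ltnS.
by rewrite exprMn; ring.
Qed.

Let logZE x k : logZ_term (s x) (t x) k = (l k * x ^+ k)%:C.
Proof.
rewrite /logZ_term /l /s /t.
have -> : (x * A)%:C + x%:C = ((A + 1) * x)%:C :> C by rewrite -realCD mulrDl mul1r mulrC.
rewrite !(realCM, realCD, realCN, realCX, realCV, realC_nat, realC1) !exprMn.
by move: ((-1) ^+ k / k%:R : C) ((2 ^+ k)^-1 : C) => u v; ring.
Qed.

(** [M] truncates Z, [P] truncates its logarithm and [Q] truncates exp P. As [P] has no constant
    term, n terms of the exponential determine all coefficients below degree n. *)
Let M : {poly R} := \poly_(k < n) z k.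
Let P : {poly R} := \sum_(k < n) l k.+2 *: 'X^(k.+2).
Let Q : {poly R} := \sum_(j < n) (j`!%:R^-1) *: P ^+ j.

Let ME x : series (mahler_term (s x) (t x)) n = (M.[x])%:C.
Proof.
rewrite /series /= big_mkord horner_poly (rmorph_sum (real_complex R)).
by apply: eq_bigr => k _; rewrite mahlerE.
Qed.

Let PE x : series (fun k => logZ_term (s x) (t x) k.+2) n = (P.[x])%:C.
Proof.
rewrite /series /= big_mkord /P horner_sum (rmorph_sum (real_complex R)).
by apply: eq_bigr => k _; rewrite logZE hornerZ hornerXn.
Qed.

Let QE x : expT n (P.[x])%:C = (Q.[x])%:C.
Proof.
rewrite /expT /Q [in RHS]horner_sum [RHS](rmorph_sum (real_complex R)).
apply: eq_bigr => k _; rewrite hornerZ horner_exp /= realCM realCV realC_nat realCX.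
exact: mulrC.
Qed.

(** The three summands account for the errors between M and Z, between Z and exp P, and between exp
    P and Q. *)
Let K : R := mahler_const R * 4 ^+ n + logZ_const R * expR (6 * n%:R)
  + (6 * n%:R) ^+ n * expR (6 * n%:R).

Let MQ_bound x : 0 < x < (4 * (A + 1))^-1 -> `|(M - Q).[x]| <= (K * (A + 1) ^+ n) * x ^+ n.
Proof.
move=> /andP[x0 x1]; have A0 : 0 <= A := ler0n _ _.
(* [r] dominates both a x and x, and the range of x makes it at most 1/4. *)
pose r := (A + 1) * x.
have r0 : 0 <= r by rewrite mulr_ge0 ?(ltW x0) //; lra.
have r4 : r <= 4^-1.
  move: x1; rewrite invfM -ltr_pdivrMr ?invr_gt0 ?invrK; last by lra.
  by rewrite mulrC => /ltW.
have sr : cabs (s x) <= r.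
  by rewrite cabs_real ger0_norm ?mulr_ge0 ?(ltW x0) // mulrC ler_wpM2r ?(ltW x0) // lerDl.
have tr : cabs (t x) <= r.
  by rewrite cabs_real gtr0_norm // ler_peMl ?(ltW x0) // lerDr.
have E1 := Z_mahler_bound n r4 sr tr.
have E2 := Z_logZ_bound n r4 sr tr.
rewrite ME in E1; rewrite PE in E2.
set p : C := (P.[x])%:C in E2.
have r1 : r <= 1 by lra.
have pr : cabs p <= 6 * n%:R * r.
  rewrite /p -PE /series /= big_mkord.
  apply: le_trans (cabs_sum _ _ _) _.
  apply: (@le_trans _ _ (\sum_(k < n) 6 * r)).
    apply: ler_sum => k _; apply: le_trans (norm_logZ_term_le k sr tr) _.
    by rewrite ler_wpM2l // exprS ler_piMr // exprn_ile1.
  by rewrite sumr_const card_ord -[leLHS]mulr_natr mulrAC.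
have p6 : cabs p <= 6 * n%:R by rewrite (le_trans pr) // ler_piMr // mulr_ge0.
have E3 : cabs (cexp p - expT n p) <= (6 * n%:R) ^+ n * expR (6 * n%:R) * r ^+ n.
  apply: le_trans (cabs_cexp_sub_expT n p) _; rewrite [leRHS]mulrAC -exprMn; apply: ler_pM; rewrite ?expR_ge0 ?ler_expR //.
    by rewrite divr_ge0 // exprn_ge0 // cabs_ge0.
  apply: (@le_trans _ _ (cabs p ^+ n)).
    by rewrite ler_piMr ?exprn_ge0 ?cabs_ge0 // invf_le1 ?ltr0n ?fact_gt0 // ler1n fact_gt0.
  by rewrite lerXn2r ?nnegrE ?cabs_ge0 // (le_trans (cabs_ge0 _) pr).
have E4 : cabs (Z (s x) (t x) - cexp p) <= logZ_const R * expR (6 * n%:R) * r ^+ n.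
  have -> : Z (s x) (t x) - cexp p = (Z (s x) (t x) * cexp (- p) - 1) * cexp p.
    by rewrite mulrBl mul1r -mulrA cexpN_mul mulr1.
  rewrite cabsM mulrAC; apply: ler_pM; rewrite ?cabs_ge0 //.
    apply: le_trans E2 _; rewrite ler_wpM2l ?logZ_const_ge0 // -addn2 exprD ler_piMr ?exprn_ge0 //.
    by rewrite exprn_ile1.
  by rewrite (le_trans (cabs_cexp_le _)) // ler_expR.
rewrite -(cabs_real ((M - Q).[x])) hornerD hornerN realCD realCN -QE -/p.
have -> : (M.[x])%:C - expT n p = - (Z (s x) (t x) - (M.[x])%:C) + (Z (s x) (t x) - cexp p)
   + (cexp p - expT n p) by ring.
apply: le_trans (cabsD _ _) _; apply: (@le_trans _ _ (mahler_const R * 4 ^+ n * r ^+ n +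
   logZ_const R * expR (6 * n%:R) * r ^+ n + (6 * n%:R) ^+ n * expR (6 * n%:R) * r ^+ n)).
  apply: lerD => //; apply: le_trans (cabsD _ _) _; apply: lerD => //.
  by rewrite cabsN -mulrA -exprMn.
by rewrite -!mulrDl -mulrA -exprMn.
Qed.

(** Below degree n the coefficients of [M] are those of [Q], which is built from zeta values at
    integers from 2 on by rational operations. *)
Lemma zeta_ring_mahler_sum k : (k < n)%N -> V (z k).
Proof.
move=> kn; have A1 : 0 < A + 1 by have : 0 <= A := ler0n _ _; lra.
have d0 : 0 < (4 * (A + 1))^-1 by rewrite invr_gt0 mulr_gt0.
have := small_poly_coef d0 MQ_bound kn.
rewrite coefB coef_poly kn => /eqP; rewrite subr_eq0 => /eqP ->.
have VA m : V (A ^+ m) by apply: zeta_ringX; exact: zeta_ring_nat.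
have V2 m : V ((2 ^+ m)^-1) by rewrite -natrX; exact: zeta_ring_natV.
have V1 := zeta_ring1 R.
move: k {kn}; apply: zeta_poly_sum => j; apply: zeta_polyZ; first exact: zeta_ring_natV.
apply: zeta_poly_exp; apply: zeta_poly_sum => i; apply: zeta_polyZ (zeta_polyXn _ _).
apply: zr_mul; first apply: zr_mul.
- apply: zr_mul (zeta_ring_natV _ _); apply: zeta_ringX; exact: zeta_ringN.
- exact: zeta_ring_zeta.
- apply: zeta_ringB; apply: zr_mul => //; first exact: zeta_ringB.
    exact: zr_add.
  by apply: zeta_ringX; apply: zr_add => //; exact: zeta_ring_nat.
Qed.

End MahlerCoefficients.

Section MahlerMeasures.
Variable R : realType.

Lemma zeta_ring_mahler_coef i j : zeta_ring (mahler_coef R i j).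
Proof.
pose p : {poly R} := \poly_(u < (i + j).+1) mahler_coef R u (i + j - u).
have h : zeta_poly p.
  apply: (@zeta_poly_nat_values _ _ 0) => a _.
  by rewrite horner_poly; exact: (@zeta_ring_mahler_sum R a (i + j).+1).
by have := h i; rewrite coef_poly ltnS leq_addr addKn.
Qed.

Lemma zeta_ring_mxx k l : zeta_ring (mxx R k l).
Proof.
have f0 (m : nat) : m`!%:R != 0 :> R by rewrite pnatr_eq0 -lt0n fact_gt0.
have -> : mxx R k l = mahler_coef R k l * (k`!%:R * l`!%:R).
  by rewrite /mahler_coef divfK // mulf_neq0.
apply: zr_mul; first exact: zeta_ring_mahler_coef.
by apply: zr_mul; exact: zeta_ring_nat.
Qed.

End MahlerMeasures.

Unset Implicit Arguments.
Set Strict Implicit.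

Theorem theorem12 (R : realType) :
  (* (i) *)
  (forall s t : Cx R, -1 < complex.Re s -> -1 < complex.Re t ->
     Zxx s t = Gamma (s + 1) * Gamma (t + 1) /
               (Gamma (s / 2 + 1) * Gamma (t / 2 + 1) * Gamma ((s + t) / 2 + 1))
     /\ (fun N : nat => \prod_(1 <= n < N.+1)
            ((1 + s / (2 * n%:R)) * (1 + t / (2 * n%:R)) * (1 + (s + t) / (2 * n%:R)) /
             ((1 + s / n%:R) * (1 + t / n%:R)))) @ \oo --> Zxx s t)
  /\
  (* (ii) *)
  (exists2 delta : R, 0 < delta &
     forall s t : Cx R, `|s| < delta%:C -> `|t| < delta%:C ->
       exists2 L : Cx R,
         series (fun n : nat => logZ_term s t n.+2) @ \oo --> L &
         Zxx s t = cexp L)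
  /\
  (exists c : nat -> nat -> R, (forall i j, zeta_ring (c i j)) /\
     exists2 delta : R, 0 < delta &
       forall s t : Cx R, `|s| < delta%:C -> `|t| < delta%:C ->
         series (fun n : nat => \sum_(i < n.+1) (c i (n - i)%N)%:C * s ^+ i * t ^+ (n - i))
           @ \oo --> Zxx s t)
  /\
  (* (iii) *)
  (forall k l : nat, zeta_ring (@mxx R k l)).
Proof.
(* On discs of radius at most 1/4 the real parts exceed -1, so [Zxx] may be replaced by [Z]. *)
have small (s : Cx R) (d : R) : d <= 4^-1 -> cabs s < d -> -1 < Rez s.
  by move=> d4 sd; have := Re_le_cabs s; rewrite ler_norml => /andP[h _]; lra.
split; [|split; [|split]].
- move=> s t hs ht; rewrite (ZxxE hs ht); split; first exact: Z_Gamma.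
  exact: cvg_Z_product.
- exists 4^-1; first by rewrite invr_gt0.
  move=> s t; rewrite !cabs_lt => hs ht.
  by rewrite (ZxxE (small _ _ (lexx _) hs) (small _ _ (lexx _) ht)); exact: Z_exp_zeta.
- exists (mahler_coef R); split; first by move=> i j; exact: zeta_ring_mahler_coef.
  (* The radius at which the error of the truncated series decays like 2^(- n). *)
  exists 8^-1; first by rewrite invr_gt0.
  move=> s t; rewrite !cabs_lt => hs ht.
  have d4 : 8^-1 <= 4^-1 :> R by lra.
  rewrite (ZxxE (small _ _ d4 hs) (small _ _ d4 ht)); exact: cvg_mahler_series.
- exact: zeta_ring_mxx.
Qed.
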